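(* Let $n\ge1$ and let $\nu=(\nu_1,\dots,\nu_m)$ be a tuple of positive integers summing to $n$. With $Y_n$, its subalgebras $Y_\nu,Y_\nu^+,Y_\nu^-$ and the elements $D_{a;i,j}^{(r)}$, $E_{a,b;i,j}^{(r)}$, $F_{a,b;i,j}^{(r)}$ as defined in the context: (i) The set of all monomials in $\{D_{a;i,j}^{(r)}\}_{1\le a\le m,\,1\le i,j\le\nu_a,\,r\ge1}$ taken in some fixed order forms a basis for $Y_\nu$. (ii) The set of all monomials in $\{E_{a,b;i,j}^{(r)}\}_{1\le a<b\le m,\,1\le i\le\nu_a,\,1\le j\le\nu_b,\,r\ge1}$ taken in some fixed order forms a basis for $Y_\nu^+$. (iii) The set of all monomials in $\{F_{a,b;i,j}^{(r)}\}_{1\le a<b\le m,\,1\le i\le\nu_b,\,1\le j\le\nu_a,\,r\ge1}$ taken in some fixed order forms a basis for $Y_\nu^-$. (iv) The set of all monomials in the union of the elements listed in (i), (ii) and (iii) taken in some fixed order forms a basis for $Y_n$.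
   Context: All algebras are unital associative over $\mathbb C$. The Yangian $Y_n$ is the algebra with generators $T_{i,j}^{(r)}$ ($1\le i,j\le n$, $r\ge1$) and relations $$[T_{i,j}^{(r)},T_{h,k}^{(s)}]=\sum_{t=0}^{\min(r,s)-1}\left(T_{i,k}^{(r+s-1-t)}T_{h,j}^{(t)}-T_{i,k}^{(t)}T_{h,j}^{(r+s-1-t)}\right)$$ for $1\le h,i,j,k\le n$, $r,s\ge0$, where $T_{i,j}^{(0)}:=\delta_{i,j}$. Put $T_{i,j}(u)=\sum_{r\ge0}T_{i,j}^{(r)}u^{-r}\in Y_n[[u^{-1}]]$ and $T(u)=(T_{i,j}(u))_{1\le i,j\le n}$. Given $\nu$, the matrix $T(u)$ factors uniquely as $T(u)=F(u)D(u)E(u)$ where, in block form with respect to $\nu$, $D(u)$ is block diagonal with blocks $D_a(u)$ of size $\nu_a\times\nu_a$; $E(u)$ is block upper unitriangular with $(a,b)$-block $E_{a,b}(u)$ of size $\nu_a\times\nu_b$ ($a<b$); and $F(u)$ is block lower unitriangular with $(b,a)$-block denoted $F_{a,b}(u)$, of size $\nu_b\times\nu_a$ ($a<b$). Write entries as $D_{a;i,j}(u)=\sum_{r\ge0}D_{a;i,j}^{(r)}u^{-r}$, $E_{a,b;i,j}(u)=\sum_{r\ge1}E_{a,b;i,j}^{(r)}u^{-r}$, $F_{a,b;i,j}(u)=\sum_{r\ge1}F_{a,b;i,j}^{(r)}u^{-r}$, and put $E_{a;i,j}^{(r)}:=E_{a,a+1;i,j}^{(r)}$, $F_{a;i,j}^{(r)}:=F_{a,a+1;i,j}^{(r)}$.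 Equivalently, for $b>a+1$ the elements $E_{a,b;i,j}^{(r)}$, $F_{a,b;j,i}^{(r)}$ ($1\le i\le\nu_a$, $1\le j\le\nu_b$) are given inductively by $$E_{a,b;i,j}^{(r)}=[E_{a,b-1;i,k}^{(r)},E_{b-1;k,j}^{(1)}],\qquad F_{a,b;j,i}^{(r)}=[F_{b-1;j,k}^{(1)},F_{a,b-1;k,i}^{(r)}]$$ for any $1\le k\le\nu_{b-1}$ (the result is independent of $k$). $Y_\nu$, $Y_\nu^+$, $Y_\nu^-$ denote the subalgebras of $Y_n$ generated by all the $D_{a;i,j}^{(r)}$, all the $E_{a;i,j}^{(r)}$, and all the $F_{a;i,j}^{(r)}$, respectively. ''Monomials taken in some fixed order'' means: fix an arbitrary total order on the given set of elements and take all (finite) ordered products, with repetitions allowed, including the empty product $1$. *)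

(* Defs.v *)
From HB Require Import structures.
From mathcomp Require Import all_boot all_order all_algebra.
From mathcomp Require Import ring_quotient generic_quotient.
From mathcomp.multinomials Require Import monalg.
From mathcomp Require Import boolp classical_sets.
From mathcomp Require Import reals complex.

Set Implicit Arguments.
Unset Strict Implicit.
Unset Printing Implicit Defensive.

Import GRing.Theory.
Local Open Scope ring_scope.
Local Open Scope classical_set_scope.

Section LinearAlgebra.

Variables (K : comNzRingType).

Definition lin_indep (V : lmodType K) (J : eqType) (v : J -> V) : Prop :=
  forall (s : seq J) (c : J -> K), uniq s ->
    \sum_(j <- s) c j *: v j = 0 -> forall j, j \in s -> c j = 0.

Definition lin_span (V : lmodType K) (J : eqType) (v : J -> V) : set V :=
  [set x | exists (s : seq J) (c : J -> K), x = \sum_(j <- s) c j *: v j].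

Definition is_basis (V : lmodType K) (U : set V) (J : eqType) (v : J -> V) :
    Prop :=
  lin_indep v /\ lin_span v = U.

Definition generated_subalg (A : algType K) (S : set A) : set A :=
  smallest [set B : set A | GRing.subalg_closed (mem B)] S.

Definition total_order (I : Type) (le : rel I) : Prop :=
  [/\ reflexive le, antisymmetric le, transitive le & total le].

(* Ordered monomials are indexed by the weakly increasing sequences of indices, *)
(* so that linear independence also says that distinct sequences give distinct  *)
(* elements.                                                                    *)
Definition ordered_monomial (A : algType K) (I : choiceType) (x : I -> A)
    (le : rel I) (s : {s : seq I | sorted le s}) : A :=
  \prod_(i <- sval s) x i.

Definition ordered_monomials_basis (A : algType K) (I : choiceType)
    (x : I -> A) (U : set A) : Prop :=
  forall le : rel I, total_order le -> is_basis U (@ordered_monomial A I x le).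

End LinearAlgebra.

Definition two_sided_ideal (A : nzRingType) (I : set A) : Prop :=
  [/\ I 0, forall x y, I x -> I y -> I (x - y),
      forall a x, I x -> I (a * x) & forall a x, I x -> I (x * a)].

Lemma malg_scaleAr (K : comNzRingType) (M : monomType) (a : K)
    (x y : {malg K[M]}) :
  a *: (x * y) = x * (a *: y).
Proof.
apply/malgP=> k; rewrite mcoeffZ.
rewrite (@mcoeffMlw _ _ (msupp x) (msupp y)) //.
rewrite (@mcoeffMlw _ _ (msupp x) (msupp y)) ?msuppZ_le // mulr_sumr.
apply: eq_bigr => k1 _; rewrite mulr_sumr; apply: eq_bigr => k2 _.
by rewrite mcoeffZ mulrnAr mulrCA.
Qed.

(* The difference of the two sides of the defining relations of the Yangian.    *)
Definition yangian_relator (A : nzRingType) (n : nat)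
    (T : 'I_n -> 'I_n -> nat -> A) (i j h k : 'I_n) (r s : nat) : A :=
  (T i j r * T h k s - T h k s * T i j r) -
  \sum_(t < minn r s)
     (T i k (r + s - 1 - t)%N * T h j t
      - T i k t * T h j (r + s - 1 - t)%N).

Lemma rmorph_yangian_relator (A : nzRingType) (B : comNzRingType) (n : nat)
    (eps : {rmorphism A -> B}) (T : 'I_n -> 'I_n -> nat -> A) i j h k r s :
  (forall i j r, eps (T i j r) = ((r == 0)%N && (i == j))%:R) ->
  eps (yangian_relator T i j h k r s) = 0.
Proof.
move=> epsT; rewrite rmorphB rmorphB !rmorphM (mulrC (eps (T i j r))) subrr sub0r.
apply/eqP; rewrite oppr_eq0 rmorph_sum; apply/eqP/big1 => t _.
have /andP[tr ts] : (t < r)%N && (t < s)%N by rewrite -leq_min.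
have rst : (r + s - 1 - t != 0)%N.
  rewrite -lt0n subn_gt0 ltn_subRL add1n -[t.+2]addn1.
  by apply: leq_add => //; apply: leq_ltn_trans ts.
by rewrite rmorphB !rmorphM !epsT (negPf rst) /= mul0r mulr0 subr0.
Qed.

(* The Yangian of gl_n over K, as the quotient of the free algebra on the       *)
(* letters (i, j, r) by the two-sided ideal of the relations; the letter        *)
(* (i, j, r) stands for T_{i,j}^{(r+1)}.                                        *)
Section Yangian.

Variables (K : comNzRingType) (n : nat).

Definition ygen : choiceType := ('I_n * 'I_n * nat)%type.
Local Notation yfree := {malg K[{fmonom ygen}]}.

Definition yfreeT (i j : 'I_n) (r : nat) : yfree :=
  if r is r'.+1 then << fmu ((i, j, r') : ygen) >> else (i == j)%:R.

Definition yrelators : set yfree :=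
  [set x | exists i j h k r s, x = yangian_relator yfreeT i j h k r s].

Definition yideal_set : set yfree :=
  smallest [set I | two_sided_ideal I] yrelators.

Definition yideal : pred yfree := fun x => `[< yideal_set x >].

Lemma yidealP x : reflect (yideal_set x) (x \in yideal).
Proof. exact: asboolP. Qed.

Lemma yideal_setP : two_sided_ideal yideal_set.
Proof.
split=> [I [[]] //|x y Ix Iy I PI|a x Ix I PI|a x Ix I PI];
  case: (PI) => -[I0 IB Il Ir] _.
- by apply: IB; [apply: Ix|apply: Iy].
- by apply: Il; apply: Ix.
- by apply: Ir; apply: Ix.
Qed.

Lemma yideal_zmod_closed : zmod_closed yideal.
Proof.
have [I0 IB _ _] := yideal_setP.
by split=> [|x y /yidealP Ix /yidealP Iy]; apply/yidealP=> //; apply: IB.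
Qed.

HB.instance Definition _ :=
  GRing.isZmodClosed.Build yfree yideal yideal_zmod_closed.

Lemma yidealMl a x : x \in yideal -> a * x \in yideal.
Proof.
have [_ _ Il _] := yideal_setP.
by move=> /yidealP Ix; apply/yidealP; apply: Il.
Qed.

Lemma yidealMr a x : x \in yideal -> x * a \in yideal.
Proof.
have [_ _ _ Ir] := yideal_setP.
by move=> /yidealP Ix; apply/yidealP; apply: Ir.
Qed.

Lemma yidealZ (c : K) x : x \in yideal -> c *: x \in yideal.
Proof. by move=> Ix; rewrite -[x]mul1r scalerAl yidealMl. Qed.

Lemma yfreeT_counit i j r :
  mcoeff (@mone _) (yfreeT i j r) = ((r == 0)%N && (i == j))%:R.
Proof.
case: r => [|r] /=; first by rewrite rmorph_nat.
by rewrite mcoeffU1; case: eqP => // /(congr1 (@fmonom_val _)); rewrite fmU fm1.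
Qed.

(* The ideal is proper because the counit (the coefficient of the empty word)   *)
(* kills the relators.                                                          *)
Lemma yideal1 : 1 \notin yideal.
Proof.
apply/negP => /yidealP /(_ [set x | mcoeff (@mone _) x = 0]).
rewrite /= rmorph1 => H; suff /H/eqP : two_sided_ideal
    [set x : yfree | mcoeff (@mone _) x = 0] /\
    yrelators `<=` [set x | mcoeff (@mone _) x = 0] by rewrite oner_eq0.
split; first split=> /=.
- by rewrite rmorph0.
- by move=> x y x0 y0; rewrite rmorphB /= x0 y0 subr0.
- by move=> a x x0; rewrite rmorphM /= x0 mulr0.
- by move=> a x x0; rewrite rmorphM /= x0 mul0r.
move=> _ [i [j [h [k [r [s ->]]]]]].
exact: (@rmorph_yangian_relator _ _ _ (@mcoeff (fmonom ygen) K (@mone _)) _ _ _ _ _ _ _ yfreeT_counit).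
Qed.

Definition yideal_closed : zmodClosed yfree := GRing.ZmodClosed.clone _ yideal _.

Definition yangian : Type := Quotient.quot yideal_closed.

HB.instance Definition _ := GRing.Zmodule.on yangian.
HB.instance Definition _ : EqQuotient yfree _ yangian :=
  EqQuotient.on (Quotient.quot yideal_closed).

Definition ypi (x : yfree) : yangian := \pi_yangian%qT x.

Lemma ypi_surj (P : yangian -> Prop) : (forall x, P (ypi x)) -> forall u, P u.
Proof. by move=> H u; rewrite -[u]reprK; apply: H. Qed.

Lemma ypi_eq x y : ypi x = ypi y <-> x - y \in yideal.
Proof.
by rewrite (Quotient.idealrBE yideal_closed); split=> /eqP.
Qed.

Lemma ypi_repr x : repr (ypi x) - x \in yideal.
Proof. by apply/ypi_eq; rewrite /ypi reprK. Qed.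

Lemma ypiD x y : ypi (x + y) = ypi x + ypi y.
Proof. exact: (Quotient.pi_add yideal_closed). Qed.

Lemma ypiN x : ypi (- x) = - ypi x.
Proof. exact: (Quotient.pi_opp yideal_closed). Qed.

Lemma ypi0 : ypi 0 = 0.
Proof. by rewrite -(subrr 0) ypiD ypiN subrr. Qed.

Definition ymul (u v : yangian) : yangian := ypi (repr u * repr v).
Definition yscale (c : K) (u : yangian) : yangian := ypi (c *: repr u).

Lemma ypiM x y : ymul (ypi x) (ypi y) = ypi (x * y).
Proof.
apply/ypi_eq.
have -> : repr (ypi x) * repr (ypi y) - x * y
    = (repr (ypi x) - x) * repr (ypi y) + x * (repr (ypi y) - y).
  by rewrite mulrBl mulrBr addrA subrK.
have Ix := yidealMr (repr (ypi y)) (ypi_repr x).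
have Iy := yidealMl x (ypi_repr y).
exact: (rpredD Ix Iy).
Qed.

Lemma ypiZ c x : yscale c (ypi x) = ypi (c *: x).
Proof. by apply/ypi_eq; rewrite -scalerBr yidealZ ?ypi_repr. Qed.

Lemma ymulA : associative ymul.
Proof.
by do 3![elim/ypi_surj=> ?]; rewrite !ypiM mulrA.
Qed.

Lemma ymul1 : left_id (ypi 1) ymul.
Proof. by elim/ypi_surj=> x; rewrite ypiM mul1r. Qed.

Lemma ymulr1 : right_id (ypi 1) ymul.
Proof. by elim/ypi_surj=> x; rewrite ypiM mulr1. Qed.

Lemma ymulDl : left_distributive ymul +%R.
Proof.
by do 3![elim/ypi_surj=> ?]; rewrite !ypiM -!ypiD !ypiM mulrDl.
Qed.

Lemma ymulDr : right_distributive ymul +%R.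
Proof.
by do 3![elim/ypi_surj=> ?]; rewrite !ypiM -!ypiD !ypiM mulrDr.
Qed.

Lemma yone_neq0 : ypi 1 != 0.
Proof.
by rewrite -ypi0; apply: contraNneq yideal1 => /ypi_eq; rewrite subr0.
Qed.

HB.instance Definition _ := GRing.Zmodule_isNzRing.Build yangian
  ymulA ymul1 ymulr1 ymulDl ymulDr yone_neq0.

Lemma yscaleA a b u : yscale a (yscale b u) = yscale (a * b) u.
Proof. by elim/ypi_surj: u => x; rewrite !ypiZ scalerA. Qed.

Lemma yscale1 : left_id 1 yscale.
Proof. by elim/ypi_surj=> x; rewrite ypiZ scale1r. Qed.

Lemma yscaleDr : right_distributive yscale +%R.
Proof.
by move=> a; do 2![elim/ypi_surj=> ?]; rewrite !ypiZ -!ypiD ypiZ scalerDr.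
Qed.

Lemma yscaleDl u : {morph yscale^~ u : a b / a + b}.
Proof. by move=> a b; elim/ypi_surj: u => x; rewrite !ypiZ -ypiD scalerDl. Qed.

HB.instance Definition _ := GRing.Zmodule_isLmodule.Build K yangian
  yscaleA yscale1 yscaleDr yscaleDl.

Lemma yscaleAl (a : K) (u v : yangian) : a *: (u * v) = (a *: u) * v.
Proof.
elim/ypi_surj: u => x; elim/ypi_surj: v => y.
change (yscale a (ymul (ypi x) (ypi y)) = ymul (yscale a (ypi x)) (ypi y)).
by rewrite ypiM !ypiZ ypiM scalerAl.
Qed.

HB.instance Definition _ := GRing.Lmodule_isLalgebra.Build K yangian yscaleAl.

Lemma yscaleAr (a : K) (u v : yangian) : a *: (u * v) = u * (a *: v).
Proof.
elim/ypi_surj: u => x; elim/ypi_surj: v => y.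
change (yscale a (ymul (ypi x) (ypi y)) = ymul (ypi x) (yscale a (ypi y))).
by rewrite ypiM !ypiZ ypiM malg_scaleAr.
Qed.

HB.instance Definition _ := GRing.Lalgebra_isAlgebra.Build K yangian yscaleAr.

Definition yangianT (i j : 'I_n) (r : nat) : yangian := ypi (yfreeT i j r).

Lemma yangianT0 i j : yangianT i j 0 = (i == j)%:R.
Proof.
rewrite /yangianT /=; case: (i == j) => //=; exact: ypi0.
Qed.

Lemma yangianT_relation i j h k r s :
  yangian_relator yangianT i j h k r s = 0.
Proof.
have piM x y : ypi (x * y) = ypi x * ypi y := esym (ypiM x y).
have piB x y : ypi (x - y) = ypi x - ypi y by rewrite ypiD ypiN.
have piS := big_morph ypi ypiD ypi0.
have E : ypi (yangian_relator yfreeT i j h k r s)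
       = yangian_relator yangianT i j h k r s.
  have piC a b c d : ypi (a * b - c * d) = ypi a * ypi b - ypi c * ypi d.
    exact: (etrans (piB _ _) (f_equal2 (fun u v => u - v) (piM a b) (piM c d))).
  apply: etrans (piB _ _) _; congr (_ - _); first exact: piC.
  by apply: etrans (piS _ _ _ _) _; apply: eq_bigr => t _; apply: piC.
rewrite -E -ypi0; apply/ypi_eq; rewrite subr0; apply/yidealP => I [_]; apply.
by exists i, j, h, k, r, s.
Qed.

Definition yangianT_series (r : nat) : 'M[yangian]_n :=
  \matrix_(i, j) yangianT i j r.

Lemma yangianT_series0 : yangianT_series 0%N = 1%:M.
Proof. by apply/matrixP=> i j; rewrite !mxE yangianT0; case: eqP. Qed.

End Yangian.

(* A sequence of matrices f stands for the formal series sum_r f r u^(-r).      *)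
Section Gauss.

Variables (A : nzRingType) (m : nat) (nu : 'I_m -> nat).
Local Notation n := (\sum_a nu a)%N.
Implicit Types T F D E : nat -> 'M[A]_n.

Definition smul (f g : nat -> 'M[A]_n) : nat -> 'M[A]_n :=
  fun r => \sum_(t < r.+1) f t *m g (r - t)%N.

(* In T(u) = F(u) D(u) E(u), the off-diagonal blocks of F(u) and E(u) have no   *)
(* constant term.                                                               *)
Record gauss_factorization T F D E : Prop := GaussFactorization {
  gauss_mul : T = smul (smul F D) E;
  gauss_D_diag : forall r (a b : 'I_m), a != b -> submxblock (D r) a b = 0;
  gauss_E_upper : forall r (a b : 'I_m), (b < a)%N -> submxblock (E r) a b = 0;
  gauss_E_unit : forall r a, submxblock (E r) a a = (r == 0)%N%:R%:M;
  gauss_E_const : E 0%N = 1%:M;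
  gauss_F_lower : forall r (a b : 'I_m), (a < b)%N -> submxblock (F r) a b = 0;
  gauss_F_unit : forall r a, submxblock (F r) a a = (r == 0)%N%:R%:M;
  gauss_F_const : F 0%N = 1%:M
}.

Definition scross (f g : nat -> 'M[A]_n) (r : nat) : 'M[A]_n :=
  \sum_(1 <= t < r) f t *m g (r - t)%N.

Lemma smulE f g r : f 0%N = 1%:M -> g 0%N = 1%:M -> (0 < r)%N ->
  smul f g r = f r + g r + scross f g r.
Proof.
case: r => // r f0 g0 _; rewrite /smul /scross.
rewrite -(big_mkord xpredT (fun t => f t *m g (r.+1 - t)%N)).
rewrite big_ltn // big_nat_recr //= subn0 subnn f0 g0 mul1mx mulmx1.
by rewrite addrA addrC addrA.
Qed.

Lemma eq_scross f g f' g' r :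
    (forall t, (t < r)%N -> f t = f' t) -> (forall t, (t < r)%N -> g t = g' t) ->
  scross f g r = scross f' g' r.
Proof.
move=> ff' gg'; rewrite /scross big_nat_cond [RHS]big_nat_cond.
apply: eq_bigr => t /andP[/andP[t0 tr] _].
by rewrite (ff' _ tr) gg' // ltn_subrL t0 (leq_ltn_trans _ tr).
Qed.

Lemma eq_smul f g f' g' r :
    (forall t, (t <= r)%N -> f t = f' t) -> (forall t, (t <= r)%N -> g t = g' t) ->
  smul f g r = smul f' g' r.
Proof.
move=> ff' gg'; apply: eq_bigr => t _.
have tr : (t <= r)%N by rewrite -ltnS.
by rewrite (ff' _ tr) (gg' _ (leq_subr _ _)).
Qed.

Lemma smul0 f g : smul f g 0%N = f 0%N *m g 0.
Proof. by rewrite /smul big_ord1. Qed.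

Definition lower_part (W : 'M[A]_n) : 'M[A]_n := \matrix_(i, j)
  if (tagnat.sig1 j < tagnat.sig1 i)%N then W i j else 0.
Definition diag_part (W : 'M[A]_n) : 'M[A]_n := \matrix_(i, j)
  if tagnat.sig1 j == tagnat.sig1 i then W i j else 0.
Definition upper_part (W : 'M[A]_n) : 'M[A]_n := \matrix_(i, j)
  if (tagnat.sig1 i < tagnat.sig1 j)%N then W i j else 0.

Lemma part_sum W : W = lower_part W + diag_part W + upper_part W.
Proof.
apply/matrixP=> i j; rewrite !mxE -val_eqE /=.
by case: ltngtP; rewrite ?addr0 ?add0r.
Qed.

Definition gauss_rest T F D E r : 'M[A]_n :=
  T r - scross F D r - scross (smul F D) E r.

Definition gauss_step T (X : nat -> 'M[A]_n * 'M[A]_n * 'M[A]_n) r :=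
  let W := gauss_rest T (fun t => (X t).1.1) (fun t => (X t).1.2)
                      (fun t => (X t).2) r in
  (lower_part W, diag_part W, upper_part W).

Fixpoint gauss_approx T N : nat -> 'M[A]_n * 'M[A]_n * 'M[A]_n :=
  if N is N'.+1 then
    fun r => if r == N then gauss_step T (gauss_approx T N') N
             else gauss_approx T N' r
  else fun _ => (1%:M, 1%:M, 1%:M).

Lemma gauss_approxE T N r : (r <= N)%N ->
  gauss_approx T N r = gauss_approx T r r.
Proof.
elim: N => [|N IHN]; first by rewrite leqn0 => /eqP ->.
by rewrite leq_eqVlt => /orP[/eqP-> //|rN] /=; rewrite ltn_eqF // IHN.
Qed.

Lemma eq_gauss_rest T F D E F' D' E' r :
    (forall t, (t < r)%N -> F t = F' t) -> (forall t, (t < r)%N -> D t = D' t) ->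
    (forall t, (t < r)%N -> E t = E' t) ->
  gauss_rest T F D E r = gauss_rest T F' D' E' r.
Proof.
move=> eF eD eE; congr (_ - _ - _); apply: eq_scross => // t tr.
by apply: eq_smul => k kt; [apply: eF|apply: eD]; apply: leq_ltn_trans tr.
Qed.

Lemma smul3E F D E r :
    F 0%N = 1%:M -> D 0%N = 1%:M -> E 0%N = 1%:M -> (0 < r)%N ->
  smul (smul F D) E r =
    F r + D r + E r + (scross F D r + scross (smul F D) E r).
Proof.
move=> F0 D0 E0 r0; rewrite smulE ?smul0 ?F0 ?D0 ?mul1mx //.
by rewrite smulE // -!addrA; do 2!congr (_ + _); rewrite addrCA.
Qed.

Lemma Rank_eqE a b (i : 'I_(nu a)) (j : 'I_(nu b)) :
  (tagnat.Rank a i == tagnat.Rank b j)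
    = (Tagged (fun c => 'I_(nu c)) i == Tagged (fun c => 'I_(nu c)) j).
Proof. by rewrite (inj_eq (@tagnat.rank_inj _ _)). Qed.

Lemma submxblock1_neq a b : a != b -> submxblock (1%:M : 'M[A]_n) a b = 0.
Proof.
move=> ab; apply/matrixP=> i j; rewrite !mxE Rank_eqE.
by case: eqP => // /(congr1 tag)/eqP; rewrite /= (negPf ab).
Qed.

Lemma submxblock1 a : submxblock (1%:M : 'M[A]_n) a a = 1%:M.
Proof. by apply/matrixP=> i j; rewrite !mxE Rank_eqE eq_Tagged. Qed.

Lemma gauss_exists T : T 0%N = 1%:M ->
  exists FDE : (nat -> 'M[A]_n) * (nat -> 'M[A]_n) * (nat -> 'M[A]_n),
    gauss_factorization T FDE.1.1 FDE.1.2 FDE.2.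
Proof.
move=> T0; pose X r := gauss_approx T r r.
pose F r := (X r).1.1; pose D r := (X r).1.2; pose E r := (X r).2.
exists (F, D, E) => /=.
have XS r : X r.+1 = gauss_step T X r.+1.
  rewrite /X /= eqxx /gauss_step.
  by congr (lower_part _, diag_part _, upper_part _); apply: eq_gauss_rest => t;
    rewrite ltnS => /gauss_approxE ->.
have FS r : F r.+1 = lower_part (gauss_rest T F D E r.+1) by rewrite /F XS.
have DS r : D r.+1 = diag_part (gauss_rest T F D E r.+1) by rewrite /D XS.
have ES r : E r.+1 = upper_part (gauss_rest T F D E r.+1) by rewrite /E XS.
split=> //.
- apply: functional_extensionality_dep => -[|r]; first by rewrite !smul0 !mulmx1.
  rewrite smul3E // FS DS ES -part_sum /gauss_rest.
  by rewrite -[T r.+1 - _ - _]addrA -opprD subrK.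
- move=> [|r] a b ab; first exact: submxblock1_neq.
  rewrite DS; apply/matrixP=> i j; rewrite !mxE !tagnat.Rank1K.
  by rewrite eq_sym (negPf ab).
- move=> [|r] a b ab; first by rewrite submxblock1_neq // eq_sym neq_ltn ab.
  rewrite ES; apply/matrixP=> i j; rewrite !mxE !tagnat.Rank1K.
  by rewrite ltnNge (ltnW ab).
- move=> [|r] a; first exact: submxblock1.
  by rewrite ES; apply/matrixP=> i j; rewrite !mxE !tagnat.Rank1K ltnn mul0rn.
- move=> [|r] a b ab; first by rewrite submxblock1_neq // neq_ltn ab.
  rewrite FS; apply/matrixP=> i j; rewrite !mxE !tagnat.Rank1K.
  by rewrite ltnNge (ltnW ab).
- move=> [|r] a; first exact: submxblock1.
  by rewrite FS; apply/matrixP=> i j; rewrite !mxE !tagnat.Rank1K ltnn mul0rn.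
Qed.

Lemma gauss_unique T F D E F' D' E' : T 0%N = 1%:M ->
    gauss_factorization T F D E -> gauss_factorization T F' D' E' ->
  [/\ F = F', D = D' & E = E'].
Proof.
move=> T0 G G'.
have D0 : D 0%N = 1%:M.
  move: T0; rewrite (gauss_mul G) !smul0 (gauss_F_const G) (gauss_E_const G).
  by rewrite mul1mx mulmx1.
have D0' : D' 0%N = 1%:M.
  move: T0; rewrite (gauss_mul G') !smul0 (gauss_F_const G') (gauss_E_const G').
  by rewrite mul1mx mulmx1.
suff H r : [/\ F r = F' r, D r = D' r & E r = E' r].
  by split; apply: functional_extensionality_dep => r; have [] := H r.
elim/ltn_ind: r => -[_|r IH].
  by rewrite D0 D0' (gauss_F_const G) (gauss_E_const G) (gauss_F_const G')
    (gauss_E_const G').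
have sumE F1 D1 E1 : gauss_factorization T F1 D1 E1 -> D1 0%N = 1%:M ->
    F1 r.+1 + D1 r.+1 + E1 r.+1 = gauss_rest T F1 D1 E1 r.+1.
  move=> G1 D10; rewrite /gauss_rest {1}(gauss_mul G1).
  rewrite smul3E ?(gauss_F_const G1) ?(gauss_E_const G1) //.
  by rewrite -[RHS]addrA -opprD addrK.
have restE : gauss_rest T F D E r.+1 = gauss_rest T F' D' E' r.+1.
  by apply: eq_gauss_rest => t /IH[].
have := sumE _ _ _ G' D0'; rewrite -restE -(sumE _ _ _ G D0) => {}sumE.
have blk a b : submxblock (F r.+1) a b + submxblock (D r.+1) a b
    + submxblock (E r.+1) a b = submxblock (F' r.+1) a b
    + submxblock (D' r.+1) a b + submxblock (E' r.+1) a b.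
  by rewrite -!submxblockD sumE.
have red a b : [/\ submxblock (F r.+1) a b = submxblock (F' r.+1) a b,
    submxblock (D r.+1) a b = submxblock (D' r.+1) a b
  & submxblock (E r.+1) a b = submxblock (E' r.+1) a b].
  have := blk a b; case: (ltngtP a b) => [ab|ab|/val_inj ab].
  - have nab : a != b by rewrite neq_ltn ab.
    rewrite (gauss_F_lower G) // (gauss_F_lower G') // (gauss_D_diag G) //.
    by rewrite (gauss_D_diag G') // !add0r.
  - have nab : a != b by rewrite neq_ltn ab orbT.
    rewrite (gauss_E_upper G) // (gauss_E_upper G') // (gauss_D_diag G) //.
    by rewrite (gauss_D_diag G') // !addr0.
  - rewrite {}ab (gauss_E_unit G) (gauss_E_unit G') (gauss_F_unit G).
    by rewrite (gauss_F_unit G') /= => /addIr/addrI.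
by split; apply/mxblockP => a b; have [] := red a b.
Qed.

End Gauss.

(* The factorization T(u) = F(u) D(u) E(u) over the Yangian of gl_n, where      *)
(* n = nu_1 + ... + nu_m. Blocks are indexed from 0, and so are their entries.  *)
Section Parabolic.

Variables (K : comNzRingType) (m : nat) (nu : 'I_m -> nat).
Local Notation Y := (yangian K (\sum_a nu a)%N).

Definition yangianFDE :=
  sval (cid (gauss_exists (yangianT_series0 K (\sum_a nu a)%N))).

Definition yangianF := yangianFDE.1.1.
Definition yangianD := yangianFDE.1.2.
Definition yangianE := yangianFDE.2.

Lemma yangian_gauss :
  gauss_factorization (@yangianT_series K _) yangianF yangianD yangianE.
Proof. exact: svalP (cid (gauss_exists _)). Qed.

Definition coefD (a : 'I_m) (i j : 'I_(nu a)) (r : nat) : Y :=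
  submxblock (yangianD r) a a i j.

Definition coefE (a b : 'I_m) (i : 'I_(nu a)) (j : 'I_(nu b)) (r : nat) : Y :=
  submxblock (yangianE r) a b i j.

(* F_{a,b} is the block in position (b, a). *)
Definition coefF (a b : 'I_m) (i : 'I_(nu b)) (j : 'I_(nu a)) (r : nat) : Y :=
  submxblock (yangianF r) b a i j.

Definition subalgD : set Y := generated_subalg
  [set x | exists (a : 'I_m) (i j : 'I_(nu a)) (r : nat), x = coefD i j r].

Definition subalgE : set Y := generated_subalg
  [set x | exists (a b : 'I_m) (i : 'I_(nu a)) (j : 'I_(nu b)) (r : nat),
    [/\ b = a.+1 :> nat, (1 <= r)%N & x = coefE i j r]].

Definition subalgF : set Y := generated_subalg
  [set x | exists (a b : 'I_m) (i : 'I_(nu b)) (j : 'I_(nu a)) (r : nat),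
    [/\ b = a.+1 :> nat, (1 <= r)%N & x = coefF i j r]].

Definition block_pair := {p : 'I_m * 'I_m | (p.1 < p.2)%N}.

(* In the index types below, the last component r stands for the exponent r+1.  *)
Definition indexD := {a : 'I_m & ('I_(nu a) * 'I_(nu a) * nat)%type}.
Definition indexE :=
  {p : block_pair & ('I_(nu (sval p).1) * 'I_(nu (sval p).2) * nat)%type}.
Definition indexF :=
  {p : block_pair & ('I_(nu (sval p).2) * 'I_(nu (sval p).1) * nat)%type}.

HB.instance Definition _ := Choice.on indexD.
HB.instance Definition _ := Choice.on indexE.
HB.instance Definition _ := Choice.on indexF.

Definition familyD (x : indexD) : Y :=
  let: existT _ (i, j, r) := x in coefD i j r.+1.
Definition familyE (x : indexE) : Y :=
  let: existT _ (i, j, r) := x in coefE i j r.+1.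
Definition familyF (x : indexF) : Y :=
  let: existT _ (i, j, r) := x in coefF i j r.+1.

Definition familyDEF (x : indexD + indexE + indexF) : Y :=
  match x with
  | inl (inl d) => familyD d
  | inl (inr e) => familyE e
  | inr f => familyF f
  end.

End Parabolic.

(* Main.v *)
Require Import Defs.
From HB Require Import structures.
From mathcomp Require Import all_boot all_order all_algebra zify.
From mathcomp.multinomials Require Import monalg.
From mathcomp Require Import boolp classical_sets.
From mathcomp Require Import reals complex.

Set Implicit Arguments.
Unset Strict Implicit.
Unset Printing Implicit Defensive.

Import Order.TTheory GRing.Theory Num.Theory.
Local Open Scope ring_scope.

(** The Yangian is studied through the relation
      (u - v) [T_ij(u), T_hk(v)] = T_hj(u) T_ik(v) - T_hj(v) T_ik(u),
    an identity of series in x = 1/u and y = 1/v, where u - v becomes a central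
    nonzerodivisor. The proof has two independent halves.

    Spanning. Let a cut split the indices into the blocks up to k and the others.
    If T(u) = F(u) D(u) E(u), the rows of E(u) in block k are rows of
    Y_k = E^-1 pi_k E, with pi_k the projection to the blocks up to k. One has
    Y_k = N T, where N is the inverse of the corner of T below the cut, and
    1 - Y_l = S M, where S = T^-1 and M is the inverse of the corner of S above
    the cut l. Since [T_ij(u), S_hp(v)] has a single term when i is below both
    cuts and p above them, the commutator of the entries of Y_k(u) with those of
    1 - Y_l(v) closes up (cuts_comm): multiplied by (u - v)^2, it is a polynomial
    in the same entries. Hence the commutator of E^(r) and E^(s) is a combination of
    products of coefficients of E of total degree at most r + s - 1
    (E_commutator), and reordering words terminates (span_ordered_monomials). For
    all the coefficients of F, D and E together this is clear, since Y_n is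
    commutative up to lower degree. One coefficient of the same identity gives
    E_ac^(r) = [E_ab^(r), E_bc^(1)] (E_adjacent), so the E_{a,a+1} generate. The
    blocks D_a satisfy the defining relations of smaller Yangians because these pass
    to corners and, with u and v exchanged, to inverses (rtt_inv); distinct blocks commute
    because a lower corner of T commutes with an upper corner of S. The statements
    on F are those on E for the transposed matrix over the opposite ring.

    Independence. With zeta an indeterminate and e_ij matrix units of size n + 1
    that avoid one index, T(u) |-> T(u) (1 + e/(u - zeta)) defines a homomorphism
    from Y_n to matrices over Y_n[zeta] (yangian_coaction). Taking the coefficient
    of e_ij zeta^r modulo scalar matrices gives an operator that, up to words of
    lower weight, is the partial derivative along T_ij^(r+1) (partial_mon). The weight
    of a word is twice its loop degree plus its length. A combination of words of
    one weight that equals words of lower weight has derivatives with the same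
    property, so by induction its coefficients vanish (mon_independent). Finally F_ij^(r), D_ij^(r) and E_ij^(r) agree with
    T_ij^(r) up to products of lower weight (gauss_leading), in complementary
    positions (i, j), so their ordered monomials are independent as well. *)

(** * Formal power series *)

Definition ps (A : Type) : Type := nat -> A.

HB.instance Definition _ (A : Type) := gen_eqMixin (ps A).
HB.instance Definition _ (A : Type) := gen_choiceMixin (ps A).

Lemma psP (A : Type) (f g : ps A) : f =1 g -> f = g.
Proof. exact: funext. Qed.

Section PowerSeriesRing.
Variable A : nzRingType.
Implicit Types f g h : ps A.

Definition ps_zero : ps A := fun=> 0.
Definition ps_add f g : ps A := fun r => f r + g r.
Definition ps_opp f : ps A := fun r => - f r.
Definition ps_one : ps A := fun r => (r == 0)%N%:R.
Definition ps_mul f g : ps A := fun r => \sum_(t < r.+1) f t * g (r - t)%N.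

Lemma ps_addA : associative ps_add.
Proof. by move=> f g h; apply: psP => r; apply: addrA. Qed.
Lemma ps_addC : commutative ps_add.
Proof. by move=> f g; apply: psP => r; apply: addrC. Qed.
Lemma ps_add0 : left_id ps_zero ps_add.
Proof. by move=> f; apply: psP => r; apply: add0r. Qed.
Lemma ps_addN : left_inverse ps_zero ps_opp ps_add.
Proof. by move=> f; apply: psP => r; apply: addNr. Qed.

HB.instance Definition _ :=
  GRing.isZmodule.Build (ps A) ps_addA ps_addC ps_add0 ps_addN.

(* The ring laws are those of polynomials, as a coefficient of a product only   *)
(* involves truncations of the factors.                                         *)
Let trunc N f : {poly A} := \poly_(i < N) f i.

Lemma trunc_mul N f g r : (r < N)%N -> ps_mul f g r = (trunc N f * trunc N g)`_r.
Proof.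
move=> rN; rewrite coefM; apply: eq_bigr => t _; rewrite !coef_poly.
by rewrite (leq_ltn_trans _ rN) ?(leq_ltn_trans _ rN) ?leq_subr // -ltnS.
Qed.

Lemma ps_mulA : associative ps_mul.
Proof.
move=> f g h; apply: psP => r.
have E (p q : {poly A}) : (forall t, (t <= r)%N -> p`_t = q`_t) ->
    forall k, (trunc r.+1 k * p)`_r = (trunc r.+1 k * q)`_r
           /\ (p * trunc r.+1 k)`_r = (q * trunc r.+1 k)`_r.
  move=> pq k; rewrite !coefM; split; apply: eq_bigr => t _; rewrite pq //.
    exact: leq_subr.
  by rewrite -ltnS.
have F u v t : (t <= r)%N -> (trunc r.+1 (ps_mul u v))`_t
    = (trunc r.+1 u * trunc r.+1 v)`_t.
  by move=> tr; rewrite coef_poly ltnS tr (@trunc_mul r.+1).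
rewrite !(@trunc_mul r.+1) //.
have [-> _] := E _ _ (F g h) f; have [_ ->] := E _ _ (F f g) h.
by rewrite mulrA.
Qed.

Lemma ps_mul1 : left_id ps_one ps_mul.
Proof.
move=> f; apply: psP => r; rewrite /ps_mul big_ord_recl mul1r subn0.
by rewrite big1 ?addr0 // => i _; rewrite mul0r.
Qed.
Lemma ps_mulr1 : right_id ps_one ps_mul.
Proof.
move=> f; apply: psP => r; rewrite /ps_mul big_ord_recr /= subnn mulr1.
rewrite big1 ?add0r // => i _.
by rewrite /ps_one eqn0Ngt subn_gt0 ltn_ord mulr0.
Qed.
Lemma ps_mulDl : left_distributive ps_mul ps_add.
Proof.
move=> f g h; apply: psP => r; rewrite /ps_mul /ps_add -big_split /=.
by apply: eq_bigr => t _; rewrite mulrDl.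
Qed.
Lemma ps_mulDr : right_distributive ps_mul ps_add.
Proof.
move=> f g h; apply: psP => r; rewrite /ps_mul /ps_add -big_split /=.
by apply: eq_bigr => t _; rewrite mulrDr.
Qed.
Lemma ps_1neq0 : ps_one != 0.
Proof.
by apply/eqP => /(congr1 (fun f : ps A => f 0%N))/eqP; rewrite oner_eq0.
Qed.

HB.instance Definition _ := GRing.Zmodule_isNzRing.Build (ps A)
  ps_mulA ps_mul1 ps_mulr1 ps_mulDl ps_mulDr ps_1neq0.

Lemma psD f g r : (f + g) r = f r + g r. Proof. by []. Qed.
Lemma psN f r : (- f) r = - f r. Proof. by []. Qed.
Lemma ps0 r : (0 : ps A) r = 0. Proof. by []. Qed.
Lemma ps1 r : (1 : ps A) r = (r == 0)%N%:R. Proof. by []. Qed.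
Lemma psM f g r : (f * g) r = \sum_(t < r.+1) f t * g (r - t)%N.
Proof. by []. Qed.
Lemma psB f g r : (f - g) r = f r - g r. Proof. by []. Qed.
Lemma ps_sum I (s : seq I) (P : pred I) (F : I -> ps A) r :
  (\sum_(i <- s | P i) F i) r = \sum_(i <- s | P i) F i r.
Proof. exact: (big_morph (fun f : ps A => f r) (fun f g => psD f g r) (ps0 r)). Qed.

Definition psX : ps A := fun r => (r == 1)%N%:R.

Lemma psXM f r : (psX * f) r = if r is r'.+1 then f r' else 0.
Proof.
rewrite psM; case: r => [|r]; first by rewrite big_ord1 mul0r.
rewrite big_ord_recl mul0r add0r big_ord_recl /= mul1r subn1 /=.
by rewrite big1 ?addr0 // => i _; rewrite mul0r.
Qed.

Lemma psX_comm f : psX * f = f * psX.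
Proof.
apply: psP => r; rewrite psXM psM; case: r => [|r].
  by rewrite big_ord1 mulr0.
rewrite big_ord_recr /= subnn mulr0 addr0 big_ord_recr /= subSn // subnn mulr1.
rewrite big1 ?add0r // => i _.
by rewrite /psX subSn ?(ltnW (ltn_ord i)) //= eqSS subn_eq0 leqNgt ltn_ord mulr0.
Qed.

End PowerSeriesRing.
Arguments psX {A}.

Lemma ps_commr (A : nzRingType) (f g : ps A) :
  (forall r s, GRing.comm (f r) (g s)) -> GRing.comm f g.
Proof.
move=> fg; apply: psP => r; rewrite !psM (reindex_inj rev_ord_inj) /=.
by apply: eq_bigr => t _; rewrite subSS fg subKn // -ltnS.
Qed.

Section PowerSeriesMorphisms.
Variables (A : nzRingType).

Definition psC (a : A) : ps A := fun r => if r is 0%N then a else 0.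

Lemma psCM a (f : ps A) r : (psC a * f) r = a * f r.
Proof.
rewrite psM big_ord_recl /= subn0 big1 ?addr0 // => i _; exact: mul0r.
Qed.
Lemma psMC a (f : ps A) r : (f * psC a) r = f r * a.
Proof.
rewrite psM big_ord_recr /= subnn big1 ?add0r // => i _.
by rewrite /psC; case: (r - i)%N (subn_gt0 i r) => [|k]; rewrite ?ltn_ord // mulr0.
Qed.

Lemma psC_zmod : zmod_morphism psC.
Proof. by move=> a b; apply: psP => -[|r] //; rewrite psB /= subr0. Qed.
Lemma psC_monoid : monoid_morphism psC.
Proof.
split=> [|a b]; first by apply: psP => -[].
by apply: psP => -[|r]; rewrite psCM //= mulr0.
Qed.
HB.instance Definition _ := GRing.isZmodMorphism.Build A (ps A) psC psC_zmod.
HB.instance Definition _ := GRing.isMonoidMorphism.Build A (ps A) psC psC_monoid.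

Definition ps_const (f : ps A) : A := f 0%N.

Lemma ps_const_zmod : zmod_morphism ps_const. Proof. by []. Qed.
Lemma ps_const_monoid : monoid_morphism ps_const.
Proof. by split=> // f g; rewrite /ps_const psM big_ord1. Qed.
HB.instance Definition _ := GRing.isZmodMorphism.Build (ps A) A ps_const ps_const_zmod.
HB.instance Definition _ := GRing.isMonoidMorphism.Build (ps A) A ps_const ps_const_monoid.

Variables (B : nzRingType) (phi : {rmorphism A -> B}).

Definition psmap (f : ps A) : ps B := fun r => phi (f r).

Lemma psmap_zmod : zmod_morphism psmap.
Proof. by move=> a b; apply: psP => r; rewrite /psmap !psB rmorphB. Qed.
Lemma psmap_monoid : monoid_morphism psmap.
Proof.
split=> [|a b]; apply: psP => r; rewrite /psmap; first by rewrite !ps1 rmorph_nat.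
by rewrite psM rmorph_sum; apply: eq_bigr => t _; rewrite rmorphM.
Qed.
HB.instance Definition _ := GRing.isZmodMorphism.Build (ps A) (ps B) psmap psmap_zmod.
HB.instance Definition _ :=
  GRing.isMonoidMorphism.Build (ps A) (ps B) psmap psmap_monoid.

End PowerSeriesMorphisms.

(** Series in x with coefficients series in y, so that the ring laws come from
    the case of one variable. The difference y - x stands for u - v up to the
    factor xy. *)
Section TwoVariables.
Variable A : nzRingType.
Local Notation B := (ps (ps A)).

Definition inx : ps A -> B := psmap (@psC A).
Definition iny : ps A -> B := @psC (ps A).
HB.instance Definition _ := GRing.RMorphism.on inx.
HB.instance Definition _ := GRing.RMorphism.on iny.

Definition varx : B := psX.
Definition vary : B := psC psX.
Definition vdiff : B := vary - varx.
Definition vprod : B := varx * vary.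

Lemma inx_iny f g r s : (inx f * iny g) r s = f r * g s.
Proof. by rewrite psMC psCM. Qed.
Lemma iny_inx f g r s : (iny g * inx f) r s = g s * f r.
Proof. by rewrite psCM /inx /psmap psMC. Qed.

Lemma varxM (f : B) r s : (varx * f) r s = if r is r'.+1 then f r' s else 0.
Proof. by rewrite psXM; case: r. Qed.
Lemma varyM (f : B) r s : (vary * f) r s = if s is s'.+1 then f r s' else 0.
Proof. by rewrite psCM psXM. Qed.

Lemma varx_comm (f : B) : GRing.comm varx f. Proof. exact: psX_comm. Qed.
Lemma vary_comm (f : B) : GRing.comm vary f.
Proof. by apply: psP => r; rewrite psCM psMC psX_comm. Qed.
Lemma vdiff_comm (f : B) : GRing.comm vdiff f.
Proof. by apply/commr_sym/commrB; apply/commr_sym; [exact: vary_comm|exact: varx_comm]. Qed.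
Lemma vprod_comm (f : B) : GRing.comm vprod f.
Proof. by apply/commr_sym/commrM; apply/commr_sym; [exact: varx_comm|exact: vary_comm]. Qed.

Lemma vdiffM (f : B) r s : (vdiff * f) r s =
  (if s is s'.+1 then f r s' else 0) - (if r is r'.+1 then f r' s else 0).
Proof. by rewrite mulrBl !psB varxM varyM. Qed.
Lemma vprodM (f : B) r s :
  (vprod * f) r s = if r is r'.+1 then if s is s'.+1 then f r' s' else 0 else 0.
Proof. by rewrite -mulrA varxM; case: r => // r; rewrite varyM. Qed.

Lemma vdiff_reg (f : B) : vdiff * f = 0 -> f = 0.
Proof.
move=> f0; apply: psP => r; apply: psP => s; rewrite !ps0.
elim: r s => [|r IH] s.
  by have := congr1 (fun h : B => h 0%N s.+1) f0; rewrite /= vdiffM subr0.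
by have := congr1 (fun h : B => h r.+1 s.+1) f0; rewrite /= vdiffM IH subr0.
Qed.

Lemma vdiff_lreg : GRing.lreg vdiff.
Proof.
by move=> f g /= fg; apply/eqP; rewrite -subr_eq0; apply/eqP/vdiff_reg; rewrite mulrBr fg subrr.
Qed.

End TwoVariables.

(** * Commutators and corners of matrices *)

Section Commutators.
Variables (B : nzRingType) (n : nat).
Implicit Types (P Q : pred 'I_n) (K M N T : 'M[B]_n) (c z p : B).

Definition diag_pr P : 'M[B]_n := \matrix_(i, j) ((i == j) && P i)%:R.

Lemma diag_prM P M i j : (diag_pr P *m M) i j = (P i)%:R * M i j.
Proof.
rewrite mxE (bigD1 i) //= big1 ?addr0 ?mxE ?eqxx // => k ki.
by rewrite mxE eq_sym (negPf ki) mul0r.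
Qed.
Lemma Mdiag_pr P M i j : (M *m diag_pr P) i j = M i j * (P j)%:R.
Proof.
rewrite mxE (bigD1 j) //= big1 ?addr0 ?mxE ?eqxx // => k ki.
by rewrite mxE (negPf ki) mulr0.
Qed.

Lemma diag_pr_comm P i j c : diag_pr P i j * c = c * diag_pr P i j.
Proof. by rewrite mxE; apply: esym (commr_nat _ _). Qed.

Lemma outerE M N i j h k : (col j M *m row i N) h k = M h j * N i k.
Proof. by rewrite mxE big_ord1 !mxE. Qed.

Definition ad c M : 'M[B]_n := \matrix_(i, j) (c * M i j - M i j * c).

Lemma adM c M N : ad c (M *m N) = ad c M *m N + M *m ad c N.
Proof.
apply/matrixP => i j; rewrite !mxE mulr_sumr mulr_suml -sumrB -big_split /=.
apply: eq_bigr => k _; rewrite !mxE mulrBl mulrBr.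
by rewrite !mulrA addrA subrK.
Qed.

Lemma ad_diag_pr c P : ad c (diag_pr P) = 0.
Proof. by apply/matrixP => i j; rewrite !mxE commr_nat subrr. Qed.

(** Corners stay inside matrices of size n: cuts at different places can then be
    multiplied with one another, with no change of index type. *)
Definition corner_inverse P T N : Prop :=
  [/\ diag_pr P *m N = N, N *m diag_pr P = N, N *m T *m diag_pr P = diag_pr P & diag_pr P *m T *m N = diag_pr P].

Lemma corner_inverse_cancel P T N M : corner_inverse P T N -> diag_pr P *m M = M ->
  N *m T *m M = M.
Proof. by case=> _ _ NT _ PM; rewrite -[in LHS]PM mulmxA NT PM. Qed.

Lemma corner_inverse_cancelr P T N M : corner_inverse P T N -> M *m diag_pr P = M ->
  M *m T *m N = M.
Proof. by case=> _ _ _ TN MP; rewrite -[in LHS]MP -!mulmxA (mulmxA (diag_pr P)) TN MP. Qed.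

(** The derivation [c, -] applied to N T P = P, as for an inverse. *)
Lemma ad_corner_inverse c P T N : corner_inverse P T N ->
  ad c N = - (N *m ad c T *m N).
Proof.
case=> PN NP NT TN.
have adNP : ad c N = ad c N *m diag_pr P by rewrite -[in LHS]NP adM ad_diag_pr mulmx0 addr0.
have := congr1 (ad c) NT; rewrite !adM ad_diag_pr mulmx0 addr0 => /eqP.
rewrite mulmxDl addr_eq0 => /eqP E.
have : ad c N *m T *m diag_pr P *m N = - (N *m ad c T *m diag_pr P *m N) by rewrite E mulNmx.
by rewrite -!mulmxA PN !mulmxA {1}adNP -!mulmxA (mulmxA (diag_pr P)) TN -adNP !mulmxA.
Qed.

Lemma mx_outer N M T K j i h k :
  (N *m (col j M *m row i T) *m K) h k = (N *m M) h j * (T *m K) i k.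
Proof.
rewrite mulmxA -mulmxA -row_mul mxE big_ord1 !mxE; congr (_ * _).
by apply: eq_bigr => l _; rewrite !mxE.
Qed.

Lemma corner_congr P T N M M' : corner_inverse P T N ->
  (forall h k, P h -> P k -> M h k = M' h k) -> N *m M *m N = N *m M' *m N.
Proof.
case=> PN NP _ _ MM.
have E : diag_pr P *m M *m diag_pr P = diag_pr P *m M' *m diag_pr P.
  apply/matrixP => h k; rewrite !Mdiag_pr !diag_prM.
  by case Ph: (P h); case Pk: (P k); rewrite ?mul0r ?mulr0 // MM.
have F X : N *m X *m N = N *m (diag_pr P *m X *m diag_pr P) *m N.
  by rewrite !mulmxA NP -[RHS]mulmxA PN.
by rewrite F E -F.
Qed.

Lemma commr_corner_inverse c P T N : corner_inverse P T N ->
    (forall i j, P i -> P j -> GRing.comm c (T i j)) ->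
  forall i j, GRing.comm c (N i j).
Proof.
move=> TN cT i j; apply/eqP; rewrite -subr_eq0; apply/eqP.
have := congr1 (fun M : 'M[B]_n => M i j) (ad_corner_inverse c TN).
rewrite (corner_congr (M' := 0) TN) => [|h k Ph Pk]; last first.
  by rewrite !mxE cT ?subrr.
by rewrite mulmx0 mul0mx oppr0 !mxE.
Qed.

Section RTT.
Variables (z p : B) (zC : forall b, GRing.comm z b) (pC : forall b, GRing.comm p b).

(** The relation between T = T(u) and T' = T(v), with z / p for u - v. It does not
    involve a unit matrix, hence passes to corners. *)
Definition rtt P T T' : Prop := forall i j h k, P i -> P j -> P h -> P k ->
  z * (T i j * T' h k - T' h k * T i j) = p * (T h j * T' i k - T' h j * T i k).

Lemma rtt_sub P Q T T' : subpred Q P -> rtt P T T' -> rtt Q T T'.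
Proof. by move=> QP R i j h k *; apply: R; apply: QP. Qed.

Lemma scale_conj (c : B) N M K : (forall b, GRing.comm c b) ->
  c *: (N *m M *m K) = N *m (c *: M) *m K.
Proof.
move=> cC; rewrite scalemxAl; congr (_ *m K); apply/matrixP=> i j.
by rewrite !mxE mulr_sumr; apply: eq_bigr => k _; rewrite mxE !mulrA cC.
Qed.

Lemma zad_corner_inverse c P T N M : corner_inverse P T N ->
    (forall h k, P h -> P k -> z * (c * T h k - T h k * c) = p * M h k) ->
  forall h k, z * (c * N h k - N h k * c) = - (p * (N *m M *m N) h k).
Proof.
move=> TN E h k.
have := congr1 (fun K : 'M[B]_n => (z *: K) h k) (ad_corner_inverse c TN).
rewrite mxE [ad c N h k]mxE => ->; rewrite scalerN scale_conj //.
rewrite (corner_congr (M' := p *: M) TN); last by move=> *; rewrite !mxE E.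
by rewrite -scale_conj // !mxE.
Qed.

(** Derivation rule for the inverse: conjugating the two rank one matrices on the
    right of the relation by N' leaves one factor equal to a unit vector. *)
Lemma rtt_mixed P T T' N' : rtt P T T' -> corner_inverse P T' N' ->
  forall i j h k, P i -> P j -> z * (T i j * N' h k - N' h k * T i j)
    = p * ((diag_pr P) h j * (T *m N') i k - (N' *m T) h j * (diag_pr P) i k).
Proof.
move=> R TN i j h k Pi Pj.
rewrite (zad_corner_inverse (M := col j T *m row i T' - col j T' *m row i T) TN);
  last first.
  by move=> h' k' Ph Pk; rewrite R // !mxE !big_ord1 !mxE.
rewrite mulmxBr mulmxBl [X in p * X]mxE [(- _ : 'M[B]_n) _ _]mxE !mx_outer.
have [_ _ NT' TN'] := TN.
have -> : (N' *m T') h j = (diag_pr P) h j.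
  by have := congr1 (fun M : 'M[B]_n => M h j) NT'; rewrite Mdiag_pr Pj mulr1.
have -> : (T' *m N') i k = (diag_pr P) i k.
  by have := congr1 (fun M : 'M[B]_n => M i k) TN'; rewrite -mulmxA diag_prM Pi mul1r.
by rewrite -mulrN opprB.
Qed.

(** T(-u)^-1 satisfies the relation of T(u): both signs change when u and v are
    exchanged. *)
Lemma rtt_inv P T T' N N' : rtt P T T' -> corner_inverse P T N ->
  corner_inverse P T' N' -> rtt P N' N.
Proof.
move=> R TN TN' a b c d Pa Pb Pc Pd.
rewrite (zad_corner_inverse
  (M := col b (diag_pr P) *m row a (N' *m T) - col b (T *m N') *m row a (diag_pr P)) TN);
  last first.
  move=> h k Ph Pk; rewrite -opprB mulrN (rtt_mixed R TN') // -mulrN opprB.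
  by rewrite [in RHS]mxE [(- _ : 'M[B]_n) _ _]mxE !outerE !diag_pr_comm.
rewrite mulmxBr mulmxBl [X in p * X]mxE [(- _ : 'M[B]_n) _ _]mxE !mx_outer.
have [PN NP _ _] := TN; have [PN' NP' _ _] := TN'.
by rewrite NP PN (mulmxA N) (corner_inverse_cancel TN) // (corner_inverse_cancelr TN) // -mulrN opprB.
Qed.

(** In block form T = (A B; C D') below the cut P, the matrix Y is P + A^-1 B, and
    for the inverse S of T', Y' is the analogous product with the corner above Q.
    The commutators of the entries of Y with those of Y' turn out to be expressed
    by these entries alone. *)
Section OffDiagonal.
Variables (P Q : pred 'I_n) (PQ : subpred P Q) (T T' N S M : 'M[B]_n).
Hypotheses (R : rtt predT T T') (TN : corner_inverse P T N)
  (TS : corner_inverse predT T' S) (SM : corner_inverse (predC Q) S M).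
Let Y := N *m T.
Let Y' := S *m M.
Let V := Y *m Y'.

Lemma lower_cut_row0 h j : ~~ P h -> Y h j = 0.
Proof. by case: TN => PN _ _ _ Ph; rewrite /Y -PN -mulmxA diag_prM (negPf Ph) mul0r. Qed.

Lemma upper_cut_col0 h j : Q j -> Y' h j = 0.
Proof. by case: SM => _ MP _ _ Ph; rewrite /Y' -MP mulmxA Mdiag_pr /= Ph mulr0. Qed.

(** The second term of rtt_mixed vanishes here, as no index lies both in P and
    outside Q. *)
Lemma lower_cut_inverse_comm h e : ~~ Q e -> forall i j,
  z * (Y i j * S h e - S h e * Y i j)
    = p * ((Y *m S) i e * ((diag_pr predT) h j - Y h j)).
Proof.
move=> Qp i j.
have ne g : P g -> g != e by move=> /PQ Qg; apply: contraNneq Qp => <-.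
have TSh g l : P g -> z * (T g l * S h e - S h e * T g l)
    = p * ((diag_pr predT) h l * (T *m S) g e).
  move=> Pg; rewrite (rtt_mixed R TS) //.
  by congr (p * _); rewrite [X in _ - _ * X]mxE (negPf (ne _ Pg)) mulr0 subr0.
have zN g : z * (S h e * N i g - N i g * S h e) = p * ((Y *m S) i e * N h g).
  rewrite (zad_corner_inverse (M := - (col e (T *m S) *m row h (diag_pr predT))) TN).
    rewrite mulmxN mulNmx [X in p * X]mxE mulrN opprK mx_outer /Y !mulmxA.
    case: TN => PN _ _ _; congr (p * (_ * _)).
    by have -> : diag_pr predT *m N = N by apply/matrixP => a b; rewrite diag_prM mul1r.
  move=> a b Pa Pb; rewrite -opprB mulrN TSh // [in RHS]mxE outerE mulrN.
  by rewrite diag_pr_comm.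
have -> : Y i j * S h e - S h e * Y i j = - (ad (S h e) Y) i j.
  by rewrite [ad _ _ _ _]mxE opprB.
rewrite mulrN /Y adM mxE mulrDr.
have -> : z * (ad (S h e) N *m T) i j = p * ((Y *m S) i e * Y h j).
  rewrite mxE mulr_sumr [Y h j]mxE !mulr_sumr; apply: eq_bigr => g _.
  by rewrite mulrA mxE zN !mulrA.
have -> : z * (N *m ad (S h e) T) i j = - (p * ((Y *m S) i e * diag_pr predT h j)).
  rewrite mxE /Y -mulmxA [X in p * (X * _)]mxE mulr_suml !mulr_sumr -sumrN.
  apply: eq_bigr => g _; case Pg: (P g); last first.
    by case: TN => _ <- _ _; rewrite Mdiag_pr Pg !(mulr0, mul0r) oppr0.
  rewrite mulrA zC -mulrA mxE -opprB mulrN TSh // diag_pr_comm mulrN (mulrA _ p) -pC.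
  by rewrite !mulrA.
by rewrite opprD opprK mulrBr mulrBr addrC.
Qed.

Lemma lower_cut_corner_comm i j q k : z * (Y i j * M q k - M q k * Y i j) = - (p * (M q j * V i k)).
Proof.
rewrite (zad_corner_inverse (M := col j (diag_pr predT) *m row i (Y *m S)) SM).
  rewrite mx_outer /V /Y' mulmxA; congr (- (p * (_ * _))).
  by have -> : M *m diag_pr predT = M by apply/matrixP => a b; rewrite Mdiag_pr mulr1.
move=> h l Qh Ql; rewrite lower_cut_inverse_comm // outerE; congr (p * _).
rewrite lower_cut_row0 ?subr0 -?diag_pr_comm //.
by apply: contra Qh => /PQ.
Qed.

Lemma cuts_comm1 i j h k : z * (Y i j * Y' h k - Y' h k * Y i j)
  = p * (\sum_q (Y *m S) i q * ((diag_pr predT) h j - Y h j) * M q k - Y' h j * V i k).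
Proof.
have -> : Y i j * Y' h k - Y' h k * Y i j = (ad (Y i j) Y') h k by rewrite [RHS]mxE.
rewrite /Y' adM mxE mulrDr mulrBr; congr (_ + _).
  rewrite mxE !mulr_sumr; apply: eq_bigr => q _; case Qq: (Q q).
    by case: SM => <- _ _ _; rewrite diag_prM /= Qq !(mul0r, mulr0).
  by rewrite mulrA mxE lower_cut_inverse_comm ?Qq // !mulrA.
rewrite mxE [X in X * V i k]mxE mulr_suml !mulr_sumr -sumrN.
apply: eq_bigr => q _; rewrite mulrA zC -mulrA mxE lower_cut_corner_comm mulrN.
by rewrite (mulrA _ p) -pC -!mulrA.
Qed.

(** Multiplying by z once more allows Y_hj to be moved past M, which leaves only
    entries of Y and Y'. *)
Lemma cuts_comm i j h k : z * (z * (Y i j * Y' h k - Y' h k * Y i j))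
  = z * p * (V i k * ((diag_pr predT) h j - Y h j) - Y' h j * V i k)
    + p * p * (V i j * V h k).
Proof.
rewrite cuts_comm1.
have -> (b : B) : z * (p * b) = p * (z * b) by rewrite mulrA zC -mulrA.
have -> (b : B) : z * p * b = p * (z * b) by rewrite [z * p]zC -mulrA.
rewrite -mulrA -mulrDr; congr (p * _).
rewrite !mulrBr addrAC; congr (_ - _).
have VE i' k' : V i' k' = \sum_q (Y *m S) i' q * M q k'.
  by rewrite /V /Y' mulmxA mxE.
rewrite mulr_sumr.
have E q : z * ((Y *m S) i q * ((diag_pr predT) h j - Y h j) * M q k)
    = z * ((Y *m S) i q * M q k * (diag_pr predT) h j)
      - z * ((Y *m S) i q * M q k * Y h j)
      + p * ((Y *m S) i q * M q j * V h k).
  have -> : p * ((Y *m S) i q * M q j * V h k)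
      = - ((Y *m S) i q * (z * (Y h j * M q k - M q k * Y h j))).
    by rewrite lower_cut_corner_comm mulrN opprK (mulrA _ p) -pC -!mulrA.
  rewrite (mulrA _ z) -zC -!mulrA -!mulrBr; congr (z * (_ * _)).
  by rewrite mulrBr opprB addrA subrK mulrBl diag_pr_comm.
by rewrite (eq_bigr _ (fun q _ => E q)) big_split /= sumrB -!mulr_sumr -!mulr_suml -!VE.
Qed.

(** Between the two cuts row j of Y and column j of Y' vanish, so that a single
    term survives. *)
Lemma cuts_comm_adjacent i j k : ~~ P j -> Q j ->
  z * (Y i j * Y' j k - Y' j k * Y i j) = p * V i k.
Proof.
move=> Pj Qj; rewrite cuts_comm1 lower_cut_row0 // upper_cut_col0 // mul0r !subr0.
rewrite /V /Y' mulmxA [(_ *m M) i k]mxE; congr (p * _); apply: eq_bigr => q _.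
by rewrite [diag_pr _ _ _]mxE eqxx mulr1.
Qed.

End OffDiagonal.
End RTT.
End Commutators.

(** * The defining relations as an identity of series *)

Section SeriesRTT.
Variables (A : nzRingType) (n : nat).
Implicit Type T : 'M[ps A]_n.

Definition yrtt T : Prop :=
  rtt (vdiff A) (vprod A) predT (map_mx (@inx A) T) (map_mx (@iny A) T).

Let S (a b : nat -> A) r s : A :=
  \sum_(t < minn r s) (a t * b (r + s - 1 - t)%N - a (r + s - 1 - t)%N * b t).

Let S_rec a b r s : S a b r.+1 s - S a b r s.+1 = a r * b s - a s * b r.
Proof.
pose g t := a t * b (r + s - t)%N - a (r + s - t)%N * b t.
have SE r' s' : (r' + s' = (r + s).+1)%N -> S a b r' s' = \sum_(t < minn r' s') g t.
  by move=> E; apply: eq_bigr => t _; rewrite /g E subn1.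
rewrite !SE ?addSn ?addnS //; case: (ltngtP r s) => rs.
- rewrite (minn_idPl rs) (minn_idPl (leqW (ltnW rs))) big_ord_recr /= [LHS]addrC addKr.
  by rewrite /g addKn.
- rewrite (minn_idPr (leqW (ltnW rs))) (minn_idPr rs) big_ord_recr /= opprD addrA subrr sub0r.
  by rewrite /g addnK opprB.
- by rewrite rs !subrr minnC subrr.
Qed.

Let comm2 T i j h k r s : A := T i j r * T h k s - T h k s * T i j r.

Let lhsE T i j h k r s :
  (vdiff A * (map_mx (@inx A) T i j * map_mx (@iny A) T h k
           - map_mx (@iny A) T h k * map_mx (@inx A) T i j)) r s
  = (if s is s'.+1 then comm2 T i j h k r s' else 0)
    - (if r is r'.+1 then comm2 T i j h k r' s else 0).
Proof. by rewrite vdiffM; case: s => [|s]; case: r => [|r]; rewrite ?psB ?mxE ?inx_iny ?iny_inx. Qed.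

Let rhsE T i j h k r s :
  (vprod A * (map_mx (@inx A) T h j * map_mx (@iny A) T i k
           - map_mx (@iny A) T h j * map_mx (@inx A) T i k)) r s
  = if r is r'.+1 then if s is s'.+1 then T h j r' * T i k s' - T h j s' * T i k r'
                       else 0 else 0.
Proof. by rewrite vprodM; case: s => [|s]; case: r => [|r]; rewrite ?psB ?mxE ?inx_iny ?iny_inx. Qed.

Let relator_comm2 T i j h k r s :
  yangian_relator (fun i j => T i j) h k i j s r
    = - (comm2 T i j h k r s - S (T h j) (T i k) r s).
Proof.
rewrite /yangian_relator /comm2 opprB /S minnC (addnC s r) [RHS]addrC opprB; congr (_ + _).
by rewrite -sumrN; apply: eq_bigr => t _; rewrite opprB.
Qed.

(** The finite sum over t in a relator is the solution of the recurrence that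
    multiplication by y - x imposes on the coefficients of the commutator. The
    roles of (i, j, r) and (h, k, s) are exchanged to obtain the products in the
    order T_hj T_ik. *)
Lemma relator_yrtt T :
  (forall i j h k r s, yangian_relator (fun i j => T i j) i j h k r s = 0) -> yrtt T.
Proof.
move=> R i j h k _ _ _ _; apply: psP => r; apply: psP => s; rewrite lhsE rhsE.
have {R}E i' j' h' k' r' s' : comm2 T i' j' h' k' r' s' = S (T h' j') (T i' k') r' s'.
  by apply/eqP; rewrite -subr_eq0 -oppr_eq0 -relator_comm2 R.
case: r s => [|r] [|s]; rewrite ?E ?subr0 ?sub0r /S ?min0n ?minn0 ?big_ord0 ?oppr0 //.
exact: S_rec.
Qed.

Lemma yrtt_relator T : (forall i j, T i j 0%N = (i == j)%:R) -> yrtt T ->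
  forall i j h k r s, yangian_relator (fun i j => T i j) i j h k r s = 0.
Proof.
move=> T0 R h k i j s r; rewrite relator_comm2; apply/eqP; rewrite oppr_eq0 subr_eq0; apply/eqP.
elim: r s => [|r IH] s.
  by rewrite /comm2 T0 /S min0n big_ord0 commr_nat subrr.
have /(congr1 (fun f : ps (ps A) => f r.+1 s.+1)) := R i j h k isT isT isT isT.
by rewrite lhsE rhsE => /= /(canRL (subrK _)) ->; rewrite -S_rec IH subrK.
Qed.

End SeriesRTT.

(** * Inverses of matrices of series *)

Section SeriesMatrices.
Variables (A : nzRingType) (n : nat).
Implicit Types f g : nat -> 'M[A]_n.

Definition series_mx f : 'M[ps A]_n := \matrix_(i, j) (fun r => f r i j).

Lemma series_mxE f i j r : series_mx f i j r = f r i j.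
Proof. by rewrite mxE. Qed.

Lemma series_mx_mul f g r i j :
  (series_mx f *m series_mx g) i j r = (\sum_(t < r.+1) f t *m g (r - t)%N) i j.
Proof.
rewrite mxE ps_sum summxE.
under eq_bigr => k _ do rewrite psM.
rewrite exchange_big /=; apply: eq_bigr => t _; rewrite mxE.
by apply: eq_bigr => k _; rewrite !mxE.
Qed.

(** All the earlier coefficients are needed at each step of the recursion. *)
Fixpoint sinv_upto f N : seq 'M[A]_n :=
  if N is N'.+1 then
    let s := sinv_upto f N' in
    rcons s (- \sum_(t < N) f t.+1 *m nth 0 s (N' - t)%N)
  else [:: 1%:M].

Definition sinv f r : 'M[A]_n := nth 0 (sinv_upto f r) r.

Lemma size_sinv_upto f N : size (sinv_upto f N) = N.+1.
Proof. by elim: N => //= N IH; rewrite size_rcons IH. Qed.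

Lemma nth_sinv_upto f N r : (r <= N)%N -> nth 0 (sinv_upto f N) r = sinv f r.
Proof.
elim: N => [|N IH]; first by rewrite leqn0 => /eqP ->.
rewrite leq_eqVlt => /orP[/eqP -> //|rN].
by rewrite [LHS]/= nth_rcons size_sinv_upto rN IH.
Qed.

Lemma sinvS f r : sinv f r.+1 = - \sum_(t < r.+1) f t.+1 *m sinv f (r - t)%N.
Proof.
rewrite {1}/sinv /= nth_rcons size_sinv_upto ltnn eqxx; congr (- _).
by apply: eq_bigr => t _; rewrite nth_sinv_upto ?leq_subr.
Qed.

Lemma mul_sinv f : f 0%N = 1%:M -> series_mx f *m series_mx (sinv f) = 1%:M.
Proof.
move=> f0; apply/matrixP => i j; apply: psP => r.
rewrite series_mx_mul mxE; case: r => [|r].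
  by rewrite big_ord1 f0 mul1mx mxE; case: eqP.
rewrite big_ord_recl /= subn0 f0 mul1mx sinvS.
have -> : \sum_(t < r.+1) f (bump 0 t) *m sinv f (r.+1 - bump 0 t)%N
   = \sum_(t < r.+1) f t.+1 *m sinv f (r - t)%N by [].
by rewrite addNr mxE; case: eqP.
Qed.

Lemma sinv_mul f : f 0%N = 1%:M -> series_mx (sinv f) *m series_mx f = 1%:M.
Proof.
move=> f0; have E := mul_sinv f0; have E' := @mul_sinv (sinv f) (erefl _).
suff <- : series_mx (sinv (sinv f)) = series_mx f by [].
by rewrite -[LHS]mul1mx -E -mulmxA E' mulmx1.
Qed.

(** Used both for matrices with prescribed zero blocks and for matrices whose
    entries have bounded degree; inverses of series inherit either property. *)
Record graded_class (C : nat -> 'M[A]_n -> Prop) : Prop := GradedClass {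
  graded1 : C 0%N 1%:M;
  gradedD : forall r M N, C r M -> C r N -> C r (M + N);
  gradedN : forall r M, C r M -> C r (- M);
  graded0 : forall r, C r 0;
  gradedM : forall r s M N, C r M -> C s N -> C (r + s)%N (M *m N)
}.

Lemma sinv_graded C f : graded_class C -> (forall r, C r (f r)) ->
  forall r, C r (sinv f r).
Proof.
move=> CC Cf; elim/ltn_ind => -[_|r IH]; first exact: graded1.
rewrite sinvS; apply: gradedN => //; apply: big_ind => [|M N|t _].
- exact: graded0.
- exact: gradedD.
have tr : (t <= r)%N by rewrite -ltnS.
have := gradedM CC (Cf t.+1) (IH (r - t)%N _).
by rewrite addSn subnKC //; apply; rewrite ltnS leq_subr.
Qed.

End SeriesMatrices.

Section Corners.
Variables (B : nzRingType) (n : nat).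
Implicit Types (P : pred 'I_n) (M : 'M[B]_n).

Lemma diag_pr_absorbl P M : (forall i j, P j -> ~~ P i -> M i j = 0) ->
  diag_pr B P *m (M *m diag_pr B P) = M *m diag_pr B P.
Proof.
move=> H; apply/matrixP => i j; rewrite diag_prM !Mdiag_pr.
by case Pj: (P j); case Pi: (P i); rewrite /= ?mulr0 ?mul1r ?mulr1n ?mulr1 // ?H ?Pi ?mulr0.
Qed.

Lemma diag_pr_absorbr P M : (forall i j, P i -> ~~ P j -> M i j = 0) ->
  diag_pr B P *m M *m diag_pr B P = diag_pr B P *m M.
Proof.
move=> H; apply/matrixP => i j; rewrite Mdiag_pr !diag_prM.
by case Pi: (P i); case Pj: (P j); rewrite /= ?mul0r ?mul1r ?mulr1 // H ?Pj ?mul0r.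
Qed.

Lemma diag_pr_idem P : diag_pr B P *m diag_pr B P = diag_pr B P.
Proof.
apply/matrixP => i j; rewrite diag_prM !mxE.
by case: (P i); rewrite /= ?andbF ?mul1r ?mul0r.
Qed.

Lemma map_diag_pr (B' : nzRingType) (f : {rmorphism B -> B'}) P : map_mx f (diag_pr B P) = diag_pr B' P.
Proof. by apply/matrixP => i j; rewrite !mxE rmorph_nat. Qed.

Lemma map_corner_inverse (B' : nzRingType) (f : {rmorphism B -> B'}) P M N :
  corner_inverse P M N -> corner_inverse P (map_mx f M) (map_mx f N).
Proof. by case=> a b c d; split; rewrite -?(map_diag_pr f P) -?map_mxM ?a ?b ?c ?d. Qed.

End Corners.

(** * Commutators of the factors of T(u) *)

(** The conditions of a Gauss factorization entry by entry, without block
    decomposition of the index type, so that they transpose. *)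
Record block_gauss (A : nzRingType) (n : nat) (blk : 'I_n -> nat)
    (T F D E : nat -> 'M[A]_n) : Prop := BlockGauss {
  bg_mul : series_mx T = series_mx F *m series_mx D *m series_mx E;
  bg_Dconst : D 0%N = 1%:M;
  bg_Doff : forall r i j, blk i != blk j -> D r i j = 0;
  bg_Econst : E 0%N = 1%:M;
  bg_Eoff : forall r i j, (blk j < blk i)%N -> E r i j = 0;
  bg_Ediag : forall r i j, blk i = blk j -> E r i j = ((r == 0)%N && (i == j))%:R;
  bg_Fconst : F 0%N = 1%:M;
  bg_Foff : forall r i j, (blk i < blk j)%N -> F r i j = 0;
  bg_Fdiag : forall r i j, blk i = blk j -> F r i j = ((r == 0)%N && (i == j))%:R
}.

Record filtration (A : nzRingType) (G : nat -> A -> Prop) : Prop := Filtration {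
  filtration1 : G 0%N 1;
  filtration0 : forall r, G r 0;
  filtrationD : forall r x y, G r x -> G r y -> G r (x + y);
  filtrationN : forall r x, G r x -> G r (- x);
  filtrationM : forall r s x y, G r x -> G s y -> G (r + s)%N (x * y);
  filtrationW : forall r s x, (r <= s)%N -> G r x -> G s x
}.

Section Filtered.
Variables (A : nzRingType) (G : nat -> A -> Prop) (GG : filtration G).

Lemma filtrationB r x y : G r x -> G r y -> G r (x - y).
Proof. by move=> Gx Gy; apply: filtrationD => //; apply: filtrationN. Qed.

Lemma filtration_sum I (s : seq I) (P : pred I) (f : I -> A) r :
  (forall i, P i -> G r (f i)) -> G r (\sum_(i <- s | P i) f i).
Proof. by move=> H; apply: big_ind => //; [apply: filtration0|apply: filtrationD]. Qed.

Lemma graded_mx_class n : graded_class (fun r (M : 'M[A]_n) => forall i j, G r (M i j)).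
Proof.
split.
- by move=> i j; rewrite mxE; case: eqP => _; [apply: filtration1|apply: filtration0].
- by move=> r M N HM HN i j; rewrite mxE; apply: filtrationD.
- by move=> r M HM i j; rewrite mxE; apply: filtrationN.
- by move=> r i j; rewrite mxE; apply: filtration0.
- by move=> r s M N HM HN i j; rewrite mxE; apply: filtration_sum => k _; apply: filtrationM.
Qed.

(** Below total degree e the truncated difference only asks for G of 0; this is
    harmless because the commutators of interest have e = 1 and r, s >= 1. *)
Definition fil2 e (f : ps (ps A)) : Prop := forall r s, G (r + s - e)%N (f r s).

Lemma fil2D e f g : fil2 e f -> fil2 e g -> fil2 e (f + g).
Proof. by move=> ff fg r s; rewrite !psD; apply: filtrationD. Qed.
Lemma fil2N e f : fil2 e f -> fil2 e (- f).
Proof. by move=> ff r s; rewrite !psN; apply: filtrationN. Qed.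
Lemma fil2B e f g : fil2 e f -> fil2 e g -> fil2 e (f - g).
Proof. by move=> ff fg; apply: fil2D => //; apply: fil2N. Qed.
Lemma fil2M f g : fil2 0 f -> fil2 0 g -> fil2 0 (f * g).
Proof.
move=> ff fg r s; rewrite psM ps_sum; apply: filtration_sum => i _.
rewrite psM; apply: filtration_sum => j _; have := filtrationM GG (ff i j) (fg (r - i) (s - j))%N.
rewrite !subn0; have ir := leq_ord i; have js := leq_ord j.
by congr G; lia.
Qed.
Lemma fil2_0 e : fil2 e 0. Proof. by move=> r s; apply: filtration0. Qed.
Lemma fil2_sum e I (s : seq I) (P : pred I) f :
  (forall i, P i -> fil2 e (f i)) -> fil2 e (\sum_(i <- s | P i) f i).
Proof. by move=> H; apply: big_ind => //; [apply: fil2_0|apply: fil2D]. Qed.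
Lemma fil2_inx f : (forall r, G r (f r)) -> fil2 0 (inx f).
Proof.
by move=> Gf r [|s]; rewrite subn0 ?addn0 //; apply: filtration0.
Qed.
Lemma fil2_iny f : (forall r, G r (f r)) -> fil2 0 (iny f).
Proof. by move=> Gf [|r] s; rewrite subn0 //; apply: filtration0. Qed.
Lemma fil2_vprod e f : fil2 e f -> fil2 e.+2 (vprod A * f).
Proof.
move=> ff [|r] [|s]; rewrite vprodM; try exact: filtration0.
by have := ff r s; congr G; lia.
Qed.
Lemma fil2_vdiff e f : fil2 e f -> fil2 e.+1 (vdiff A * f).
Proof.
by move=> ff r s; rewrite vdiffM; apply: filtrationB; [case: s => [|s]|case: r => [|r]];
   try exact: filtration0; have := ff r s; congr G; lia.
Qed.
(** The coefficient of x^r y^s of f is recovered from (y - x) f along the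
    antidiagonal, starting from the border r = 0. *)
Lemma fil2_vdiff_inv e f : fil2 e.+1 (vdiff A * f) -> fil2 e f.
Proof.
move=> ff; elim=> [|r IH] s.
  by have := ff 0%N s.+1; rewrite vdiffM subr0; congr G; lia.
have := ff r.+1 s.+1; rewrite vdiffM => H.
rewrite -[f r.+1 s](subrK (f r s.+1)); apply: filtrationD => //.
  by move: H; congr G; lia.
by have := IH s.+1; congr G; lia.
Qed.
Lemma fil2W e f : fil2 e.+1 f -> fil2 e f.
Proof. by move=> ff r s; apply: filtrationW (ff r s) => //; lia. Qed.
Lemma fil2_nat e (b : bool) : fil2 e b%:R.
Proof.
case: b; last exact: fil2_0.
move=> r s; rewrite mulr1n ps1; case: r => [|r] /=; last exact: filtration0.
rewrite mulr1n ps1; case: s => [|s]; last exact: filtration0.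
by apply: filtrationW (filtration1 GG).
Qed.

Lemma fil2_mulmx n (M N : 'M[ps (ps A)]_n) : (forall i j, fil2 0 (M i j)) ->
  (forall i j, fil2 0 (N i j)) -> forall i j, fil2 0 ((M *m N) i j).
Proof. by move=> HM HN i j; rewrite mxE; apply: fil2_sum => k _; apply: fil2M. Qed.
Lemma fil2_diag_pr n (P : pred 'I_n) i j : fil2 0 (diag_pr _ P i j).
Proof. by rewrite mxE; apply: fil2_nat. Qed.

End Filtered.

Section BlockGaussAlgebra.
Variables (A : nzRingType) (n : nat) (blk : 'I_n -> nat) (T F D E : nat -> 'M[A]_n).
Hypotheses (TFDE : block_gauss blk T F D E) (R : yrtt (series_mx T)).

Let Ei := sinv E.
Let Fi := sinv F.
Let Di := sinv D.
Let ET := series_mx E.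
Let FT := series_mx F.
Let DT := series_mx D.
Let EiT := series_mx Ei.
Let FiT := series_mx Fi.
Let DiT := series_mx Di.

Let EEi : ET *m EiT = 1%:M. Proof. exact: mul_sinv (bg_Econst TFDE). Qed.
Let EiE : EiT *m ET = 1%:M. Proof. exact: sinv_mul (bg_Econst TFDE). Qed.
Let FFi : FT *m FiT = 1%:M. Proof. exact: mul_sinv (bg_Fconst TFDE). Qed.
Let FiF : FiT *m FT = 1%:M. Proof. exact: sinv_mul (bg_Fconst TFDE). Qed.
Let DDi : DT *m DiT = 1%:M. Proof. exact: mul_sinv (bg_Dconst TFDE). Qed.
Let DiD : DiT *m DT = 1%:M. Proof. exact: sinv_mul (bg_Dconst TFDE). Qed.

Lemma support_class (rel : rel 'I_n) : reflexive rel -> transitive rel ->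
  graded_class (fun _ (M : 'M[A]_n) => forall i j, ~~ rel i j -> M i j = 0).
Proof.
move=> rr rt; split.
- by move=> i j; rewrite mxE; case: eqP => [->|//]; rewrite rr.
- by move=> r M N HM HN i j ij; rewrite mxE HM ?HN ?addr0.
- by move=> r M HM i j ij; rewrite mxE HM ?oppr0.
- by move=> r i j _; rewrite mxE.
- move=> r s M N HM HN i j ij; rewrite mxE big1 // => k _.
  case ik: (rel i k); last by rewrite HM ?ik ?mul0r.
  case kj: (rel k j); last by rewrite HN ?kj ?mulr0.
  by rewrite (rt _ _ _ ik kj) in ij.
Qed.

Lemma sinv_E_off r i j : (blk j < blk i)%N -> Ei r i j = 0.
Proof.
move=> ji; apply: (sinv_graded (support_class (rel := fun i j => (blk i <= blk j)%N) _ _)).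
- by move=> k /=.
- by move=> a b c; apply: leq_trans.
- by move=> t k l; rewrite -ltnNge; apply: bg_Eoff TFDE _ _ _.
- by rewrite -ltnNge.
Qed.

Lemma sinv_F_off r i j : (blk i < blk j)%N -> Fi r i j = 0.
Proof.
move=> ji; apply: (sinv_graded (support_class (rel := fun i j => (blk j <= blk i)%N) _ _)).
- by move=> k /=.
- by move=> a b c ab bc; apply: leq_trans bc ab.
- by move=> t k l; rewrite -ltnNge; apply: bg_Foff TFDE _ _ _.
- by rewrite -ltnNge.
Qed.

Lemma sinv_D_off r i j : blk i != blk j -> Di r i j = 0.
Proof.
move=> ji; apply: (sinv_graded (support_class (rel := fun i j => blk i == blk j) _ _)).
- by move=> k /=.
- by move=> a b c /= /eqP ->.
- by move=> t k l; apply: bg_Doff TFDE _ _ _.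
- by [].
Qed.

Variables (L : pred 'I_n).
Let pi := diag_pr (ps A) L.

Let toPS0 (M : nat -> 'M[A]_n) i j : (forall r, M r i j = 0) -> series_mx M i j = 0.
Proof. by move=> M0; apply: psP => r; rewrite series_mxE M0. Qed.

Section Down.
Hypothesis Ldown : forall i j, (blk i <= blk j)%N -> L j -> L i.

Let below i j : L i -> ~~ L j -> (blk i < blk j)%N.
Proof. by move=> Li Lj; rewrite ltnNge; apply: contra Lj => ji; apply: Ldown Li. Qed.

Let piE : pi *m (ET *m pi) = ET *m pi.
Proof. by apply: diag_pr_absorbl => i j Lj Li; apply: toPS0 => r; apply: bg_Eoff TFDE _ _ _ _; apply: below. Qed.
Let piEi : pi *m (EiT *m pi) = EiT *m pi.
Proof. by apply: diag_pr_absorbl => i j Lj Li; apply: toPS0 => r; apply: sinv_E_off; apply: below. Qed.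
Let piF : pi *m FT *m pi = pi *m FT.
Proof. by apply: diag_pr_absorbr => i j Lj Li; apply: toPS0 => r; apply: bg_Foff TFDE _ _ _ _; apply: below. Qed.
Let piFi : pi *m FiT *m pi = pi *m FiT.
Proof. by apply: diag_pr_absorbr => i j Lj Li; apply: toPS0 => r; apply: sinv_F_off; apply: below. Qed.

Let block_comm (M : nat -> 'M[A]_n) : (forall r i j, blk i != blk j -> M r i j = 0) ->
  pi *m series_mx M = series_mx M *m pi.
Proof.
move=> M0; apply/matrixP => i j; rewrite diag_prM Mdiag_pr.
case: (blk i =P blk j) => [ij|/eqP ij]; last by rewrite toPS0 ?mulr0 ?mul0r // => r; apply: M0.
have -> : L j = L i by apply/idP/idP; apply: Ldown; rewrite ij.
exact/esym/commr_nat.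
Qed.
Let piD : pi *m DT = DT *m pi. Proof. exact/block_comm/(bg_Doff TFDE). Qed.
Let piDi : pi *m DiT = DiT *m pi. Proof. exact: block_comm sinv_D_off. Qed.

Lemma down_corner : corner_inverse L (series_mx T) (EiT *m pi *m DiT *m FiT).
Proof.
have TE : series_mx T = FT *m DT *m ET := bg_mul TFDE.
split; rewrite -/pi.
- by rewrite !mulmxA -(mulmxA pi) piEi.
- by rewrite -(mulmxA EiT) piDi -!mulmxA (mulmxA pi) piFi.
- rewrite TE !mulmxA -(mulmxA _ FiT) FiF mulmx1 -(mulmxA _ DiT) DiD mulmx1.
  by rewrite -!mulmxA piE mulmxA EiE mul1mx.
- rewrite TE !mulmxA -[X in X *m DiT *m FiT]mulmxA.
  rewrite -[pi *m FT *m DT *m ET *m (EiT *m pi)]mulmxA (mulmxA ET) EEi mul1mx.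
  rewrite -(mulmxA (pi *m FT *m DT)) piDi mulmxA -(mulmxA _ DT) DDi mulmx1.
  by rewrite piF -mulmxA FFi mulmx1.
Qed.

End Down.

Section Up.
Hypothesis Lup : forall i j, (blk i <= blk j)%N -> L i -> L j.

Let above i j : L j -> ~~ L i -> (blk i < blk j)%N.
Proof. by move=> Li Lj; rewrite ltnNge; apply: contra Lj => ji; apply: Lup Li. Qed.

Lemma up_corner : corner_inverse L (EiT *m DiT *m FiT) (FT *m DT *m pi *m ET).
Proof.
have piF : pi *m (FT *m pi) = FT *m pi.
  by apply: diag_pr_absorbl => i j Lj Li; apply: toPS0 => r; apply: bg_Foff TFDE _ _ _ _; apply: above.
have piFi : pi *m (FiT *m pi) = FiT *m pi.
  by apply: diag_pr_absorbl => i j Lj Li; apply: toPS0 => r; apply: sinv_F_off; apply: above.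
have piE : pi *m ET *m pi = pi *m ET.
  by apply: diag_pr_absorbr => i j Lj Li; apply: toPS0 => r; apply: bg_Eoff TFDE _ _ _ _; apply: above.
have piEi : pi *m EiT *m pi = pi *m EiT.
  by apply: diag_pr_absorbr => i j Lj Li; apply: toPS0 => r; apply: sinv_E_off; apply: above.
have piD : pi *m DT = DT *m pi.
  apply/matrixP => i j; rewrite diag_prM Mdiag_pr.
  case: (blk i =P blk j) => [ij|/eqP ij]; last first.
    by rewrite toPS0 ?mulr0 ?mul0r // => r; apply: bg_Doff TFDE _ _ _ _.
  have -> : L j = L i by apply/idP/idP; apply: Lup; rewrite ij.
  exact/esym/commr_nat.
split; rewrite -/pi.
- by rewrite -(mulmxA FT) -piD !mulmxA -(mulmxA pi) piF.
- by rewrite -!mulmxA (mulmxA pi) piE.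
- rewrite !mulmxA -(mulmxA _ ET) EEi mulmx1 -(mulmxA FT) -piD mulmxA.
  by rewrite -(mulmxA _ DT) DDi mulmx1 -!mulmxA piFi mulmxA FFi mul1mx.
- rewrite !mulmxA -(mulmxA _ FiT) FiF mulmx1 -(mulmxA _ DiT) DiD mulmx1 piEi.
  by rewrite -mulmxA EiE mulmx1.
Qed.
End Up.
End BlockGaussAlgebra.

Section BlockGaussCommutators.
Variables (A : nzRingType) (n : nat) (blk : 'I_n -> nat) (T F D E : nat -> 'M[A]_n).
Hypotheses (TFDE : block_gauss blk T F D E) (R : yrtt (series_mx T)).

Let ET := series_mx E.
Let FT := series_mx F.
Let DT := series_mx D.
Let EiT := series_mx (sinv E).
Let FiT := series_mx (sinv F).
Let DiT := series_mx (sinv D).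
Let S := EiT *m DiT *m FiT.

Let EiE : EiT *m ET = 1%:M. Proof. exact: sinv_mul (bg_Econst TFDE). Qed.

Let cx (M : 'M[ps A]_n) := map_mx (@inx A) M.
Let cy (M : 'M[ps A]_n) := map_mx (@iny A) M.

Let diag_pr_predT (B : nzRingType) : diag_pr B (predT : pred 'I_n) = 1%:M.
Proof. by apply/matrixP => i j; rewrite !mxE andbT. Qed.

Let diag_pr_predC (B : nzRingType) (Q : pred 'I_n) : diag_pr B (predC Q) = 1%:M - diag_pr B Q.
Proof.
apply/matrixP => i j; rewrite !mxE /=.
by case: (i == j); case: (Q i); rewrite /= ?subr0 ?subrr.
Qed.

Let TS : corner_inverse predT (series_mx T) S.
Proof.
have := @down_corner _ _ _ _ _ _ _ TFDE predT (fun _ _ _ _ => isT).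
by rewrite diag_pr_predT mulmx1.
Qed.

Let E_off i j : (blk j < blk i)%N -> ET i j = 0.
Proof. by move=> ji; apply: psP => r; rewrite series_mxE (bg_Eoff TFDE). Qed.
Let F_off i j : (blk i < blk j)%N -> FT i j = 0.
Proof. by move=> ji; apply: psP => r; rewrite series_mxE (bg_Foff TFDE). Qed.
Let D_off i j : blk i != blk j -> DT i j = 0.
Proof. by move=> ji; apply: psP => r; rewrite series_mxE (bg_Doff TFDE). Qed.
Let Ei_off i j : (blk j < blk i)%N -> EiT i j = 0.
Proof. by move=> ji; apply: psP => r; rewrite series_mxE (sinv_E_off TFDE). Qed.
Let Fi_off i j : (blk i < blk j)%N -> FiT i j = 0.
Proof. by move=> ji; apply: psP => r; rewrite series_mxE (sinv_F_off TFDE). Qed.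
Let Di_off i j : blk i != blk j -> DiT i j = 0.
Proof. by move=> ji; apply: psP => r; rewrite series_mxE (sinv_D_off TFDE). Qed.

Let bool_ps (b : bool) r : (b%:R : ps A) r = ((r == 0)%N && b)%:R.
Proof. by case: b; rewrite /= ?mulr1n ?mulr0n ?andbT ?andbF ?ps1. Qed.

Let E_diag i j : blk i = blk j -> ET i j = (i == j)%:R.
Proof. by move=> ij; apply: psP => r; rewrite series_mxE (bg_Ediag TFDE) // bool_ps. Qed.
Let F_diag i j : blk i = blk j -> FT i j = (i == j)%:R.
Proof. by move=> ij; apply: psP => r; rewrite series_mxE (bg_Fdiag TFDE) // bool_ps. Qed.

(* Only the blocks between those of i and j contribute to an entry. *)
Let mul_upper_diag (M N : 'M[ps A]_n) i j :
    (forall i j, (blk j < blk i)%N -> M i j = 0) ->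
    (forall i j, (blk j < blk i)%N -> N i j = 0) ->
    (forall i j, blk i = blk j -> N i j = (i == j)%:R) ->
  blk i = blk j -> (M *m N) i j = M i j.
Proof.
move=> M0 N0 N1 ij; rewrite mxE (bigD1 j) //= N1 // eqxx mulr1 big1 ?addr0 // => g gj.
case: (ltngtP (blk g) (blk j)) => gij.
- by rewrite M0 ?mul0r // ij.
- by rewrite N0 ?mulr0.
- by rewrite N1 // (negPf gj) mulr0.
Qed.

Let Ei_diag i j : blk i = blk j -> EiT i j = (i == j)%:R.
Proof. by move=> ij; rewrite -(mul_upper_diag Ei_off E_off E_diag) // EiE mxE. Qed.

Let mul_lower_diag (M N : 'M[ps A]_n) i j :
    (forall i j, (blk i < blk j)%N -> M i j = 0) ->
    (forall i j, (blk i < blk j)%N -> N i j = 0) ->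
    (forall i j, blk i = blk j -> N i j = (i == j)%:R) ->
  blk i = blk j -> (M *m N) i j = M i j.
Proof.
move=> M0 N0 N1 ij; rewrite mxE (bigD1 j) //= N1 // eqxx mulr1 big1 ?addr0 // => g gj.
case: (ltngtP (blk g) (blk j)) => gij.
- by rewrite N0 ?mulr0.
- by rewrite M0 ?mul0r // ij.
- by rewrite N1 // (negPf gj) mulr0.
Qed.

Let Fi_diag i j : blk i = blk j -> FiT i j = (i == j)%:R.
Proof.
move=> ij; rewrite -(mul_lower_diag Fi_off F_off F_diag) //.
by rewrite (sinv_mul (bg_Fconst TFDE)) mxE.
Qed.

Let row_cut (Q : pred 'I_n) i j : (forall g, Q g = (blk g <= blk i)%N) ->
  (EiT *m diag_pr _ Q *m ET) i j = ET i j.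
Proof.
move=> QE; rewrite mxE (bigD1 i) //= Mdiag_pr QE leqnn mulr1 Ei_diag // eqxx mul1r.
rewrite big1 ?addr0 // => g gi; rewrite Mdiag_pr QE.
case: (ltngtP (blk g) (blk i)) => gij.
- by rewrite Ei_off ?mul0r.
- by rewrite mulr0 mul0r.
- by rewrite Ei_diag // eq_sym (negPf gi) !mul0r.
Qed.

Let row_cutC (Q : pred 'I_n) i j : (forall g, Q g = (blk g <= blk i)%N) ->
  (EiT *m diag_pr _ (predC Q) *m ET) i j = (i == j)%:R - ET i j.
Proof.
move=> QE; rewrite diag_pr_predC mulmxBr mulmxBl mulmx1 EiE.
by rewrite mxE [(- _ : 'M[ps A]_n) _ _]mxE row_cut // mxE.
Qed.

Section TwoCuts.
Variables (i0 h0 : 'I_n) (ih : (blk i0 <= blk h0)%N).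
Let P : pred 'I_n := fun g => (blk g <= blk i0)%N.
Let Q : pred 'I_n := fun g => (blk g <= blk h0)%N.
Let YP := cx (EiT *m diag_pr _ P *m ET).
Let YQ := cy (EiT *m diag_pr _ (predC Q) *m ET).

Let PQ : subpred P Q. Proof. by move=> g gi; apply: leq_trans gi ih. Qed.
Let Pdown i j : (blk i <= blk j)%N -> P j -> P i.
Proof. by move=> ij; apply: leq_trans. Qed.
Let QCup i j : (blk i <= blk j)%N -> predC Q i -> predC Q j.
Proof. by rewrite /= /Q -!ltnNge => ij ih0; apply: leq_trans ih0 ij. Qed.

Let NP := cx (EiT *m diag_pr _ P *m DiT *m FiT).
Let MQ := cy (FT *m DT *m diag_pr _ (predC Q) *m ET).

Let NPi : corner_inverse P (cx (series_mx T)) NP.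
Proof. exact: map_corner_inverse (down_corner TFDE Pdown). Qed.
Let TSi : corner_inverse predT (cy (series_mx T)) (cy S).
Proof. exact: map_corner_inverse TS. Qed.
Let MQi : corner_inverse (predC Q) (cy S) MQ.
Proof. exact: map_corner_inverse (up_corner TFDE QCup). Qed.

Let YPE : NP *m cx (series_mx T) = YP.
Proof.
rewrite -map_mxM (bg_mul TFDE) -/FT -/DT -/ET !mulmxA; congr map_mx; congr (_ *m _).
rewrite -(mulmxA _ FiT) (sinv_mul (bg_Fconst TFDE)) mulmx1.
by rewrite -(mulmxA _ DiT) (sinv_mul (bg_Dconst TFDE)) mulmx1.
Qed.
Let YQE : cy S *m MQ = YQ.
Proof.
rewrite -map_mxM /S !mulmxA; congr map_mx; congr (_ *m _ *m _).
rewrite -(mulmxA _ FiT) (sinv_mul (bg_Fconst TFDE)) mulmx1.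
by rewrite -(mulmxA _ DiT) (sinv_mul (bg_Dconst TFDE)) mulmx1.
Qed.

Let YY := cuts_comm (@vdiff_comm A) (@vprod_comm A) PQ R NPi TSi MQi.
Let YYadj := cuts_comm_adjacent (@vdiff_comm A) (@vprod_comm A) PQ R NPi TSi MQi.

Let YProw j : YP i0 j = inx (ET i0 j).
Proof. by rewrite mxE row_cut. Qed.
Let YQrow j : YQ h0 j = (h0 == j)%:R - iny (ET h0 j).
Proof. by rewrite mxE row_cutC // rmorphB rmorph_nat. Qed.

Let br_rows j k : inx (ET i0 j) * iny (ET h0 k) - iny (ET h0 k) * inx (ET i0 j)
  = - (YP i0 j * YQ h0 k - YQ h0 k * YP i0 j).
Proof.
rewrite YProw YQrow mulrBr mulrBl [inx _ * _%:R]commr_nat.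
by rewrite [RHS]opprB opprB [RHS]addrC addrA subrK.
Qed.

(** The right-hand side of cuts_comm has order at least 3 in (x, y), because of
    the factors z p and p p; division by (y - x)^2 leaves order 1. *)
Lemma E_commutator_cuts G : filtration G -> (forall r i j, G r (E r i j)) ->
  forall j k r s,
    G (r + s - 1)%N (E r i0 j * E s h0 k - E s h0 k * E r i0 j).
Proof.
move=> GG GE j k r s.
have GEi : forall t i j, G t (sinv E t i j) := sinv_graded (graded_mx_class GG n) GE.
have fE i j' : fil2 G 0 (cx ET i j') /\ fil2 G 0 (cx EiT i j').
  by split; rewrite mxE; apply: fil2_inx => // t; rewrite series_mxE.
have fE' i j' : fil2 G 0 (cy ET i j') /\ fil2 G 0 (cy EiT i j').
  by split; rewrite mxE; apply: fil2_iny => // t; rewrite series_mxE.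
have fYP i j' : fil2 G 0 (YP i j').
  rewrite /YP /cx !map_mxM map_diag_pr.
  apply: fil2_mulmx => //; first apply: fil2_mulmx => //.
  - by move=> a b; case: (fE a b).
  - by move=> a b; apply: fil2_diag_pr.
  - by move=> a b; case: (fE a b).
have fYQ i j' : fil2 G 0 (YQ i j').
  rewrite /YQ /cy !map_mxM map_diag_pr.
  apply: fil2_mulmx => //; first apply: fil2_mulmx => //.
  - by move=> a b; case: (fE' a b).
  - by move=> a b; apply: fil2_diag_pr.
  - by move=> a b; case: (fE' a b).
have fV := fil2_mulmx GG fYP fYQ.
suff: fil2 G 1 (inx (ET i0 j) * iny (ET h0 k) - iny (ET h0 k) * inx (ET i0 j)).
  by move=> /(_ r s); rewrite !psB inx_iny iny_inx !series_mxE.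
rewrite br_rows; apply: fil2N => //.
apply: (fil2_vdiff_inv GG); apply: (fil2_vdiff_inv GG).
have := YY i0 j h0 k; rewrite YPE YQE => ->.
apply: fil2D => //.
  rewrite -mulrA; apply: fil2_vdiff => //; apply: fil2_vprod => //.
  apply: fil2B => //; apply: fil2M => //.
  by apply: fil2B => //; apply: fil2_diag_pr.
apply: fil2W => //; rewrite -mulrA; do 2!apply: fil2_vprod => //.
by apply: fil2M.
Qed.

(** The coefficient of x^(r+1) y in cuts_comm_adjacent, where only the constant
    terms of Y' contribute. *)
Lemma E_adjacent_cuts k r : (blk i0 < blk h0)%N -> (blk h0 < blk k)%N ->
  E r i0 h0 * E 1%N h0 k - E 1%N h0 k * E r i0 h0 = E r i0 k.
Proof.
move=> ih' hk; have := YYadj i0 k (j := h0).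
rewrite YPE YQE => /(_ _ (leqnn _)); rewrite /P -ltnNge ih' => /(_ isT) H.
have E0 a b : E 0%N a b = (a == b)%:R by rewrite (bg_Econst TFDE) mxE.
have br r' s' : E r' i0 h0 * E s' h0 k - E s' h0 k * E r' i0 h0
    = - (YP i0 h0 * YQ h0 k - YQ h0 k * YP i0 h0) r' s'.
  have := congr1 (fun f : ps (ps A) => f r' s') (br_rows h0 k).
  by rewrite /= !psB inx_iny iny_inx !series_mxE => ->.
have := congr1 (fun f : ps (ps A) => f r.+1 1%N) H.
rewrite /= vdiffM vprodM -[X in X - _]opprK -br E0 commr_nat subrr oppr0 sub0r br => ->.
have c0 g : (EiT *m diag_pr _ (predC Q) *m ET) g k 0%N = (diag_pr A (predC Q)) g k.
  have -> : diag_pr A (predC Q) = map_mx (@ps_const A) (EiT *m diag_pr _ (predC Q) *m ET).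
    rewrite !map_mxM map_diag_pr.
    have -> : map_mx (@ps_const A) EiT = 1%:M.
      by apply/matrixP => a b; rewrite mxE /ps_const series_mxE.
    have -> : map_mx (@ps_const A) ET = 1%:M.
      by apply/matrixP => a b; rewrite mxE /ps_const series_mxE (bg_Econst TFDE).
    by rewrite mul1mx mulmx1.
  by rewrite [RHS]mxE.
have VE g : (YP i0 g * YQ g k) r 0%N = E r i0 g * (diag_pr A (predC Q)) g k.
  by rewrite YProw [YQ g k]mxE inx_iny c0 series_mxE.
rewrite mxE ps_sum ps_sum (bigD1 k) //= VE mxE eqxx /= /Q -ltnNge hk mulr1.
by rewrite big1 ?addr0 // => g gk; rewrite VE mxE (negPf gk) mulr0.
Qed.

End TwoCuts.

Lemma E_commutator G : filtration G -> (forall r i j, G r (E r i j)) ->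
  forall i j h k r s, G (r + s - 1)%N (E r i j * E s h k - E s h k * E r i j).
Proof.
move=> GG GE i j h k r s; case: (leqP (blk i) (blk h)) => ih.
  exact: E_commutator_cuts.
rewrite -opprB; apply: filtrationN => //; rewrite addnC.
exact: E_commutator_cuts (ltnW ih) _ GG GE _ _ _ _.
Qed.

Lemma E_adjacent i j k r : (blk i < blk j)%N -> (blk j < blk k)%N ->
  E r i j * E 1%N j k - E 1%N j k * E r i j = E r i k.
Proof. by move=> ij jk; apply: E_adjacent_cuts (ltnW ij) _ _ ij jk. Qed.

Section DiagonalBlocks.
Variable (b : nat).
Let U : pred 'I_n := fun g => (b <= blk g)%N.
Let W : pred 'I_n := fun g => blk g == b.
Let MU := FT *m DT *m diag_pr _ U *m ET.

Let MUi : corner_inverse U S MU.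
Proof. by apply: (up_corner TFDE) => i j ij; rewrite /U => bi; apply: leq_trans ij. Qed.

Let MU_diag i j : blk i = b -> blk j = b -> MU i j = DT i j.
Proof.
move=> ib jb; rewrite /MU mxE (bigD1 j) //= Mdiag_pr /U jb leqnn mulr1 E_diag // eqxx mulr1.
rewrite big1 ?addr0 => [|g gj]; last first.
  rewrite Mdiag_pr; case: (ltngtP (blk g) (blk j)) => gij.
  - by rewrite /U leqNgt -jb gij mulr0 mul0r.
  - by rewrite E_off ?mulr0.
  - by rewrite E_diag // (negPf gj) mulr0.
rewrite mxE (bigD1 i) //= F_diag // eqxx mul1r big1 ?addr0 // => g gi.
case: (blk g =P blk j) => gj; last by rewrite D_off ?mulr0 //; apply/eqP.
by rewrite F_diag ?gj ?ib // eq_sym (negPf gi) mul0r.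
Qed.

(** The relation goes from T to its inverse, then to the corner of the blocks from
    b on, then to the inverse of this corner, whose first block is D_b. *)
Lemma D_rtt : rtt (vdiff A) (vprod A) W (cx DT) (cy DT).
Proof.
have SR : rtt (vdiff A) (vprod A) predT (cy S) (cx S).
  apply: (rtt_inv (@vdiff_comm A) (@vprod_comm A) R); exact: map_corner_inverse TS.
have SU : rtt (vdiff A) (vprod A) U (cy S) (cx S) by apply: rtt_sub SR.
have MR : rtt (vdiff A) (vprod A) U (cx MU) (cy MU).
  apply: (rtt_inv (@vdiff_comm A) (@vprod_comm A) SU); exact: map_corner_inverse MUi.
move=> i j h k Wi Wj Wh Wk; move: (Wi) (Wj) (Wh) (Wk) => /eqP ib /eqP jb /eqP hb /eqP kb.
have sub g : W g -> U g by rewrite /W /U => /eqP ->.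
have := MR i j h k (sub _ Wi) (sub _ Wj) (sub _ Wh) (sub _ Wk).
rewrite ![cx MU _ _]mxE ![cy MU _ _]mxE !MU_diag //.
by rewrite ![cx DT _ _]mxE ![cy DT _ _]mxE.
Qed.

(** The corner of T up to block a commutes with the corner of T^-1 from block
    b on; D_a and D_b are read off from the inverses of these corners. *)
Lemma D_commute i j h k r s : blk i = blk j -> (blk i < b)%N -> blk h = b -> blk k = b ->
  D r i j * D s h k = D s h k * D r i j.
Proof.
move=> ij ib hb kb; pose a := blk i.
pose La : pred 'I_n := fun g => (blk g <= a)%N.
pose Wa : pred 'I_n := fun g => blk g == a.
pose N := EiT *m diag_pr _ La *m DiT *m FiT.
have Ni : corner_inverse La (series_mx T) N.
  by apply: (down_corner TFDE) => g l gl; apply: leq_trans.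
have c1 i' j' : La i' -> La j' -> GRing.comm (cx (series_mx T) i' j') (cy MU h k).
  move=> Li Lj; apply: (commr_corner_inverse (map_corner_inverse (@iny A) MUi)) => g l Ug Ul.
  apply: (@vdiff_lreg A); apply/eqP; rewrite -subr_eq0 -mulrBr; apply/eqP.
  rewrite (rtt_mixed (@vdiff_comm A) (@vprod_comm A) R (map_corner_inverse (@iny A) TS)) //.
  have ne x y : La x -> U y -> (x == y) = false.
    by move=> Lx Uy; apply/eqP => xy; move: Lx Uy; rewrite xy /La /U /a; lia.
  have diag_pr0 x y : (x == y) = false -> diag_pr (ps (ps A)) predT x y = 0.
    by move=> xy; rewrite mxE xy.
  by rewrite !diag_pr0 ?mul0r ?mulr0 ?subr0 ?mulr0 // ?[g == _]eq_sym; apply: ne.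
have c2 i' j' : GRing.comm (cy MU h k) (cx N i' j').
  apply: (commr_corner_inverse (map_corner_inverse (@inx A) Ni)) => g l Lg Ll.
  exact/commr_sym/c1.
have Ndiag i' j' : Wa i' -> Wa j' -> N i' j' = DiT i' j'.
  rewrite /Wa => /eqP ia /eqP ja; rewrite /N -mulmxA mxE (bigD1 i') //= Mdiag_pr.
  rewrite /La ia leqnn mulr1 Ei_diag // eqxx mul1r big1 ?addr0 => [|g gi]; last first.
    rewrite Mdiag_pr; case: (ltngtP (blk g) (blk i')) => gij.
    - by rewrite Ei_off ?mul0r.
    - by rewrite /La leqNgt -ia gij mulr0 mul0r.
    - by rewrite Ei_diag // eq_sym (negPf gi) !mul0r.
  rewrite mxE (bigD1 j') //= Fi_diag // eqxx mulr1 big1 ?addr0 // => g gj.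
  case: (blk i' =P blk g) => ig; last by rewrite Di_off ?mul0r //; apply/eqP.
  by rewrite Fi_diag ?(negPf gj) ?mulr0 // -ig ia ja.
have Dcorner : corner_inverse Wa (diag_pr _ Wa *m DiT *m diag_pr _ Wa) (diag_pr _ Wa *m DT *m diag_pr _ Wa).
  have com (M : 'M[ps A]_n) : (forall i j, blk i != blk j -> M i j = 0) ->
      diag_pr _ Wa *m M = M *m diag_pr _ Wa.
    move=> M0; apply/matrixP => x y; rewrite diag_prM Mdiag_pr.
    case: (blk x =P blk y) => [xy|/eqP xy]; last by rewrite M0 ?mulr0 ?mul0r.
    by rewrite /Wa xy; apply/esym/commr_nat.
  have DDi := mul_sinv (bg_Dconst TFDE); have DiD := sinv_mul (bg_Dconst TFDE).
  have wD := com _ D_off; have wDi := com _ Di_off.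
  rewrite wD wDi -2!(mulmxA _ (diag_pr _ Wa)) diag_pr_idem; split.
  - by rewrite mulmxA wD -mulmxA diag_pr_idem.
  - by rewrite -mulmxA diag_pr_idem.
  - by rewrite -!mulmxA (mulmxA (diag_pr _ Wa) DiT) wDi -!mulmxA !diag_pr_idem mulmxA DDi mul1mx.
  - rewrite (mulmxA (diag_pr _ Wa)) wDi -!mulmxA (mulmxA (diag_pr _ Wa) (diag_pr _ Wa)) diag_pr_idem.
    by rewrite (mulmxA (diag_pr _ Wa) DT) wD -mulmxA diag_pr_idem mulmxA DiD mul1mx.
have c3 i' j' : GRing.comm (cy MU h k) (cx (diag_pr _ Wa *m DT *m diag_pr _ Wa) i' j').
  apply: (commr_corner_inverse (map_corner_inverse (@inx A) Dcorner)) => g l Wg Wl.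
  rewrite [map_mx (@inx A) _ _ _]mxE Mdiag_pr diag_prM Wg Wl mul1r mulr1 -Ndiag //.
  by have := c2 g l; rewrite [cx _ _ _]mxE.
have := c3 i j; rewrite ![cx _ _ _]mxE Mdiag_pr diag_prM /Wa -ij eqxx mul1r mulr1.
rewrite [cy _ _ _]mxE MU_diag // => /(congr1 (fun f : ps (ps A) => f r s)).
by rewrite inx_iny iny_inx !series_mxE.
Qed.

End DiagonalBlocks.

Lemma D_commutator G : filtration G -> (forall r i j, G r (D r i j)) ->
  forall i j h k r s, G (r + s - 1)%N (D r i j * D s h k - D s h k * D r i j).
Proof.
move=> GG GD i j h k r s.
case: (blk i =P blk j) => [ij|/eqP ij]; last first.
  by rewrite (bg_Doff TFDE) // mulr0 mul0r subr0; apply: filtration0.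
case: (blk h =P blk k) => [hk|/eqP hk]; last first.
  by rewrite [D s h k](bg_Doff TFDE) // mulr0 mul0r subr0; apply: filtration0.
case: (ltngtP (blk i) (blk h)) => ih.
- by rewrite (D_commute r s ij ih) // subrr; apply: filtration0.
- by rewrite (D_commute s r hk ih) // subrr; apply: filtration0.
suff: fil2 G 1 (cx DT i j * cy DT h k - cy DT h k * cx DT i j).
  by move=> /(_ r s); rewrite !psB ![cx _ _ _]mxE ![cy _ _ _]mxE inx_iny iny_inx !series_mxE.
apply: (fil2_vdiff_inv GG); rewrite (D_rtt (b := blk i)) ?ij ?hk ?eqxx // -?hk -?ih -?ij //.
apply: fil2_vprod => //.
have fx a b : fil2 G 0 (cx DT a b).
  by rewrite mxE; apply: fil2_inx => // t; rewrite series_mxE.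
have fy a b : fil2 G 0 (cy DT a b).
  by rewrite mxE; apply: fil2_iny => // t; rewrite series_mxE.
by apply: fil2B => //; apply: fil2M.
Qed.

End BlockGaussCommutators.

(** * Spanning by ordered monomials *)

Section Words.
Variables (K : comNzRingType) (A : algType K) (I : choiceType) (x : I -> A).
Implicit Types (P Q : seq I -> Prop) (s t : seq I) (y : A).

Definition mon s : A := \prod_(i <- s) x i.

Lemma mon_cat s t : mon (s ++ t) = mon s * mon t.
Proof. by rewrite /mon big_cat. Qed.
Lemma mon_cons i s : mon (i :: s) = x i * mon s.
Proof. by rewrite /mon big_cons. Qed.

Inductive wspan P : A -> Prop :=
| Wspan0 : wspan P 0
| WspanD c s y : P s -> wspan P y -> wspan P (c *: mon s + y).

Lemma wspan_mon P s : P s -> wspan P (mon s).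
Proof. by move=> Ps; rewrite -[mon s]addr0 -[mon s]scale1r; apply: WspanD => //; apply: Wspan0. Qed.

Lemma wspan_add P y z : wspan P y -> wspan P z -> wspan P (y + z).
Proof.
move=> Hy Hz; elim: Hy => [|c s y' Ps _ IH]; first by rewrite add0r.
by rewrite -addrA; apply: WspanD.
Qed.

Lemma wspan_scale P c y : wspan P y -> wspan P (c *: y).
Proof.
elim=> [|d s z Ps _ IH]; first by rewrite scaler0; apply: Wspan0.
by rewrite scalerDr scalerA; apply: WspanD.
Qed.

Lemma wspan_opp P y : wspan P y -> wspan P (- y).
Proof. by rewrite -scaleN1r; apply: wspan_scale. Qed.

Lemma wspan_sub P y z : wspan P y -> wspan P z -> wspan P (y - z).
Proof. by move=> Hy Hz; apply: wspan_add => //; apply: wspan_opp. Qed.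

Lemma wspan_sum P (J : Type) (r : seq J) (B : pred J) (F : J -> A) :
  (forall j, B j -> wspan P (F j)) -> wspan P (\sum_(j <- r | B j) F j).
Proof. by move=> H; apply: big_ind => //; [apply: Wspan0|apply: wspan_add]. Qed.

Lemma wspan_bind P Q y : wspan P y -> (forall s, P s -> wspan Q (mon s)) -> wspan Q y.
Proof.
move=> Hy PQ; elim: Hy => [|c s z Ps _ IH]; first exact: Wspan0.
by apply: wspan_add => //; apply: wspan_scale; apply: PQ.
Qed.

Lemma wspanW P Q y : (forall s, P s -> Q s) -> wspan P y -> wspan Q y.
Proof. by move=> PQ Hy; apply: (wspan_bind Hy) => s /PQ; apply: wspan_mon. Qed.

Lemma wspan_mul P Q (R : seq I -> Prop) y z :
    (forall s t, P s -> Q t -> R (s ++ t)) ->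
  wspan P y -> wspan Q z -> wspan R (y * z).
Proof.
move=> PQR Hy Hz; elim: Hy => [|c s y' Ps _ IH]; first by rewrite mul0r; apply: Wspan0.
rewrite mulrDl; apply: wspan_add => //; rewrite -scalerAl; apply: wspan_scale.
elim: Hz => [|d t z' Qt _ IHz]; first by rewrite mulr0; apply: Wspan0.
rewrite mulrDr -scalerAr -mon_cat; apply: WspanD => //; exact: PQR.
Qed.

Lemma wspan_none P y : (forall s, ~ P s) -> wspan P y -> y = 0.
Proof. by move=> nP; case=> // c s z /nP. Qed.

Variable w : I -> nat.

Definition wt s : nat := (\sum_(i <- s) w i)%N.

Lemma wt_cat s t : wt (s ++ t) = (wt s + wt t)%N.
Proof. by rewrite /wt big_cat. Qed.
Lemma wt_cons i s : wt (i :: s) = (w i + wt s)%N.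
Proof. by rewrite /wt big_cons. Qed.
Lemma wt_perm s t : perm_eq s t -> wt s = wt t.
Proof. by move=> st; apply: perm_big. Qed.

(** The inequality is strict so that degree -1, the zero subspace, is fil 0. *)
Definition fil e := wspan (fun s => (wt s < e)%N).

Lemma filS e e' y : (e <= e')%N -> fil e y -> fil e' y.
Proof. by move=> ee'; apply: wspanW => s se; apply: leq_trans se ee'. Qed.

Lemma fil_mon s : fil (wt s).+1 (mon s). Proof. exact: wspan_mon. Qed.

Lemma fil_gen i : fil (w i).+1 (x i).
Proof. by have := fil_mon [:: i]; rewrite /mon big_seq1 /wt big_seq1. Qed.

Lemma fil_bool (b : bool) : fil 1 b%:R.
Proof.
case: b; last exact: Wspan0.
have -> : true%:R = mon [::] :> A by rewrite /mon big_nil.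
by apply: wspan_mon; rewrite /wt big_nil.
Qed.

Lemma fil_mulr a b y z : fil a y -> fil b.+1 z -> fil (a + b) (y * z).
Proof. by apply: wspan_mul => s t; rewrite wt_cat; lia. Qed.
Lemma fil_mull a b y z : fil a.+1 y -> fil b z -> fil (a + b) (y * z).
Proof. by apply: wspan_mul => s t; rewrite wt_cat; lia. Qed.

Lemma fil_zero y : fil 0 y -> y = 0. Proof. exact: wspan_none. Qed.

Lemma fil_filtration : filtration (fun r => fil r.+1).
Proof.
split=> [|r|r y z|r y|r s y z|r s y rs].
- exact: (fil_bool true).
- exact: Wspan0.
- exact: wspan_add.
- exact: wspan_opp.
- by move=> Hy Hz; have := fil_mulr Hy Hz.
- exact: filS.
Qed.

Hypothesis comm_lower : forall i j, fil (w i + w j) (x i * x j - x j * x i).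

Lemma fil_comm_mon i t : fil (w i + wt t) (x i * mon t - mon t * x i).
Proof.
elim: t => [|j t IH]; first by rewrite /mon big_nil mulr1 mul1r subrr; apply: Wspan0.
have -> : x i * mon (j :: t) - mon (j :: t) * x i
   = (x i * x j - x j * x i) * mon t + x j * (x i * mon t - mon t * x i).
  by rewrite mon_cons mulrBl mulrBr !mulrA addrA subrK.
rewrite wt_cons; apply: wspan_add.
  by rewrite addnA; apply: fil_mulr => //; apply: fil_mon.
rewrite addnCA; apply: fil_mull => //.
exact: fil_gen.
Qed.

(** Moving the first letter into its place costs commutators, of lower weight. *)
Lemma fil_perm s t : perm_eq s t -> fil (wt s) (mon s - mon t).
Proof.
elim: s t => [|i s IH] t st.
  have /nilP -> : nilp t by rewrite /nilp -(perm_size st).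
  by rewrite subrr; apply: Wspan0.
have it : i \in t by rewrite -(perm_mem st) mem_head.
case/splitPr: it st => t1 t2 st.
have {}st : perm_eq s (t1 ++ t2).
  by rewrite -(perm_cons i) (perm_trans st) // -[i :: t2]cat1s perm_catCA.
have -> : mon (i :: s) - mon (t1 ++ i :: t2)
  = x i * (mon s - mon (t1 ++ t2)) + (x i * mon t1 - mon t1 * x i) * mon t2.
  by rewrite !mon_cat !mon_cons mulrBl mulrBr !mulrA addrA subrK.
apply: wspan_add; last first.
  rewrite wt_cons (wt_perm st) wt_cat addnA; apply: fil_mulr; first exact: fil_comm_mon.
  exact: fil_mon.
rewrite wt_cons; apply: fil_mull; last exact: IH.
exact: fil_gen.
Qed.

Lemma fil_comm a b y z : fil a.+1 y -> fil b.+1 z -> fil (a + b) (y * z - z * y).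
Proof.
move=> Hy Hz; elim: Hy => [|c s y' sa _ IH].
  by rewrite mul0r mulr0 subrr; apply: Wspan0.
rewrite mulrDl mulrDr opprD addrACA; apply: wspan_add => //.
rewrite -scalerAl -scalerAr -scalerBr; apply: wspan_scale.
elim: Hz => [|d t z' tb _ IHz]; first by rewrite mul0r mulr0 subrr; apply: Wspan0.
rewrite mulrDl mulrDr opprD addrACA; apply: wspan_add => //.
rewrite -scalerAl -scalerAr -scalerBr; apply: wspan_scale; rewrite -!mon_cat.
have p : perm_eq (s ++ t) (t ++ s) by rewrite perm_catC.
by apply: filS (fil_perm p); rewrite wt_cat; apply: leq_add.
Qed.

(** Sorting a word leaves an error of strictly lower weight, to which the same
    argument applies. *)
Lemma fil_sorted (le : rel I) e y : total_order le -> fil e y ->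
  wspan (fun s => sorted le s /\ (wt s < e)%N) y.
Proof.
move=> [_ _ _ le_total]; elim/ltn_ind: e y => e IH y Hy.
apply: (wspan_bind Hy) => s se.
have ps : perm_eq s (sort le s) by rewrite perm_sym perm_sort.
rewrite -[mon s](subrK (mon (sort le s))); apply: wspan_add.
  apply: wspanW (IH _ se _ (fil_perm ps)) => t [-> ts]; split=> //.
  exact: ltn_trans se.
by apply: wspan_mon; rewrite sort_sorted // -(wt_perm ps).
Qed.

End Words.

Section LinSpan.
Variables (K : comNzRingType) (V : lmodType K) (J : eqType) (v : J -> V).

(* Coefficients of repeated vectors are added up. *)
Lemma lin_span_pairs (l : seq (K * J)) : lin_span v (\sum_(q <- l) q.1 *: v q.2).
Proof.
exists (undup (map snd l)), (fun j => \sum_(q <- l | q.2 == j) q.1).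
under [RHS]eq_bigr => j _ do rewrite scaler_suml big_mkcond.
rewrite exchange_big /=; apply: eq_big_seq => q ql.
rewrite (bigD1_seq q.2) ?undup_uniq ?mem_undup ?map_f //= eqxx.
by rewrite big1 ?addr0 // => j /negPf jq; rewrite eq_sym jq.
Qed.

End LinSpan.

Section OrderedMonomials.
Variables (K : comNzRingType) (A : algType K) (I : choiceType) (x : I -> A) (le : rel I).

Lemma wspan_lin_span (P : seq I -> Prop) y : (forall s, P s -> sorted le s) ->
  wspan x P y -> lin_span (@ordered_monomial K A I x le) y.
Proof.
move=> Ple Hy.
suff [l ->] : exists l : seq (K * {s : seq I | sorted le s}),
    y = \sum_(q <- l) q.1 *: ordered_monomial x q.2 by apply: lin_span_pairs.
elim: Hy => [|c s z Ps _ [l ->]]; first by exists [::]; rewrite big_nil.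
by exists ((c, exist _ s (Ple s Ps)) :: l); rewrite big_cons.
Qed.

Lemma generated_subalg_closed (S : set A) : GRing.subalg_closed (mem (generated_subalg S)).
Proof.
split=> [|c y z|y z].
- by rewrite inE => B [[]]; rewrite inE.
- rewrite !inE => Hy Hz B [BB SB]; have [_ BZ _] := BB.
  by have := BZ c y z; rewrite !inE; apply; [apply: Hy|apply: Hz].
- rewrite !inE => Hy Hz B [BB SB]; have [_ _ BM] := BB.
  by have := BM y z; rewrite !inE; apply; [apply: Hy|apply: Hz].
Qed.

Lemma sub_generated (S : set A) y : S y -> generated_subalg S y.
Proof. by move=> Sy B [_]; apply. Qed.

(** The elements of bounded weight form a subalgebra, hence exhaust the one that S
    generates. *)
Lemma span_ordered_monomials (w : I -> nat) (S : set A) : total_order le ->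
    (forall i j, fil x w (w i + w j) (x i * x j - x j * x i)) ->
    (forall i, generated_subalg S (x i)) ->
    (forall y, S y -> exists e, fil x w e y) ->
  lin_span (@ordered_monomial K A I x le) = generated_subalg S.
Proof.
move=> tle xx Sx xS; have [G1 GL GM] := generated_subalg_closed S.
rewrite predeqE => y; split.
  move=> [s [c ->]]; have : 0 \in generated_subalg S.
    by have := GL (-1) _ _ G1 G1; rewrite scaleN1r addNr.
  have Gmon (t : seq I) : mon x t \in generated_subalg S.
    elim: t => [|i t IH]; first by rewrite /mon big_nil.
    by rewrite mon_cons; apply: GM => //; rewrite inE; apply: Sx.
  move=> G0; suff : \sum_(j <- s) c j *: ordered_monomial x j \in generated_subalg S.
    by rewrite inE.
  elim: s => [|t s IH]; first by rewrite big_nil.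
  by rewrite big_cons; apply: GL => //; apply: Gmon.
move=> Gy; suff [e He] : exists e, fil x w e y.
  by apply: wspan_lin_span (fil_sorted xx tle He) => s [].
apply: (Gy [set z | exists e, fil x w e z]%classic); split=> //.
split=> [|c y1 y2|y1 y2]; rewrite !inE /=.
- by exists 1%N; exact: filtration1 (fil_filtration x w).
- move=> [e1 H1] [e2 H2]; exists (maxn e1 e2); apply: wspan_add.
    by apply: wspan_scale; apply: filS H1; rewrite leq_maxl.
  by apply: filS H2; rewrite leq_maxr.
- move=> [e1 H1] [e2 H2]; exists (e1 + e2)%N.
  by apply: fil_mulr H1 _; apply: filS H2.
Qed.

End OrderedMonomials.

(** * Independence of ordered monomials *)

Section PartialDerivatives.
Variables (K : numFieldType) (A : algType K) (I : choiceType) (x : I -> A) (w : I -> nat).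
Hypothesis w_gt0 : forall i, (0 < w i)%N.
Variable partial : I -> A -> A.
Hypothesis partialD : forall i y z, partial i (y + z) = partial i y + partial i z.
Hypothesis partialZ : forall i c y, partial i (c *: y) = c *: partial i y.
Hypothesis partial_mon : forall i s,
  fil x w (wt w s - w i) (partial i (mon x s) - (count_mem i s)%:R *: mon x (rem i s)).

Lemma wt_rem i s : i \in s -> wt w s = (w i + wt w (rem i s))%N.
Proof. by move=> si; rewrite -wt_cons; apply: wt_perm; apply: perm_to_rem. Qed.

Lemma partial_fil i d y : fil x w d y -> fil x w (d - w i) (partial i y).
Proof.
have partial0 : partial i 0 = 0 by rewrite -(scale0r 0) partialZ !scale0r.
elim=> [|c s z sd _ IH]; first by rewrite partial0; apply: Wspan0.
rewrite partialD partialZ; apply: wspan_add => //; apply: wspan_scale.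
rewrite -[partial i _](subrK ((count_mem i s)%:R *: mon x (rem i s))); apply: wspan_add.
  by apply: filS (partial_mon i s); apply: leq_sub2r; apply: ltnW.
case si: (i \in s); last first.
  by rewrite (count_memPn _) ?si // scale0r; apply: Wspan0.
by apply: wspan_scale; apply: wspan_mon; have := wt_rem si; have := w_gt0 i; lia.
Qed.

(** The partial derivative along a letter i of one of the words lowers the weight
    and multiplies its coefficient by the exponent of i, which is not zero in K;
    words that differ as multisets stay different after removal of i. *)
Lemma mon_independent d (Z : eqType) (S : seq Z) (f : Z -> seq I) (c : Z -> K) :
    uniq S -> (forall z, z \in S -> wt w (f z) = d) ->
    {in S &, forall z z', perm_eq (f z) (f z') -> z = z'} ->
    fil x w d (\sum_(z <- S) c z *: mon x (f z)) ->
  forall z, z \in S -> c z = 0.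
Proof.
elim/ltn_ind: d Z S f c => d IH Z S f c uS wS injS Sd z0 z0S.
case Ef: (f z0) => [|i s].
  have d0 : d = 0%N by rewrite -(wS _ z0S) Ef /wt big_nil.
  have fS z : z \in S -> z = z0.
    move=> zS; apply: injS => //; rewrite Ef.
    case E : (f z) (wS _ zS) => [//|j t]; rewrite d0 wt_cons.
    by have := w_gt0 j; lia.
  move: Sd; rewrite d0 => /fil_zero.
  rewrite (bigD1_seq z0) //= big1_seq ?addr0 => [|z /andP[zz0 zS]]; last first.
    by rewrite (fS _ zS) eqxx in zz0.
  by rewrite Ef /mon big_nil => /eqP; rewrite scaler_eq0 oner_eq0 orbF => /eqP.
pose S' := [seq z <- S | i \in f z].
have z0S' : z0 \in S' by rewrite mem_filter Ef mem_head.
have wi := w_gt0 i.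
have wid : (w i <= d)%N by rewrite -(wS _ z0S) Ef wt_cons leq_addr.
have dd : (d - w i < d)%N by lia.
have := IH _ dd _ S' (fun z => rem i (f z)) (fun z => c z * (count_mem i (f z))%:R).
move=> /(_ _ _ _ _ z0 z0S') => H.
have /eqP : c z0 * (count_mem i (f z0))%:R = 0.
  apply: H => [||z z'|]; first exact: filter_uniq.
  - by move=> z; rewrite mem_filter => /andP[iz zS]; rewrite -(wS z zS) (wt_rem iz) addKn.
  - rewrite !mem_filter => /andP[iz zS] /andP[iz' zS'] p; apply: injS => //.
    by rewrite (perm_trans (perm_to_rem iz)) // perm_sym (perm_trans (perm_to_rem iz')) //
      perm_cons perm_sym.
  have E : partial i (\sum_(z <- S) c z *: mon x (f z))
      = \sum_(z <- S) c z *: partial i (mon x (f z)).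
    elim: (S) => [|z S1 IH1]; first by rewrite !big_nil -(scale0r 0) partialZ !scale0r.
    by rewrite !big_cons partialD partialZ IH1.
  have F : fil x w (d - w i) (\sum_(z <- S) c z *: ((count_mem i (f z))%:R *: mon x (rem i (f z)))).
    have := partial_fil i Sd; rewrite E => HE.
    rewrite -[X in fil _ _ _ X](subKr (\sum_(z <- S) c z *: partial i (mon x (f z)))).
    apply: wspan_sub => //; rewrite -sumrB big_seq_cond; apply: wspan_sum => z.
    rewrite andbT => zS; rewrite -scalerBr; apply: wspan_scale.
    by have := partial_mon i (f z); rewrite (wS _ zS).
  rewrite big_filter; rewrite (bigID (fun z => i \in f z)) /= in F.
  rewrite [X in _ + X]big1 ?addr0 in F => [|z iz]; last first.
    by rewrite (count_memPn iz) scale0r scaler0.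
  by under eq_bigr => z _ do rewrite -scalerA.
by rewrite mulf_eq0 Ef /= eqxx pnatr_eq0 /= orbF => /eqP.
Qed.

(** The top weight part of a relation among the X_j is, modulo lower weight, a
    relation among the x_i. *)
Lemma ordered_monomials_indep (J : choiceType) (X : J -> A) (phi : J -> I) (le : rel J) :
    injective phi -> antisymmetric le -> transitive le ->
    (forall j, fil x w (w (phi j)) (X j - x (phi j))) ->
  lin_indep (@ordered_monomial K A J X le).
Proof.
move=> phi_inj le_anti le_tr Xx.
have Xmon t : fil x w (wt w (map phi t)) (mon X t - mon x (map phi t)).
  elim: t => [|j t IH]; first by rewrite /mon !big_nil subrr; apply: Wspan0.
  have -> : mon X (j :: t) - mon x (map phi (j :: t))
     = (X j - x (phi j)) * mon X t + x (phi j) * (mon X t - mon x (map phi t)).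
    by rewrite /= !mon_cons mulrBl mulrBr addrA subrK.
  rewrite /= wt_cons; apply: wspan_add.
    apply: fil_mulr => //; rewrite -[mon X t](subrK (mon x (map phi t))).
    by apply: wspan_add; [apply: filS IH|apply: fil_mon].
  by apply: fil_mull => //; apply: fil_gen.
have Xfil t : fil x w (wt w (map phi t)).+1 (mon X t).
  rewrite -[mon X t](subrK (mon x (map phi t))); apply: wspan_add; last exact: fil_mon.
  exact: filS (Xmon t).
pose f (z : {s : seq J | sorted le s}) := map phi (sval z).
have f_inj z z' : perm_eq (f z) (f z') -> z = z'.
  move=> p; apply: val_inj; apply: (@sorted_eq _ le) => //; try exact: valP.
  exact: perm_map_inj phi_inj _ _ p.
suff H N : forall (s : seq {s : seq J | sorted le s}) c, uniq s ->
    (forall z, z \in s -> (wt w (f z) < N)%N) ->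
    \sum_(z <- s) c z *: ordered_monomial X z = 0 -> forall z, z \in s -> c z = 0.
  move=> s c us s0 z zs; apply: (H (\max_(z <- s) wt w (f z)).+1 s c us _ s0) => // z' z's.
  by rewrite ltnS; apply: leq_bigmax_seq.
elim: N => [|N IH] s c us sN s0; first by move=> z /sN.
have top z : z \in s -> wt w (f z) = N -> c z = 0.
  move=> zs zN; pose S := [seq z <- s | wt w (f z) == N].
  apply: (@mon_independent N _ S f c); rewrite ?filter_uniq ?mem_filter ?zN ?eqxx //.
  - by move=> z'; rewrite mem_filter => /andP[/eqP].
  - by move=> z' z'' _ _; apply: f_inj.
  have -> : \sum_(z' <- S) c z' *: mon x (f z')
     = - (\sum_(z' <- S) c z' *: (mon X (sval z') - mon x (f z')))
       - \sum_(z' <- s | wt w (f z') != N) c z' *: mon X (sval z').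
    move: s0; rewrite (bigID (fun z' => wt w (f z') == N)) /= -big_filter -/S.
    move=> /eqP; rewrite addr_eq0 => /eqP E.
    under [X in - X - _]eq_bigr => z' _ do rewrite scalerBr.
    rewrite sumrB opprB; rewrite /ordered_monomial in E.
    by rewrite /mon E opprK addrK.
  apply: wspan_sub.
    apply: wspan_opp; rewrite big_seq_cond; apply: wspan_sum => z'; rewrite andbT mem_filter.
    by move=> /andP[/eqP <- _]; apply: wspan_scale; apply: Xmon.
  rewrite big_seq_cond; apply: wspan_sum => z' /andP[z's z'N]; apply: wspan_scale.
  by apply: filS (Xfil (sval z')); have := sN _ z's; rewrite -/(f z'); lia.
move=> z zs; case: (wt w (f z) =P N) => zN; first exact: top.
apply: (IH [seq z <- s | wt w (f z) != N]); rewrite ?filter_uniq ?mem_filter //.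
- move=> z'; rewrite mem_filter => /andP[z'N /sN]; lia.
- rewrite big_filter -[RHS]s0 [RHS](bigID (fun z' => wt w (f z') == N)) /=.
  by rewrite big_seq_cond [X in _ = X + _]big1_seq ?add0r -?big_seq_cond // => z' /andP[/eqP z'N z's];
    rewrite top ?scale0r.
- by rewrite zs andbT; apply/eqP.
Qed.

End PartialDerivatives.

(** * Homomorphisms from the Yangian *)

Section YangianLift.
Variables (K : comNzRingType) (n : nat) (B : nzRingType).
Variables (iota : {rmorphism K -> B}) (iotaC : forall c b, GRing.comm (iota c) b).
Variable tau : 'I_n -> 'I_n -> nat -> B.
Hypothesis tau0 : forall i j, tau i j 0%N = (i == j)%:R.
Hypothesis tauR : forall i j h k r s, yangian_relator tau i j h k r s = 0.

Local Notation yfree := {malg K[{fmonom (ygen n)}]}.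

Definition word_eval (u : {fmonom (ygen n)}) : B :=
  \prod_(l <- (u : seq (ygen n))) tau l.1.1 l.1.2 l.2.+1.

Lemma word_eval_mmorphism : mmorphism word_eval.
Proof.
by split=> [u v|]; rewrite /word_eval ?fmM ?fm1 ?big_cat ?big_nil.
Qed.
HB.instance Definition _ :=
  isMultiplicative.Build {fmonom (ygen n)} B word_eval word_eval_mmorphism.

Let ev : yfree -> B := mmap iota word_eval.

Let evM (u v : yfree) : ev (u * v) = ev u * ev v.
Proof.
have [H _] := @commr_mmap_is_multiplicative _ _ _ iota word_eval
  (fun g m m' => iotaC (mcoeff m g) (word_eval m')).
exact: H.
Qed.
Let ev1 : ev 1 = 1. Proof. exact: mmap1. Qed.
Let evB (u v : yfree) : ev (u - v) = ev u - ev v. Proof. exact: mmapB. Qed.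
Let evZ c (u : yfree) : ev (c *: u) = iota c * ev u. Proof. exact: mmapZ. Qed.

Let evT i j r : ev (yfreeT K i j r) = tau i j r.
Proof.
case: r => [|r]; last first.
  rewrite /ev /yfreeT mmapU /word_eval fmU big_seq1.
  by rewrite -[RHS]mul1r; congr (_ * _); apply: (rmorph1 iota).
rewrite /= tau0; case: (i == j) => /=; first exact: ev1.
by have := evB 0 0; rewrite !subr0 subrr.
Qed.

Let ev_ideal (u : yfree) : (u \in @yideal K n) -> ev u = 0.
Proof.
move=> /yidealP /(_ [set v | ev v = 0]%classic) H; apply: H; split.
  split=> /=.
  - by have := evB 0 0; rewrite !subr0 subrr.
  - by move=> a b a0 b0; rewrite evB a0 b0 subr0.
  - by move=> a b b0; rewrite evM b0 mulr0.
  - by move=> a b b0; rewrite evM b0 mul0r.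
move=> _ [i [j [h [k [r [s ->]]]]]] /=.
have evS (m : nat) (f : 'I_m -> yfree) : ev (\sum_(t < m) f t) = \sum_(t < m) ev (f t).
  exact: (raddf_sum (mmap iota word_eval)).
have evC i1 j1 r1 i2 j2 r2 i3 j3 r3 i4 j4 r4 :
    ev (yfreeT K i1 j1 r1 * yfreeT K i2 j2 r2 - yfreeT K i3 j3 r3 * yfreeT K i4 j4 r4)
    = tau i1 j1 r1 * tau i2 j2 r2 - tau i3 j3 r3 * tau i4 j4 r4.
  apply: etrans (evB _ _) _; congr (_ - _); apply: etrans (evM _ _) _;
  by congr (_ * _); apply: evT.
rewrite -(tauR i j h k r s); apply: etrans (evB _ _) _; congr (_ - _); first exact: evC.
by apply: etrans (evS _ _) _; apply: eq_bigr => t _; apply: evC.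
Qed.

Lemma yangian_lift : exists delta : yangian K n -> B,
  [/\ forall u v, delta (u + v) = delta u + delta v,
      forall u v, delta (u * v) = delta u * delta v,
      delta 1 = 1,
      forall c u, delta (c *: u) = iota c * delta u
    & forall i j r, delta (yangianT K i j r) = tau i j r].
Proof.
pose delta (u : yangian K n) := ev (repr u).
have dpi u : delta (ypi u) = ev u.
  by apply/eqP; rewrite -subr_eq0 -evB; apply/eqP/ev_ideal/ypi_repr.
exists delta; split.
- elim/ypi_surj=> u; elim/ypi_surj=> v.
  by rewrite -ypiD !dpi; apply: mmapD.
- elim/ypi_surj=> u; elim/ypi_surj=> v.
  have -> : ypi u * ypi v = ypi (u * v) by exact: ypiM.
  by rewrite !dpi evM.
- exact: etrans (dpi 1) ev1.
- move=> c; elim/ypi_surj=> u.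
  have -> : c *: ypi u = ypi (c *: u) by exact: ypiZ.
  by rewrite !dpi evZ.
- by move=> i j r; rewrite dpi evT.
Qed.

End YangianLift.

Section YangianWords.
Variables (K : comNzRingType) (n : nat).
Local Notation Y := (yangian K n).

Definition genT (l : ygen n) : Y := yangianT K l.1.1 l.1.2 l.2.+1.

Lemma yangian_words (w : ygen n -> nat) (y : Y) : exists e, fil genT w e y.
Proof.
elim/ypi_surj: y => u.
have piM x y : ypi (x * y) = ypi x * ypi y := esym (ypiM x y).
have piS := big_morph (@ypi K n) (@ypiD K n) (@ypi0 K n).
have piW (s : seq (ygen n)) : ypi << 1 *g FMonom s >> = mon genT s.
  elim: s => [|l s IH].
    rewrite /mon big_nil.
    have -> : FMonom [::] = @mone (fmonom (ygen n)) by apply: val_inj; rewrite /= fm1.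
    by [].
  rewrite mon_cons -IH -piM; congr ypi.
  have -> : FMonom (l :: s) = mmul (fmu l) (FMonom s) by apply: val_inj; rewrite /= fmM fmU.
  case: l => -[i j] r; apply/esym/(etrans (fgmulUU _ _ _ _)).
  by rewrite mulr1.
rewrite (monalgE u) piS.
apply: (big_ind (fun y => exists e, fil genT w e y)) => [|y z [d Hy] [e Hz]|[s] _].
- by exists 0%N; apply: Wspan0.
- exists (maxn d e); apply: wspan_add.
    by apply: filS Hy; rewrite leq_maxl.
  by apply: filS Hz; rewrite leq_maxr.
exists (wt w s).+1.
have -> : mkmalgU (FMonom s) (mcoeff (FMonom s) u)
    = mcoeff (FMonom s) u *: mkmalgU (FMonom s) 1.
  by apply/malgP => k; rewrite mcoeffZ !mcoeffU mulrnAr mulr1.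
have -> c (z : {malg K[{fmonom (ygen n)}]}) : ypi (c *: z) = c *: ypi z.
  by symmetry; exact: ypiZ.
by apply: wspan_scale; rewrite piW; apply: fil_mon.
Qed.

End YangianWords.

Section ProductRTT.
Variables (B : nzRingType) (n : nat) (z p : B).
Hypotheses (zC : forall b, GRing.comm z b) (pC : forall b, GRing.comm p b).
Variables (T T' L L' : 'M[B]_n).
Hypotheses (TL' : forall i j h k, GRing.comm (T i j) (L' h k))
  (T'L : forall i j h k, GRing.comm (T' i j) (L h k)).

(** The identity behind the comultiplication of the Yangian: the mixed terms
    cancel after exchange of the two summation indices. *)
Lemma rtt_mul : rtt z p predT T T' -> rtt z p predT L L' ->
  rtt z p predT (T *m L) (T' *m L').
Proof.
move=> RT RL i j h k _ _ _ _.
pose g (X Y : 'M[B]_n) (U V : 'M[B]_n) i h j k :=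
  \sum_a \sum_b X i a * Y h b * (U a j * V b k).
have mulE (X Y U V : 'M[B]_n) i' j' h' k' :
    (forall a b, GRing.comm (Y h' b) (U a j')) ->
    (X *m U) i' j' * (Y *m V) h' k' = g X Y U V i' h' j' k'.
  move=> YU; rewrite !mxE mulr_suml; apply: eq_bigr => a _.
  rewrite mulr_sumr; apply: eq_bigr => b _.
  by rewrite -!mulrA; congr (_ * _); rewrite !mulrA YU.
rewrite !mulE //; try by move=> a b; first [exact: TL'|exact: T'L].
have E : z * (g T T' L L' i h j k - g T' T L' L h i k j)
    = \sum_a \sum_b p * (T h a * T' i b * (L a j * L' b k)
        - T' h a * T i b * (L a j * L' b k)
        + (T' h b * T i a * (L b j * L' a k) - T' h b * T i a * (L' b j * L a k))).
  rewrite /g [X in _ - X]exchange_big /= -sumrB mulr_sumr; apply: eq_bigr => a _.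
  rewrite -sumrB mulr_sumr; apply: eq_bigr => b _.
  have -> : T i a * T' h b * (L a j * L' b k) - T' h b * T i a * (L' b k * L a j)
    = (T i a * T' h b - T' h b * T i a) * (L a j * L' b k)
      + T' h b * T i a * (L a j * L' b k - L' b k * L a j).
    by rewrite mulrBl mulrBr addrA subrK.
  rewrite mulrDr mulrA RT //.
  have -> (c d : B) : z * (d * c) = d * (z * c) by rewrite mulrA zC -mulrA.
  rewrite RL // (mulrA _ p) -pC -!(mulrA p) -mulrDr; congr (p * _).
  by rewrite mulrBl mulrBr.
rewrite {}E.
under eq_bigr => a _ do rewrite -mulr_sumr.
rewrite -mulr_sumr; congr (p * _).
under eq_bigr => a _ do rewrite big_split sumrB sumrB.
rewrite big_split !sumrB /= -!/(g _ _ _ _ _ _ _ _).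
rewrite -/(g T T' L L' h i j k) -/(g T' T L L' h i j k).
have -> : \sum_a \sum_b T' h b * T i a * (L b j * L' a k) = g T' T L L' h i j k.
  by rewrite exchange_big.
have -> : \sum_a \sum_b T' h b * T i a * (L' b j * L a k) = g T' T L' L h i j k.
  by rewrite exchange_big.
by rewrite addrA subrK.
Qed.

End ProductRTT.

Lemma yrtt_mul (A : nzRingType) n (T L : 'M[ps A]_n) :
    (forall i j h k r s, GRing.comm (T i j r) (L h k s)) ->
  yrtt T -> yrtt L -> yrtt (T *m L).
Proof.
move=> TL RT RL; rewrite /yrtt !map_mxM.
have xE (M : 'M[ps A]_n) i j : map_mx (@inx A) M i j = inx (M i j) by rewrite mxE.
have yE (M : 'M[ps A]_n) i j : map_mx (@iny A) M i j = iny (M i j) by rewrite mxE.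
apply: (rtt_mul (@vdiff_comm A) (@vprod_comm A)); last 2 first.
- exact: RT.
- exact: RL.
all: move=> i j h k; rewrite ?xE ?yE.
- by apply: psP => r; apply: psP => s; rewrite inx_iny iny_inx TL.
- by apply: psP => r; apply: psP => s; rewrite inx_iny iny_inx TL.
Qed.

Section YangianDegrees.
Variables (K : comNzRingType) (n : nat).
Local Notation Y := (yangian K n).
Local Notation x := (@genT K n).

Lemma fil_mul_any (A : algType K) (I : choiceType) (g : I -> A) (w : I -> nat) a b e y z :
  ((0 < a)%N -> (0 < b)%N -> (a + b - 1 <= e)%N) -> fil g w a y -> fil g w b z ->
  fil g w e (y * z).
Proof.
case: a b => [|a] [|b] H Hy Hz.
- by rewrite (fil_zero Hy) mul0r; apply: Wspan0.
- by rewrite (fil_zero Hy) mul0r; apply: Wspan0.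
- by rewrite (fil_zero Hz) mulr0; apply: Wspan0.
- have := H isT isT; rewrite addSn subn1 => {}H.
  by apply: filS H _; apply: fil_mull.
Qed.

(** Twice the loop degree r of T^(r+1) plus one for its length as a word. In a
    defining relation the terms with t = 0 have the loop degree of the commutator
    but length 1, and the others have length 2 but lower loop degree; this weight
    decreases in both cases. *)
Definition loop_weight (l : ygen n) : nat := (2 * l.2 + 1)%N.
Definition canonical_weight (l : ygen n) : nat := l.2.+1.

Lemma yangianT_fil (w : ygen n -> nat) (d : nat -> nat) :
    (forall l, d l.2.+1 = (w l).+1) -> d 0%N = 1%N ->
  forall i j r, fil x w (d r) (yangianT K i j r).
Proof.
move=> dw d0 i j [|r].
  by rewrite yangianT0 d0; apply: fil_bool.
by rewrite (dw (i, j, r)); apply: (fil_gen x w (i, j, r)).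
Qed.

Lemma yangianT_comm_fil (w : ygen n -> nat) (d : nat -> nat) :
    (forall l, d l.2.+1 = (w l).+1) -> d 0%N = 1%N ->
    (forall a b, (d a + d b - 1 <= d (a + b))%N) ->
    (forall a b, (0 < a)%N -> (0 < b)%N -> (d (a + b - 1) <= d a + d b - 2)%N) ->
  forall l m, fil x w (w l + w m) (x l * x m - x m * x l).
Proof.
move=> dw d0 dD dB [[i j] r] [[h k] s]; rewrite /genT /=.
have -> : yangianT K i j r.+1 * yangianT K h k s.+1 - yangianT K h k s.+1 * yangianT K i j r.+1
    = \sum_(t < minn r.+1 s.+1)
     (yangianT K i k (r.+1 + s.+1 - 1 - t)%N * yangianT K h j t
      - yangianT K i k t * yangianT K h j (r.+1 + s.+1 - 1 - t)%N).
  by apply/eqP; rewrite -subr_eq0; apply/eqP; apply: yangianT_relation.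
have Tfil := yangianT_fil dw d0.
apply: wspan_sum => t _; have tr : (t < r.+1)%N by apply: leq_trans (ltn_ord t) (geq_minl _ _).
have De : (d (r.+1 + s.+1 - 1) <= w (i, j, r) + w (h, k, s))%N.
  by apply: leq_trans (dB r.+1 s.+1 isT isT) _; rewrite (dw (i, j, r)) (dw (h, k, s)); lia.
have E : (r.+1 + s.+1 - 1 - t + t = r.+1 + s.+1 - 1)%N by lia.
apply: wspan_sub; apply: (fil_mul_any _ (Tfil _ _ _) (Tfil _ _ _)) => _ _;
  apply: leq_trans (dD _ _) _.
  by rewrite E.
by rewrite addnC E.
Qed.

Lemma yangianT_comm_loop l m : fil x loop_weight (loop_weight l + loop_weight m) (x l * x m - x m * x l).
Proof.
apply: (@yangianT_comm_fil loop_weight (fun r => maxn 1 (2 * r))) => //.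
- by case=> ij r; rewrite /loop_weight /=; lia.
- by move=> a b; lia.
- by move=> a b; lia.
Qed.

Lemma yangianT_comm_can l m : fil x canonical_weight (canonical_weight l + canonical_weight m) (x l * x m - x m * x l).
Proof.
apply: (@yangianT_comm_fil canonical_weight (fun r => r.+1)) => //.
- by move=> a b; lia.
- by move=> a b; lia.
Qed.

End YangianDegrees.

Lemma eq_yangian_relator (A : nzRingType) n (T T' : 'I_n -> 'I_n -> nat -> A) i j h k r s :
  (forall i j r, T i j r = T' i j r) ->
  yangian_relator T i j h k r s = yangian_relator T' i j h k r s.
Proof.
move=> TT; rewrite /yangian_relator !TT; congr (_ - _).
by apply: eq_bigr => t _; rewrite !TT.
Qed.

Lemma yangian_relator_rmorph (A B : nzRingType) (f : {rmorphism A -> B}) n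
    (T : 'I_n -> 'I_n -> nat -> A) i j h k r s :
  f (yangian_relator T i j h k r s)
    = yangian_relator (fun i j r => f (T i j r)) i j h k r s.
Proof.
rewrite /yangian_relator rmorphB rmorphB !rmorphM rmorph_sum; congr (_ - _).
by apply: eq_bigr => t _; rewrite rmorphB !rmorphM.
Qed.

(** * The coaction on an evaluation module *)

Section Evaluation.
Variables (A : nzRingType) (n : nat).
Local Notation B := 'M[{poly A}]_n.+1.

Definition scal : A -> B := scalar_mx \o polyC.
HB.instance Definition _ := GRing.RMorphism.on scal.

(** The matrix units e_ij avoid the index 0: in size n, the unit matrix would be
    the sum of the e_ii. *)
Definition munit (i j : 'I_n) : B := delta_mx (lift ord0 i) (lift ord0 j).
Definition zpow (k : nat) : B := ('X^k)%:M.

Lemma scal_mulE a (M : B) u v k : ((scal a * M) u v)`_k = a * (M u v)`_k.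
Proof. by rewrite -[_ * M]/(_ %:M *m M) mul_scalar_mx mxE coefCM. Qed.

Lemma scal_delta_sum i (M : 'I_n -> B) : \sum_g scal (i == g)%:R * M g = M i.
Proof.
rewrite (bigD1 i) //= eqxx rmorph1 mul1r big1 ?addr0 // => g gi.
by rewrite eq_sym (negPf gi) rmorph0 mul0r.
Qed.

Lemma scalE a u v k : ((scal a) u v)`_k = a *+ ((u == v) && (k == 0)%N).
Proof. by rewrite mxE coefMn coefC; case: (u == v); case: (k == 0)%N. Qed.

Lemma scalar_commr (a : {poly A}) (M : B) :
  (forall i j, a * M i j = M i j * a) -> GRing.comm a%:M M.
Proof.
move=> aM; apply/matrixP => i j; rewrite -[_ * M]/(a%:M *m M) -[M * _]/(M *m a%:M).
rewrite mul_scalar_mx mxE aM mxE (bigD1 j) //= big1 ?addr0 => [|k kj].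
  by rewrite mxE eqxx mulr1n.
by rewrite mxE (negPf kj) mulr0n mulr0.
Qed.

Lemma scal_munit a i j : GRing.comm (scal a) (munit i j).
Proof. by apply: scalar_commr => u v; rewrite mxE; exact: commr_nat. Qed.
Lemma zpow_comm k (M : B) : GRing.comm (zpow k) M.
Proof. by apply: scalar_commr => u v; rewrite commr_polyXn. Qed.

Lemma munitM i j h k : munit i j * munit h k = (j == h)%:R * munit i k.
Proof.
rewrite /munit -[LHS]/(delta_mx _ _ *m delta_mx _ _).
case: (j =P h) => [->|/eqP jh]; first by rewrite mul_delta_mx mul1r.
by rewrite mul_delta_mx_0 ?mul0r // (inj_eq lift_inj).
Qed.

Lemma munit_zpowE i j k u v t : ((munit i j * zpow k) u v)`_t
  = ((u == lift ord0 i) && (v == lift ord0 j) && (t == k))%:R.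
Proof.
rewrite -[_ * zpow _]/(_ *m _%:M) mxE (bigD1 v) //= big1 ?addr0; last first.
  by move=> w wv; rewrite [X in _ * X]mxE (negPf wv) mulr0.
rewrite [X in _ * X]mxE eqxx mulr1n coefMXn mxE -[t == k]andTb.
have coef_bool (b : bool) l : (b%:R : {poly A})`_l = (b && (l == 0)%N)%:R.
  by case: b; rewrite ?coef1 ?coef0.
rewrite coef_bool; case: ltngtP => [tk|tk|->]; rewrite ?andbF ?subnn //.
by rewrite subn_eq0 leqNgt tk andbF.
Qed.

Definition zgeom : ps B := fun r => if r is r'.+1 then zpow r' else 0.

Lemma zgeom_comm r (M : B) : GRing.comm (zgeom r) M.
Proof. by case: r => [|r]; [apply: commr_sym; apply: commr0|apply: zpow_comm]. Qed.

(** The evaluation 1 + e / (u - zeta), as x / (1 - zeta x) = 1 / (u - zeta). *)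
Definition evaluation_mx : 'M[ps B]_n :=
  \matrix_(i, j) ((i == j)%:R + psC (munit i j) * zgeom).

(** From 1/(v - zeta) - 1/(u - zeta) = (u - v) / ((u - zeta)(v - zeta)). *)
Lemma zgeom_rtt :
  vdiff B * (inx zgeom * iny zgeom) = vprod B * (iny zgeom - inx zgeom).
Proof.
apply: psP => r; apply: psP => s; rewrite vdiffM vprodM.
have inyE a b : iny zgeom a b = if a is 0%N then zgeom b else 0 by case: a.
have inxE a b : inx zgeom a b = if b is 0%N then zgeom a else 0 by case: b.
have zz a b : zpow a * zpow b = zpow (a + b) by rewrite /zpow exprD scalar_mxM.
case: r s => [|r] [|s]; rewrite ?psB ?inx_iny ?inyE ?inxE ?mul0r ?mulr0 ?subr0 ?subrr //.
case: r s => [|r] [|s]; rewrite /= ?mul0r ?mulr0 ?subr0 ?sub0r ?zz //.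
- by rewrite addn0.
- by rewrite addnS addSn subrr.
Qed.

Lemma evaluation_mx_rtt : yrtt evaluation_mx.
Proof.
move=> i j h k _ _ _ _.
pose e a b : ps (ps B) := iny (psC (munit a b)).
pose Q := inx zgeom; pose Q' := iny zgeom.
have xL a b : map_mx (@inx B) evaluation_mx a b = (a == b)%:R + e a b * Q.
  rewrite !mxE rmorphD rmorphM rmorph_nat; congr (_ + _ * _).
  by apply: psP => -[|r]; apply: psP => -[|s].
have yL a b : map_mx (@iny B) evaluation_mx a b = (a == b)%:R + e a b * Q'.
  by rewrite !mxE rmorphD rmorphM rmorph_nat.
have QQ' : GRing.comm Q Q'.
  by apply: psP => r; apply: psP => s; rewrite inx_iny iny_inx zgeom_comm.
have Qe a b : GRing.comm Q (e a b).
  by apply: psP => r; apply: psP => s; rewrite inx_iny iny_inx zgeom_comm.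
have Q'e a b : GRing.comm Q' (e a b).
  rewrite /GRing.comm -!rmorphM; congr (iny _); apply: ps_commr => r s.
  exact: zgeom_comm.
have ee a b c d : e a b * e c d = (b == c)%:R * e a d.
  by rewrite -!rmorphM munitM !rmorphM !rmorph_nat.
rewrite !xL !yL.
have natC (b : bool) (u v : ps (ps B)) : (b%:R + u) * v - v * (b%:R + u) = u * v - v * u.
  by rewrite mulrDl mulrDr (commr_nat v b) opprD addrACA subrr add0r.
rewrite natC -opprB natC opprB.
have -> a b c d : e a b * Q * (e c d * Q') = (b == c)%:R * e a d * (Q * Q').
  by rewrite -ee -!mulrA; congr (_ * _); rewrite !mulrA (Qe c d).
have -> a b c d : e a b * Q' * (e c d * Q) = (b == c)%:R * e a d * (Q * Q').
  by rewrite -ee QQ' -!mulrA; congr (_ * _); rewrite !mulrA (Q'e c d).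
have zc (u v : ps (ps B)) : vdiff B * (u * v) = u * (vdiff B * v).
  by rewrite mulrA vdiff_comm -mulrA.
have pc (u v : ps (ps B)) : u * (vprod B * v) = vprod B * (u * v).
  by rewrite mulrA -vprod_comm -mulrA.
rewrite mulrBr !(zc (_%:R * _)).
rewrite zgeom_rtt -/Q -/Q'.
rewrite !pc -mulrBr; congr (vprod B * _).
have expand U V (b c : bool) : (b%:R + e h j * U) * (c%:R + e i k * V)
    = b%:R * c%:R + b%:R * (e i k * V) + c%:R * (e h j * U) + e h j * U * (e i k * V).
  by rewrite mulrDl !mulrDr !addrA -(commr_nat (e h j * U)).
rewrite !expand [j == h]eq_sym [k == i]eq_sym.
have -> : e h j * Q' * (e i k * Q) = e h j * Q * (e i k * Q').
  rewrite -!mulrA; congr (_ * _); rewrite !mulrA Qe Q'e -!mulrA; congr (_ * _).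
  by rewrite QQ'.
have rearrange (a p q w p' q' : ps (ps B)) :
    (a + p + q + w) - (a + p' + q' + w) = (p - p') - (q' - q).
  rewrite opprD addrACA subrr addr0 opprD addrACA.
  rewrite [X in X + _](_ : _ = p - p'); last by rewrite opprD addrACA subrr add0r.
  by rewrite opprB.
by rewrite rearrange -!mulrBr -!mulrA.
Qed.

End Evaluation.

Section YangianSeries.
Variables (K : comNzRingType) (n : nat).
Local Notation Y := (yangian K n).

Lemma yangian_yrtt : yrtt (series_mx (@yangianT_series K n)).
Proof.
apply: relator_yrtt => i j h k r s.
rewrite (eq_yangian_relator (T' := @yangianT K n)); first exact: yangianT_relation.
by move=> a b c; rewrite series_mxE mxE.
Qed.

Local Notation B := 'M[{poly Y}]_n.+1.

Definition scalT : 'M[ps B]_n := \matrix_(i, j) (fun r => scal n (yangianT K i j r)).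

Lemma scalT_rtt : yrtt scalT.
Proof.
apply: relator_yrtt => i j h k r s.
rewrite (eq_yangian_relator (T' := fun i j r => scal n (yangianT K i j r))); last first.
  by move=> a b c; rewrite mxE.
by rewrite -(yangian_relator_rmorph (scal n)) yangianT_relation rmorph0.
Qed.

Definition coaction_gen (i j : 'I_n) (r : nat) : B := (scalT *m evaluation_mx Y n) i j r.

Lemma evaluation_mxE i j r : (evaluation_mx Y n) i j r
  = if r is r'.+1 then munit Y i j * zpow Y n r' else (i == j)%:R.
Proof.
rewrite mxE psD psCM; case: (i == j); case: r => [|r];
  by rewrite /= ?mulr1n ?mulr0n ?ps1 ?mulr0 ?addr0 ?add0r ?mulr0n ?add0r.
Qed.

Lemma evaluation_mx_comm (y : Y) i j r : GRing.comm (scal n y) (evaluation_mx Y n i j r).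
Proof.
rewrite evaluation_mxE; case: r => [|r]; first exact: commr_nat.
apply: commrM; first exact: scal_munit.
exact/commr_sym/zpow_comm.
Qed.

Lemma coaction_gen0 i j : coaction_gen i j 0%N = (i == j)%:R.
Proof.
rewrite /coaction_gen mxE ps_sum (bigD1 i) //= psM big_ord1 mxE evaluation_mxE yangianT0 eqxx rmorph1 mul1r.
rewrite big1 ?addr0 // => g gi; rewrite psM big_ord1 mxE yangianT0 eq_sym (negPf gi).
by rewrite rmorph0 mul0r.
Qed.

Lemma coaction_gen_relator i j h k r s : yangian_relator coaction_gen i j h k r s = 0.
Proof.
apply: (@yrtt_relator _ _ (scalT *m evaluation_mx Y n)); first exact: coaction_gen0.
apply: yrtt_mul (scalT_rtt) (@evaluation_mx_rtt Y n) => a b c d r' s'.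
by rewrite mxE; apply: evaluation_mx_comm.
Qed.

Lemma coaction_genE i j r : coaction_gen i j r.+1 = scal n (yangianT K i j r.+1)
  + \sum_(s < r.+1) \sum_g scal n (yangianT K i g (r - s)%N) * (munit Y g j * zpow Y n s).
Proof.
rewrite /coaction_gen mxE ps_sum.
under eq_bigr => g _.
  rewrite psM big_ord_recr /= subnn evaluation_mxE (reindex_inj rev_ord_inj) /=.
over.
rewrite big_split [RHS]addrC; congr (_ + _); last first.
  rewrite (bigD1 j) //= eqxx mulr1 mxE big1 ?addr0 // => g gj.
  by rewrite (negPf gj) mulr0.
rewrite exchange_big; apply: eq_bigr => s _; apply: eq_bigr => g _.
have sr : (s <= r)%N by rewrite -ltnS.
by rewrite subSS evaluation_mxE subSn ?leq_subr // subKn // mxE.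
Qed.

End YangianSeries.

Lemma sub_subK3 (V : zmodType) (a b c : V) : b + c + (a - b - c) = a.
Proof. by rewrite addrC -[a - b - c]addrA -opprD subrK. Qed.

Lemma noncomm_expand (A : nzRingType) (t d r m D s : A) :
  (t + d + r) * (m + D + s) - t * m - (d * m + t * D)
    = t * s + d * (D + s) + r * (m + D + s).
Proof.
apply/eqP; rewrite !subr_eq; apply/eqP; rewrite !mulrDl !mulrDr !addrA.
by rewrite (ACl (3*5*6*7*8*9*4*2*1)).
Qed.

Section PartialDerivative.
Variables (K : comNzRingType) (n : nat).
Local Notation Y := (yangian K n).
Local Notation B := 'M[{poly Y}]_n.+1.
Local Notation x := (@genT K n).
Local Notation wl := (@loop_weight n).

Definition scalK : K -> B := scal n \o in_alg Y.
HB.instance Definition _ := GRing.RMorphism.on scalK.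

Lemma scalK_comm c (b : B) : GRing.comm (scalK c) b.
Proof.
apply: scalar_commr => i j; apply/polyP => k.
by rewrite coefCM coefMC /= -scalerAl -scalerAr mul1r mulr1.
Qed.

Lemma yangian_coaction : exists coaction : Y -> B,
  [/\ forall u v, coaction (u + v) = coaction u + coaction v,
      forall u v, coaction (u * v) = coaction u * coaction v,
      coaction 1 = 1,
      forall c u, coaction (c *: u) = scalK c * coaction u
    & forall i j r, coaction (yangianT K i j r) = coaction_gen K i j r].
Proof. exact: (yangian_lift scalK_comm (@coaction_gen0 K n) (@coaction_gen_relator K n)). Qed.

Definition coaction : Y -> B := sval (cid yangian_coaction).
Let coactionP := svalP (cid yangian_coaction).
Let coactionD u v : coaction (u + v) = coaction u + coaction v. Proof. by case: coactionP. Qed.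
Let coactionM u v : coaction (u * v) = coaction u * coaction v. Proof. by case: coactionP. Qed.
Let coaction1 : coaction 1 = 1. Proof. by case: coactionP. Qed.
Let coactionZ c u : coaction (c *: u) = scalK c * coaction u. Proof. by case: coactionP. Qed.
Let coactionT i j r : coaction (yangianT K i j r) = coaction_gen K i j r. Proof. by case: coactionP. Qed.

(** Subtracting the corner entry removes the multiples of the unit matrix. *)
Definition partial (l : ygen n) (y : Y) : Y :=
  ((coaction y) (lift ord0 l.1.1) (lift ord0 l.1.2))`_l.2
   - (l.1.1 == l.1.2)%:R * ((coaction y) ord0 ord0)`_l.2.

Lemma partialD l u v : partial l (u + v) = partial l u + partial l v.
Proof. by rewrite /partial coactionD ![(_ + _ : B) _ _]mxE !coefD mulrDr opprD addrACA. Qed.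

Lemma scalKE c (M : B) u v k : ((scalK c * M) u v)`_k = c *: (M u v)`_k.
Proof. by rewrite /scalK /= scal_mulE -scalerAl mul1r. Qed.

Lemma partialZ l c y : partial l (c *: y) = c *: partial l y.
Proof. by rewrite /partial coactionZ !scalKE scalerBr scalerAr. Qed.

(** zeta has weight 2, as multiplication by zeta raises the loop degree by 1. *)
Definition filmx e (M : B) : Prop := forall u v k, fil x wl (e - 2 * k) (M u v)`_k.

Lemma filmxW e e' M : (e <= e')%N -> filmx e M -> filmx e' M.
Proof. by move=> ee' HM u v k; apply: filS (HM u v k); lia. Qed.

Lemma filmx_D e M N : filmx e M -> filmx e N -> filmx e (M + N).
Proof. by move=> HM HN u v k; rewrite mxE coefD; apply: wspan_add; [apply: HM|apply: HN]. Qed.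

Lemma filmx_sum e (I : Type) (r : seq I) (P : pred I) (F : I -> B) :
  (forall i, P i -> filmx e (F i)) -> filmx e (\sum_(i <- r | P i) F i).
Proof.
move=> H; apply: big_ind => //; last exact: filmx_D.
by move=> u v k; rewrite mxE coef0; apply: Wspan0.
Qed.

Lemma filmx_M a b e M N : ((0 < a)%N -> (0 < b)%N -> (a + b - 1 <= e)%N) ->
  filmx a M -> filmx b N -> filmx e (M * N).
Proof.
move=> abe HM HN u v k; rewrite -[M * N]/(M *m N) mxE coef_sum.
apply: wspan_sum => c _; rewrite coefM; apply: wspan_sum => t _.
have tk : (t <= k)%N by rewrite -ltnS.
by apply: fil_mul_any (HM u c t) (HN c v (k - t)%N); lia.
Qed.

Arguments filmx_M {a b e M N}.

Lemma filmx_scal e y : fil x wl e y -> filmx e (scal n y).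
Proof.
move=> Hy u v k; rewrite scalE; case: k => [|k].
  by rewrite muln0 subn0 andbT; case: (u == v); [|apply: Wspan0].
by rewrite andbF; apply: Wspan0.
Qed.

Lemma filmx_munit_zpow i j k : filmx (2 * k).+1 (munit Y i j * zpow Y n k).
Proof.
move=> u v t; rewrite munit_zpowE; case: (_ && _) / andP => [[_ /eqP ->]|_]; last exact: Wspan0.
have -> : true%:R = mon x [::] :> Y by rewrite /mon big_nil.
by apply: wspan_mon; rewrite /wt big_nil; lia.
Qed.

Definition gen_linear (l : ygen n) : B := munit Y l.1.1 l.1.2 * zpow Y n l.2.

(** The remaining terms T_ig^(r-s) e_gj zeta^s, s < r, keep one letter but lose one
    unit of loop degree. *)
Lemma coaction_gen_leading l : filmx (wl l - 1) (coaction (x l) - scal n (x l) - gen_linear l).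
Proof.
case: l => -[i j] r; rewrite /genT /gen_linear /loop_weight /= coactionT coaction_genE.
have -> (a b c : B) : a + b - a - c = b - c by rewrite [a + b]addrC addrK.
have last : \sum_g scal n (yangianT K i g 0) * (munit Y g j * zpow Y n r)
    = munit Y i j * zpow Y n r.
  rewrite -[RHS](scal_delta_sum i (fun g => munit Y g j * zpow Y n r)).
  by apply: eq_bigr => g _; rewrite yangianT0.
rewrite big_ord_recr /= subnn last.
rewrite addrK; apply: filmx_sum => s _; apply: filmx_sum => g _.
have sr : (s < r)%N by [].
apply: (@filmx_M (2 * (r - s)) _ _ _ _ _ _ (filmx_munit_zpow g j s)); first by lia.
apply: filmx_scal; case E : (r - s)%N => [|t]; first by lia.
by apply: filS (fil_gen x wl (i, g, t)); rewrite /loop_weight /=; lia.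
Qed.

(** The terms in the image of a word where exactly one letter T_ij^(r+1) is
    replaced by e_ij zeta^r. *)
Fixpoint linear_part (s : seq (ygen n)) : B :=
  if s is l :: s' then gen_linear l * scal n (mon x s') + scal n (x l) * linear_part s' else 0.

Lemma filmx_gen_linear l : filmx (wl l) (gen_linear l).
Proof. by have := filmx_munit_zpow l.1.1 l.1.2 l.2; rewrite /loop_weight addn1. Qed.

Lemma filmx_gen l : filmx (wl l).+1 (scal n (x l)).
Proof. exact/filmx_scal/fil_gen. Qed.

Lemma filmx_linear_part s : filmx (wt wl s) (linear_part s).
Proof.
elim: s => [|l s IH] /=; first by move=> u v k; rewrite mxE coef0; apply: Wspan0.
rewrite wt_cons; apply: filmx_D.
  by apply: (filmx_M _ (filmx_gen_linear l) (filmx_scal (fil_mon x wl s))); lia.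
by apply: (filmx_M _ (filmx_gen l) IH); lia.
Qed.

(** Two letters that both become matrix units e_ij zeta^r cost two units of
    weight, since each carries its length 1. *)
Lemma coaction_mon s :
  filmx (wt wl s - 1) (coaction (mon x s) - scal n (mon x s) - linear_part s).
Proof.
elim: s => [|l s IH].
  rewrite /mon big_nil coaction1 rmorph1 subrr subr0.
  by move=> u v k; rewrite mxE coef0; apply: Wspan0.
rewrite mon_cons coactionM rmorphM wt_cons /=.
set t := scal n (x l); set d := gen_linear l; set m := scal n (mon x s).
set rho := coaction (x l) - t - d; set sigma := coaction (mon x s) - m - linear_part s.
have -> : coaction (x l) * coaction (mon x s) - t * m - (d * m + t * linear_part s)
    = t * sigma + d * (linear_part s + sigma) + rho * coaction (mon x s).
  have -> : coaction (x l) = t + d + rho by rewrite /rho sub_subK3.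
  have -> : coaction (mon x s) = m + linear_part s + sigma. by rewrite /sigma sub_subK3.
  exact: noncomm_expand.
have filmx_sigma : filmx (wt wl s) (linear_part s + sigma).
  by apply: filmx_D; [apply: filmx_linear_part|apply: filmxW IH; apply: leq_subr].
have filmx_coaction : filmx (wt wl s).+1 (coaction (mon x s)).
  rewrite -[coaction _](subrK m) -[_ - m](subrK (linear_part s)).
  apply: filmx_D; last exact: filmx_scal (fil_mon x wl s).
  apply: filmx_D; first by apply: filmxW IH; lia.
  by apply: filmxW (filmx_linear_part s); lia.
apply: filmx_D; first apply: filmx_D.
- by apply: (filmx_M _ (filmx_gen l) IH); lia.
- by apply: (filmx_M _ (filmx_gen_linear l) filmx_sigma); lia.
- by apply: (filmx_M _ (coaction_gen_leading l) filmx_coaction); lia.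
Qed.

Fixpoint leibniz (l : ygen n) (s : seq (ygen n)) : Y :=
  if s is l' :: s' then (l' == l)%:R * mon x s' + x l' * leibniz l s' else 0.

Lemma linear_part_entry s l :
  ((linear_part s) (lift ord0 l.1.1) (lift ord0 l.1.2))`_l.2 = leibniz l s.
Proof.
elim: s => [|l' s IH] /=; first by rewrite mxE coef0.
rewrite mxE coefD; congr (_ + _).
  rewrite -[_ * _]/(_ *m _%:M) mxE (bigD1 (lift ord0 l.1.2)) //= big1 ?addr0; last first.
    by move=> w wv; rewrite [X in _ * X]mxE (negPf wv) mulr0.
  rewrite [X in _ * X]mxE eqxx mulr1n coefMC munit_zpowE !(inj_eq lift_inj).
  case: l l' {IH} => [[i j] k] [[i' j'] k'] /=; congr (_%:R * _).
  by rewrite !xpair_eqE [i == _]eq_sym [j == _]eq_sym [k == _]eq_sym.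
by rewrite scal_mulE IH.
Qed.

Lemma linear_part_corner s k : ((linear_part s) ord0 ord0)`_k = 0.
Proof.
elim: s => [|l s IH] /=; first by rewrite mxE coef0.
rewrite mxE coefD scal_mulE IH mulr0 addr0 -[_ * scal n _]/(_ *m scal n _).
rewrite mxE coef_sum big1 // => c _.
rewrite coefM big1 // => t _; rewrite /gen_linear munit_zpowE.
by rewrite -val_eqE /= mul0r.
Qed.

(** Reinserting a letter in front or in place of l gives the same word modulo
    lower weight. *)
Lemma leibniz_rem l s :
  fil x wl (wt wl s - wl l) (leibniz l s - (count_mem l s)%:R *: mon x (rem l s)).
Proof.
elim: s => [|l' s IH] /=; first by rewrite scale0r subr0; apply: Wspan0.
have filx := fil_gen x wl l'.
have filstep : fil x wl (wt wl (l' :: s) - wl l)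
    (x l' * (leibniz l s - (count_mem l s)%:R *: mon x (rem l s))).
  by apply: fil_mul_any filx IH; rewrite wt_cons; lia.
case: (l' =P l) filstep => [<-|/eqP ll'] H; last first.
  rewrite mul0r add0r add0n mon_cons scalerAr -mulrBr.
  exact: H.
rewrite mul1r natrD scalerDl scale1r opprD addrACA subrr add0r.
case sl: (l' \in s); last first.
  have c0 : count_mem l' s = 0%N by apply/count_memPn; rewrite sl.
  by move: H; rewrite c0 !scale0r !subr0.
rewrite -[X in fil _ _ _ (X - _)](subrK ((count_mem l' s)%:R *: (x l' * mon x (rem l' s)))).
rewrite -addrA; apply: wspan_add; first by rewrite scalerAr -mulrBr.
rewrite -scalerBr -mon_cons; apply: wspan_scale.
rewrite wt_cons addKn (wt_perm wl (perm_to_rem sl)).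
apply: fil_perm; first exact: yangianT_comm_loop.
by rewrite perm_sym perm_to_rem.
Qed.

Lemma partial_mon l s : fil x wl (wt wl s - wl l)
  (partial l (mon x s) - (count_mem l s)%:R *: mon x (rem l s)).
Proof.
rewrite -[partial _ _](subrK (leibniz l s)) -addrA; apply: wspan_add; last exact: leibniz_rem.
pose r := coaction (mon x s) - scal n (mon x s) - linear_part s.
have r0 u v k : fil x wl (wt wl s - wl l + 2 * l.2 - 2 * k) (r u v)`_k.
  by apply: filS (coaction_mon s u v k); rewrite /loop_weight; lia.
have dE : coaction (mon x s) = r + linear_part s + scal n (mon x s) by rewrite /r !subrK.
clearbody r.
rewrite /partial dE ![(_ + _ : B) _ _]mxE !coefD linear_part_entry linear_part_corner addr0 !scalE eqxx.
rewrite (inj_eq lift_inj) mulrDr.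
have -> : (l.1.1 == l.1.2)%:R * (mon x s *+ (true && (l.2 == 0)%N))
    = mon x s *+ ((l.1.1 == l.1.2) && (l.2 == 0)%N).
  by case: (l.1.1 == l.1.2); rewrite ?mul1r ?mul0r.
rewrite opprD addrACA subrr addr0 addrAC addrK.
have := r0 (lift ord0 l.1.1) (lift ord0 l.1.2) l.2; have := r0 ord0 ord0 l.2.
rewrite addnK => H1 H2; apply: wspan_sub => //.
case: (l.1.1 == l.1.2) => /=; last by rewrite mul0r; apply: Wspan0.
by rewrite mulr1n mul1r.
Qed.

End PartialDerivative.

(** * Transposition and leading terms *)

Section Opposite.
Variables (A : nzRingType) (n : nat).

Definition op_mx (M : 'M[ps A]_n) : 'M[ps A^c]_n := \matrix_(i, j) (M j i : ps A^c).

Lemma op_mx_mul (M N : 'M[ps A]_n) : op_mx (M *m N) = op_mx N *m op_mx M.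
Proof.
apply/matrixP => i j; rewrite [LHS]mxE [LHS]mxE [RHS]mxE; apply: psP => r.
rewrite [LHS]ps_sum [RHS]ps_sum; apply: eq_bigr => k _; rewrite !mxE.
rewrite [LHS]psM [RHS]psM (reindex_inj rev_ord_inj) /=; apply: eq_bigr => t _.
by rewrite subSS subKn // -ltnS.
Qed.

Definition opseq (f : nat -> 'M[A]_n) : nat -> 'M[A^c]_n := fun r => (f r)^T.

Lemma series_mx_op f : series_mx (opseq f) = op_mx (series_mx f).
Proof. by apply/matrixP => i j; apply: psP => r; rewrite series_mxE !mxE. Qed.

Lemma op_block_gauss (blk : 'I_n -> nat) (T F D E : nat -> 'M[A]_n) :
  block_gauss blk T F D E -> block_gauss blk (opseq T) (opseq E) (opseq D) (opseq F).
Proof.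
case=> mul D0 Doff E0 Eoff Ediag F0 Foff Fdiag; split.
- by rewrite !series_mx_op mul !op_mx_mul mulmxA.
- by rewrite /opseq D0 trmx1.
- by move=> r i j ij; rewrite mxE Doff // eq_sym.
- by rewrite /opseq F0 trmx1.
- by move=> r i j ij; rewrite mxE Foff.
- by move=> r i j ij; rewrite mxE Fdiag // [j == i]eq_sym.
- by rewrite /opseq E0 trmx1.
- by move=> r i j ij; rewrite mxE Eoff.
- by move=> r i j ij; rewrite mxE Ediag // [j == i]eq_sym.
Qed.

(** A relator of the transposed matrix over the opposite ring is, up to sign, a
    relator of T with the two generators exchanged. *)
Lemma op_yrtt (T : nat -> 'M[A]_n) :
  (forall i j h k r s, yangian_relator (fun i j r => T r i j) i j h k r s = 0) ->
  yrtt (series_mx (opseq T)).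
Proof.
move=> R; apply: relator_yrtt => i j h k r s.
rewrite (eq_yangian_relator (T' := fun i j r => (T r j i : A^c))); last first.
  by move=> a b c; rewrite series_mxE mxE.
apply/eqP; rewrite -oppr_eq0 -(R j i k h r s) /yangian_relator; apply/eqP.
rewrite opprB opprB addrC; congr (_ + _); rewrite -sumrN.
by apply: eq_bigr => t _; rewrite opprB.
Qed.

Lemma op_filtration (G : nat -> A -> Prop) : filtration G -> filtration (A := A^c) G.
Proof.
case=> G1 G0 GD GN GM GW; split=> // r s y z Gy Gz.
by rewrite addnC; apply: GM.
Qed.

End Opposite.

Section GaussBlocks.
Variables (A : nzRingType) (m : nat) (nu : 'I_m -> nat).
Local Notation n := (\sum_a nu a)%N.
Variables (T F D E : nat -> 'M[A]_n).
Hypotheses (T0 : T 0%N = 1%:M) (TFDE : gauss_factorization T F D E).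

Definition blk (i : 'I_n) : nat := tagnat.sig1 i.

Lemma submxblockE (W : 'M[A]_n) a b i j :
  submxblock W a b i j = W (tagnat.Rank a i) (tagnat.Rank b j).
Proof. by rewrite mxE. Qed.

Lemma blk_Rank a (i : 'I_(nu a)) : blk (tagnat.Rank a i) = a.
Proof. by rewrite /blk tagnat.Rank1K. Qed.

Lemma gauss_block_gauss : block_gauss blk T F D E.
Proof.
case: (TFDE) => mul Doff Eoff Ediag E0 Foff Fdiag F0.
have ent (W : 'M[A]_n) i j : W i j =
    submxblock W (tagnat.sig1 i) (tagnat.sig1 j) (tagnat.sig2 i) (tagnat.sig2 j).
  by rewrite submxblockE !tagnat.sig2K.
have diag (W : nat -> 'M[A]_n) : (forall r a, submxblock (W r) a a = (r == 0)%N%:R%:M) ->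
    forall r i j, blk i = blk j -> W r i j = ((r == 0)%N && (i == j))%:R.
  move=> Wd r i j; rewrite -(tagnat.sig2K i) -(tagnat.sig2K j) !blk_Rank => ab.
  move: (tagnat.sig2 i) (tagnat.sig2 j); rewrite (val_inj ab) => i' j'.
  rewrite -submxblockE Wd mxE Rank_eqE eq_Tagged /=.
  by case: (i' == j'); case: (r == 0)%N; rewrite ?mulr1n ?mulr0n.
split=> //.
- have mulPS (f g : nat -> 'M[A]_n) : series_mx (smul f g) = series_mx f *m series_mx g.
    by apply/matrixP => i j; apply: psP => r; rewrite series_mx_mul series_mxE.
  by rewrite mul !mulPS.
- by move: T0; rewrite mul !smul0 F0 E0 mul1mx mulmx1.
- by move=> r i j ij; rewrite ent Doff ?mxE //; apply: contraNneq ij; rewrite /blk => ->.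
- by move=> r i j ij; rewrite ent Eoff ?mxE.
- exact: diag.
- by move=> r i j ij; rewrite ent Foff ?mxE.
- exact: diag.
Qed.

End GaussBlocks.

(** Up to products of two factors of positive degree, T(u) is F(u) + D(u) + E(u),
    and the three summands have disjoint supports. The degrees d and d' are those
    of a coefficient and of such a product. *)
Section LeadingTerms.
Variables (K : comNzRingType) (A : algType K) (I : choiceType) (x : I -> A) (w : I -> nat).
Variables (d d' : nat -> nat).
Hypotheses (dd' : forall r, (d' r <= d r)%N)
  (dM : forall r s, (0 < r)%N -> (0 < s)%N -> (d r + d s - 1 <= d' (r + s))%N).
Variables (m : nat) (nu : 'I_m -> nat).
Local Notation n := (\sum_a nu a)%N.
Variables (T F D E : nat -> 'M[A]_n).
Hypotheses (T0 : T 0%N = 1%:M) (TFDE : gauss_factorization T F D E).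
Hypothesis Tfil : forall r i j, (0 < r)%N -> fil x w (d r) (T r i j).

Let BG := gauss_block_gauss T0 TFDE.
Let mxfil r (M : 'M[A]_n) := forall i j, fil x w (d r) (M i j).

Lemma scross_fil r (f g : nat -> 'M[A]_n) :
    (forall t, (0 < t)%N -> (t < r)%N -> mxfil t (f t) /\ mxfil t (g t)) ->
  forall i j, fil x w (d' r) (scross f g r i j).
Proof.
move=> fg i j; rewrite /scross summxE big_nat_cond; apply: wspan_sum => t.
move=> /andP[/andP[t0 tr] _]; rewrite mxE; apply: wspan_sum => k _.
have rt : (0 < r - t)%N by rewrite subn_gt0.
have rt' : (r - t < r)%N by lia.
have [ft _] := fg t t0 tr; have [_ gt] := fg (r - t)%N rt rt'.
apply: fil_mul_any (ft i k) (gt k j) => _ _.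
by rewrite -{2}(subnKC (ltnW tr)); apply: dM.
Qed.

Lemma gauss_leading r i j : (0 < r)%N ->
  [/\ fil x w (d r) (F r i j), fil x w (d r) (D r i j), fil x w (d r) (E r i j)
    & [/\ (blk j < blk i)%N -> fil x w (d' r) (F r i j - T r i j),
          blk i = blk j -> fil x w (d' r) (D r i j - T r i j)
        & (blk i < blk j)%N -> fil x w (d' r) (E r i j - T r i j)]].
Proof.
elim/ltn_ind: r i j => r IH i j r0.
have D0 := bg_Dconst BG; have E0 := bg_Econst BG; have F0 := bg_Fconst BG.
have FDt t : (0 < t)%N -> (t < r)%N -> mxfil t (F t) /\ mxfil t (D t).
  by move=> t0 tr; split=> a b; have [] := IH t tr a b t0.
have FDEt t : (0 < t)%N -> (t < r)%N -> mxfil t (smul F D t) /\ mxfil t (E t).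
  move=> t0 tr; split=> a b; last by have [] := IH t tr a b t0.
  have [Ft Dt _ _] := IH t tr a b t0.
  rewrite smulE // !mxE; apply: wspan_add; first exact: wspan_add.
  apply: filS (dd' t) (scross_fil _ a b) => t' t'0 t't.
  by apply: FDt => //; apply: ltn_trans t't tr.
pose X := scross F D r + scross (smul F D) E r.
have TE : T r i j = F r i j + D r i j + E r i j + X i j.
  by rewrite (gauss_mul TFDE) smul3E // !mxE.
have Xfil : fil x w (d' r) (X i j).
  by rewrite mxE; apply: wspan_add; apply: scross_fil.
have low y : y - T r i j = - X i j ->
    fil x w (d' r) (y - T r i j) /\ fil x w (d r) y.
  move=> yT; have H : fil x w (d' r) (y - T r i j) by rewrite yT; apply: wspan_opp.
  split=> //; rewrite -[y](subrK (T r i j)); apply: wspan_add; last exact: Tfil.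
  exact: filS (dd' r) H.
have fil0 e : fil x w e 0 by apply: Wspan0.
have rn0 : (r == 0)%N = false by rewrite eqn0Ngt r0.
case: (ltngtP (blk i) (blk j)) => ij.
- have Fz := bg_Foff BG r ij.
  have Dz : D r i j = 0 by apply: bg_Doff BG _ _ _ _; rewrite ltn_eqF.
  rewrite Fz Dz !add0r in TE; have [] := low (E r i j) _; first by rewrite TE opprD addNKr.
  by move=> H1 H2; rewrite Fz Dz; split=> //; split=> // /eqP; rewrite ltn_eqF.
- have Ez := bg_Eoff BG r ij.
  have Dz : D r i j = 0 by apply: bg_Doff BG _ _ _ _; rewrite gtn_eqF.
  rewrite Ez Dz !addr0 in TE; have [] := low (F r i j) _; first by rewrite TE opprD addNKr.
  by move=> H1 H2; rewrite Ez Dz; split=> //; split=> // /eqP; rewrite gtn_eqF.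
- have Ez := bg_Ediag BG r ij; have Fz := bg_Fdiag BG r ij.
  rewrite Ez Fz rn0 /= mulr0n addr0 add0r in TE *.
  by have [|H1 H2] := low (D r i j) _; first by rewrite TE opprD addNKr.
Qed.

End LeadingTerms.

(** * The bases *)

Local Open Scope classical_set_scope.

Section Positions.
Variables (m : nat) (nu : 'I_m -> nat).
Local Notation n := (\sum_a nu a)%N.

(** The letter T_ij^(r+1) that is the leading term of a given D, E or F. *)
Definition posD (x : indexD nu) : ygen n :=
  let: existT a (i, j, r) := x in (tagnat.Rank a i, tagnat.Rank a j, r).
Definition posE (x : indexE nu) : ygen n :=
  let: existT p (i, j, r) := x in
  (tagnat.Rank (sval p).1 i, tagnat.Rank (sval p).2 j, r).
Definition posF (x : indexF nu) : ygen n :=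
  let: existT p (i, j, r) := x in
  (tagnat.Rank (sval p).2 i, tagnat.Rank (sval p).1 j, r).
Definition pos (x : indexD nu + indexE nu + indexF nu) : ygen n :=
  match x with inl (inl d) => posD d | inl (inr e) => posE e | inr f => posF f end.

Lemma posD_blk x : blk (posD x).1.1 = blk (posD x).1.2.
Proof. by case: x => a [[i j] r]; rewrite !blk_Rank. Qed.
Lemma posE_blk x : (blk (posE x).1.1 < blk (posE x).1.2)%N.
Proof. by case: x => p [[i j] r]; rewrite !blk_Rank; apply: (valP p). Qed.
Lemma posF_blk x : (blk (posF x).1.2 < blk (posF x).1.1)%N.
Proof. by case: x => p [[i j] r]; rewrite !blk_Rank; apply: (valP p). Qed.

Lemma Rank_block a b (i : 'I_(nu a)) (j : 'I_(nu b)) :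
  tagnat.Rank a i = tagnat.Rank b j -> a = b.
Proof. by move=> ij; rewrite -(tagnat.Rank1K i) ij tagnat.Rank1K. Qed.

Lemma Rank_inj a (i j : 'I_(nu a)) : tagnat.Rank a i = tagnat.Rank a j -> i = j.
Proof. by move/eqP; rewrite Rank_eqE eq_Tagged => /eqP. Qed.

Lemma posD_inj : injective posD.
Proof.
case=> a [[i j] r] [b [[i' j'] r']] H.
have Hi := congr1 (fun l : ygen n => l.1.1) H; have Hj := congr1 (fun l : ygen n => l.1.2) H.
have /= -> := congr1 (fun l : ygen n => l.2) H; move: Hi Hj => /= {H} Hi Hj.
have ab := Rank_block Hi; case: _ / ab in i' j' Hi Hj *.
by rewrite (Rank_inj Hi) (Rank_inj Hj).
Qed.
Lemma posE_inj : injective posE.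
Proof.
case=> p [[i j] r] [q [[i' j'] r']] H.
have Hi := congr1 (fun l : ygen n => l.1.1) H; have Hj := congr1 (fun l : ygen n => l.1.2) H.
have /= -> := congr1 (fun l : ygen n => l.2) H; move: Hi Hj => /= {H} Hi Hj.
have pq : p = q.
  apply: val_inj; rewrite [LHS]surjective_pairing [RHS]surjective_pairing.
  by rewrite (Rank_block Hi) (Rank_block Hj).
case: _ / pq in i' j' Hi Hj *.
by rewrite (Rank_inj Hi) (Rank_inj Hj).
Qed.
Lemma posF_inj : injective posF.
Proof.
case=> p [[i j] r] [q [[i' j'] r']] H.
have Hi := congr1 (fun l : ygen n => l.1.1) H; have Hj := congr1 (fun l : ygen n => l.1.2) H.
have /= -> := congr1 (fun l : ygen n => l.2) H; move: Hi Hj => /= {H} Hi Hj.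
have pq : p = q.
  apply: val_inj; rewrite [LHS]surjective_pairing [RHS]surjective_pairing.
  by rewrite (Rank_block Hi) (Rank_block Hj).
case: _ / pq in i' j' Hi Hj *.
by rewrite (Rank_inj Hi) (Rank_inj Hj).
Qed.

Lemma pos_inj : injective pos.
Proof.
move=> [[x|x]|x] [[y|y]|y] /= H.
- by rewrite (posD_inj H).
- by have := posE_blk y; rewrite -H posD_blk ltnn.
- by have := posF_blk y; rewrite -H posD_blk ltnn.
- by have := posE_blk x; rewrite H posD_blk ltnn.
- by rewrite (posE_inj H).
- by have := ltn_trans (posE_blk x) _; rewrite H => /(_ _ (posF_blk y)); rewrite ltnn.
- by have := posF_blk x; rewrite H posD_blk ltnn.
- by have := ltn_trans (posE_blk y) _; rewrite -H => /(_ _ (posF_blk x)); rewrite ltnn.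
- by rewrite (posF_inj H).
Qed.

Lemma posD_surj i j r : blk i = blk j -> exists x, posD x = (i, j, r).
Proof.
rewrite -(tagnat.sig2K i) -(tagnat.sig2K j) !blk_Rank => ab.
move: (tagnat.sig2 i) (tagnat.sig2 j); rewrite (val_inj ab) => i' j'.
by exists (existT _ (tagnat.sig1 j) (i', j', r)).
Qed.
Lemma posE_surj i j r : (blk i < blk j)%N -> exists x, posE x = (i, j, r).
Proof.
move=> ij; pose p : block_pair m := exist _ (tagnat.sig1 i, tagnat.sig1 j) ij.
exists (existT _ p (tagnat.sig2 i, tagnat.sig2 j, r)).
by rewrite /= !tagnat.sig2K.
Qed.
Lemma posF_surj i j r : (blk j < blk i)%N -> exists x, posF x = (i, j, r).
Proof.
move=> ij; pose p : block_pair m := exist _ (tagnat.sig1 j, tagnat.sig1 i) ij.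
exists (existT _ p (tagnat.sig2 i, tagnat.sig2 j, r)).
by rewrite /= !tagnat.sig2K.
Qed.

End Positions.

Section ParabolicPBW.
Variables (K : numFieldType) (m : nat) (nu : 'I_m -> nat).
Hypothesis nu_gt0 : forall a, (0 < nu a)%N.
Local Notation n := (\sum_a nu a)%N.
Local Notation Y := (yangian K n).
Local Notation T := (@yangianT_series K n).
Local Notation F := (@yangianF K m nu).
Local Notation D := (@yangianD K m nu).
Local Notation E := (@yangianE K m nu).
Local Notation x := (@genT K n).

Let T0 : T 0%N = 1%:M := yangianT_series0 K n.
Let BG := gauss_block_gauss T0 (yangian_gauss K nu).
Let RT := @yangian_yrtt K n.

Let op_RT : yrtt (series_mx (opseq T)).
Proof.
apply: op_yrtt => i j h k r s.
rewrite (eq_yangian_relator (T' := @yangianT K n)); first exact: yangianT_relation.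
by move=> a b c; rewrite mxE.
Qed.

Lemma coefDE a (i j : 'I_(nu a)) r :
  Defs.coefD K i j r = D r (tagnat.Rank a i) (tagnat.Rank a j).
Proof. exact: submxblockE. Qed.
Lemma coefEE a b (i : 'I_(nu a)) (j : 'I_(nu b)) r :
  Defs.coefE K i j r = E r (tagnat.Rank a i) (tagnat.Rank b j).
Proof. exact: submxblockE. Qed.
Lemma coefFE a b (i : 'I_(nu b)) (j : 'I_(nu a)) r :
  Defs.coefF K i j r = F r (tagnat.Rank b i) (tagnat.Rank a j).
Proof. exact: submxblockE. Qed.

Lemma familyDE q : @familyD K m nu q = D (posD q).2.+1 (posD q).1.1 (posD q).1.2.
Proof. by case: q => a [[i j] r]; apply: coefDE. Qed.
Lemma familyEE q : @familyE K m nu q = E (posE q).2.+1 (posE q).1.1 (posE q).1.2.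
Proof. by case: q => a [[i j] r]; apply: coefEE. Qed.
Lemma familyFE q : @familyF K m nu q = F (posF q).2.+1 (posF q).1.1 (posF q).1.2.
Proof. by case: q => a [[i j] r]; apply: coefFE. Qed.

Lemma family_leading q :
  fil x (@loop_weight n) (loop_weight (pos q)) (familyDEF K q - x (pos q)).
Proof.
have Tf r i j : (0 < r)%N -> fil x (@loop_weight n) (2 * r) (T r i j).
  case: r => // r _; rewrite mxE.
  by apply: filS (fil_gen x (@loop_weight n) (i, j, r)); rewrite /loop_weight /=; lia.
have dd' r : (2 * r - 1 <= 2 * r)%N by lia.
have dM r s : (0 < r)%N -> (0 < s)%N -> (2 * r + 2 * s - 1 <= 2 * (r + s) - 1)%N by lia.
have L i j r := gauss_leading dd' dM T0 (yangian_gauss K nu) Tf i j (ltn0Sn r).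
have TE (l : ygen n) : x l = T l.2.+1 l.1.1 l.1.2 by rewrite mxE.
have we (l : ygen n) : loop_weight l = (2 * l.2.+1 - 1)%N by case: l => ij r; rewrite /loop_weight /=; lia.
rewrite TE we; case: q => [[q|q]|q] /=.
- rewrite familyDE; have [_ _ _ [_ H _]] := L (posD q).1.1 (posD q).1.2 (posD q).2.
  by apply: H; apply: posD_blk.
- rewrite familyEE; have [_ _ _ [_ _ H]] := L (posE q).1.1 (posE q).1.2 (posE q).2.
  by apply: H; apply: posE_blk.
- rewrite familyFE; have [_ _ _ [H _ _]] := L (posF q).1.1 (posF q).1.2 (posF q).2.
  by apply: H; apply: posF_blk.
Qed.

Lemma family_indep (J : choiceType) (f : J -> indexD nu + indexE nu + indexF nu)
    (X : J -> Y) (le : rel J) : injective f -> (forall j, X j = familyDEF K (f j)) ->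
  total_order le -> lin_indep (@ordered_monomial K Y J X le).
Proof.
move=> f_inj Xf [_ le_anti le_tr _].
have w0 (l : ygen n) : (0 < loop_weight l)%N by rewrite /loop_weight addn1.
have H := @ordered_monomials_indep K Y (ygen n) x (@loop_weight n) w0 (@partial K n)
  (@partialD K n) (@partialZ K n) (@partial_mon K n) J X (@pos m nu \o f) le.
apply: H => //; first exact: inj_comp (@pos_inj m nu) f_inj.
by move=> j; rewrite Xf; apply: family_leading.
Qed.

Lemma D_basis : ordered_monomials_basis (@familyD K m nu) (@subalgD K m nu).
Proof.
move=> le tle; split.
  by apply: (@family_indep _ (inl \o inl)) => // q q' [].
pose w (q : indexD nu) := (posD q).2.+1.
have GD r i j : fil (@familyD K m nu) w r.+1 (D r i j).
  case: r => [|r]; first by rewrite (bg_Dconst BG) mxE; apply: fil_bool.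
  case: (blk i =P blk j) => [ij|/eqP ij]; last first.
    by rewrite (bg_Doff BG) //; apply: Wspan0.
  have [q qE] := posD_surj r ij.
  by have := fil_gen (@familyD K m nu) w q; rewrite familyDE /w qE.
apply: (span_ordered_monomials (w := w)) => //.
- move=> q q'; rewrite !familyDE.
  have := D_commutator BG RT (fil_filtration (@familyD K m nu) w) GD
    (posD q).1.1 (posD q).1.2 (posD q').1.1 (posD q').1.2 (posD q).2.+1 (posD q').2.+1.
  by apply: filS; rewrite /w; lia.
- move=> [a [[i j] r]]; apply: sub_generated; by exists a, i, j, r.+1.
- move=> _ [a [i [j [r ->]]]]; exists r.+1; rewrite coefDE; exact: GD.
Qed.

Let next_index (b : nat) (j : 'I_n) : (b < blk j)%N -> exists h : 'I_n, blk h = b.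
Proof.
move=> bj; have bm : (b < m)%N by apply: ltn_trans bj (ltn_ord _).
by exists (tagnat.Rank (Ordinal bm) (Ordinal (nu_gt0 (Ordinal bm)))); rewrite blk_Rank.
Qed.

Let commutator_generated (S : set Y) u v : generated_subalg S u -> generated_subalg S v ->
  generated_subalg S (u * v - v * u).
Proof.
have [_ GL GM] := @generated_subalg_closed K Y S.
move=> Su Sv; have uv : u * v \in generated_subalg S by apply: GM; rewrite inE.
have vu : v * u \in generated_subalg S by apply: GM; rewrite inE.
by have := GL (-1) _ _ vu uv; rewrite scaleN1r addrC inE.
Qed.

(** E_adjacent with h in the block just before that of j, where there is an index
    as no nu_a is 0, reduces the distance of the blocks by one. *)
Lemma E_basis : ordered_monomials_basis (@familyE K m nu) (@subalgE K m nu).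
Proof.
move=> le tle; split.
  by apply: (@family_indep _ (inl \o inr)) => // q q' [].
pose w (q : indexE nu) := (posE q).2.+1.
have GE r i j : fil (@familyE K m nu) w r.+1 (E r i j).
  case: r => [|r]; first by rewrite (bg_Econst BG) mxE; apply: fil_bool.
  case: (ltngtP (blk i) (blk j)) => ij.
  - have [q qE] := posE_surj r ij.
    by have := fil_gen (@familyE K m nu) w q; rewrite familyEE /w qE.
  - by rewrite (bg_Eoff BG) //; apply: Wspan0.
  - by rewrite (bg_Ediag BG) //; apply: Wspan0.
have gen k r i j : blk j = (blk i + k.+1)%N -> @subalgE K m nu (E r.+1 i j).
  elim: k r i j => [|k IH] r i j ij.
    apply: sub_generated; exists (tagnat.sig1 i), (tagnat.sig1 j),
      (tagnat.sig2 i), (tagnat.sig2 j), r.+1.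
    split=> //; first by rewrite -[LHS]/(blk j) ij addn1.
    by rewrite coefEE !tagnat.sig2K.
  have [h hb] : exists h : 'I_n, blk h = (blk i + k.+1)%N.
    by apply: (@next_index _ j); rewrite ij; lia.
  rewrite -(E_adjacent BG RT (i := i) (j := h) (k := j)) ?hb ?ij; try lia.
  apply: commutator_generated; first exact: IH.
  apply: sub_generated; exists (tagnat.sig1 h), (tagnat.sig1 j),
    (tagnat.sig2 h), (tagnat.sig2 j), 1%N.
  split=> //; first by rewrite -[LHS]/(blk j) -[tagnat.sig1 h : nat]/(blk h) ij hb; lia.
  by rewrite coefEE !tagnat.sig2K.
apply: (span_ordered_monomials (w := w)) => //.
- move=> q q'; rewrite !familyEE.
  have := E_commutator BG RT (fil_filtration (@familyE K m nu) w) GE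
    (posE q).1.1 (posE q).1.2 (posE q').1.1 (posE q').1.2 (posE q).2.+1 (posE q').2.+1.
  by apply: filS; rewrite /w; lia.
- move=> q; rewrite familyEE; have bq := posE_blk q.
  by apply: (gen (blk (posE q).1.2 - blk (posE q).1.1).-1); lia.
- move=> _ [a [b [i [j [r [_ _ ->]]]]]]; exists r.+1.
  by rewrite coefEE; apply: GE.
Qed.

Let op_BG := op_block_gauss BG.

(** Over the opposite ring the transpose of F is the upper triangular factor. *)
Lemma F_basis : ordered_monomials_basis (@familyF K m nu) (@subalgF K m nu).
Proof.
move=> le tle; split.
  by apply: (@family_indep _ inr) => // q q' [].
pose w (q : indexF nu) := (posF q).2.+1.
have GF r i j : fil (@familyF K m nu) w r.+1 (F r i j).
  case: r => [|r]; first by rewrite (bg_Fconst BG) mxE; apply: fil_bool.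
  case: (ltngtP (blk j) (blk i)) => ij.
  - have [q qE] := posF_surj r ij.
    by have := fil_gen (@familyF K m nu) w q; rewrite familyFE /w qE.
  - by rewrite (bg_Foff BG) //; apply: Wspan0.
  - by rewrite (bg_Fdiag BG) //; apply: Wspan0.
have gen k r i j : blk i = (blk j + k.+1)%N -> @subalgF K m nu (F r.+1 i j).
  elim: k r i j => [|k IH] r i j ij.
    apply: sub_generated; exists (tagnat.sig1 j), (tagnat.sig1 i),
      (tagnat.sig2 i), (tagnat.sig2 j), r.+1.
    split=> //; first by rewrite -[LHS]/(blk i) ij addn1.
    by rewrite coefFE !tagnat.sig2K.
  have [h hb] : exists h : 'I_n, blk h = (blk j + k.+1)%N.
    by apply: (@next_index _ i); rewrite ij; lia.
  have := E_adjacent op_BG op_RT (i := j) (j := h) (k := i) r.+1.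
  rewrite ?hb ?ij => /(_ _ _)/esym; rewrite /opseq !mxE => ->; try lia.
  apply: (commutator_generated (u := F 1%N i h) (v := F r.+1 h j)); last exact: IH.
  apply: sub_generated; exists (tagnat.sig1 h), (tagnat.sig1 i),
    (tagnat.sig2 i), (tagnat.sig2 h), 1%N.
  split=> //; first by rewrite -[LHS]/(blk i) -[tagnat.sig1 h : nat]/(blk h) ij hb; lia.
  by rewrite coefFE !tagnat.sig2K.
apply: (span_ordered_monomials (w := w)) => //.
- move=> q q'; rewrite !familyFE.
  have := E_commutator op_BG op_RT (op_filtration (fil_filtration (@familyF K m nu) w))
    (fun r i j => _) (posF q').1.2 (posF q').1.1 (posF q).1.2 (posF q).1.1
    (posF q').2.+1 (posF q).2.+1.
  rewrite /opseq !mxE => /(_ (fun r i j => _)) H.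
  apply: filS (H _); first by rewrite /w; lia.
  by move=> r i j; rewrite mxE; apply: GF.
- move=> q; rewrite familyFE; have bq := posF_blk q.
  by apply: (gen (blk (posF q).1.1 - blk (posF q).1.2).-1); lia.
- move=> _ [a [b [i [j [r [_ _ ->]]]]]]; exists r.+1.
  by rewrite coefFE; apply: GF.
Qed.

Local Notation XA := (@familyDEF K m nu).
Let wA (q : indexD nu + indexE nu + indexF nu) : nat := (pos q).2.+1.

Let entryA r i j :
  [/\ fil XA wA r.+1 (F r i j), fil XA wA r.+1 (D r i j) & fil XA wA r.+1 (E r i j)].
Proof.
case: r => [|r].
  rewrite (bg_Fconst BG) (bg_Dconst BG) (bg_Econst BG) mxE; split; exact: fil_bool.
case: (ltngtP (blk i) (blk j)) => ij.
- have [q qE] := posE_surj r ij; split.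
  + by rewrite (bg_Foff BG) //; apply: Wspan0.
  + by rewrite (bg_Doff BG) ?ltn_eqF //; apply: Wspan0.
  + by have := fil_gen XA wA (inl (inr q)); rewrite /= familyEE /wA /= qE.
- have [q qE] := posF_surj r ij; split.
  + by have := fil_gen XA wA (inr q); rewrite /= familyFE /wA /= qE.
  + by rewrite (bg_Doff BG) ?gtn_eqF //; apply: Wspan0.
  + by rewrite (bg_Eoff BG) //; apply: Wspan0.
- have [q qE] := posD_surj r ij; split.
  + by rewrite (bg_Fdiag BG) //; apply: Wspan0.
  + by have := fil_gen XA wA (inl (inl q)); rewrite /= familyDE /wA /= qE.
  + by rewrite (bg_Ediag BG) //; apply: Wspan0.
Qed.

Let T_in_XA r i j : fil XA wA r.+1 (T r i j).
Proof.
have GG := fil_filtration XA wA.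
have smul_fil (f g : nat -> 'M[Y]_n) : (forall r i j, fil XA wA r.+1 (f r i j)) ->
    (forall r i j, fil XA wA r.+1 (g r i j)) -> forall r i j, fil XA wA r.+1 (smul f g r i j).
  move=> ff fg r' i' j'; rewrite /smul summxE; apply: wspan_sum => t _.
  rewrite mxE; apply: wspan_sum => k _.
  have tr : (t <= r')%N by rewrite -ltnS.
  by have := filtrationM GG (ff t i' k) (fg (r' - t)%N k j'); rewrite subnKC.
rewrite (gauss_mul (yangian_gauss K nu)); apply: (smul_fil _ _ (smul_fil _ _ _ _)).
- by move=> r' i' j'; case: (entryA r' i' j').
- by move=> r' i' j'; case: (entryA r' i' j').
- by move=> r' i' j'; case: (entryA r' i' j').
Qed.

Let fil_T_XA e y : fil x (@canonical_weight n) e y -> fil XA wA e y.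
Proof.
elim=> [|c s z se _ IHz]; first exact: Wspan0.
apply: wspan_add => //; apply: wspan_scale.
suff H : fil XA wA (wt (@canonical_weight n) s).+1 (mon x s) by apply: filS H.
elim: s {se} => [|l s IH].
  by rewrite /mon /wt !big_nil; apply: (fil_bool XA wA true).
rewrite mon_cons wt_cons; apply: (filtrationM (fil_filtration XA wA)) => //.
by have := T_in_XA l.2.+1 l.1.1 l.1.2; rewrite mxE.
Qed.

(** The canonical weight, where T_ij^(r) has degree r, makes the Yangian
    commutative up to lower degree, and T = FDE is homogeneous. *)
Lemma DEF_basis : ordered_monomials_basis XA [set: Y].
Proof.
move=> le tle; split; first by apply: (@family_indep _ id).
have -> : [set: Y]%classic = generated_subalg [set: Y]%classic.
  by rewrite predeqE => y; split=> // _; apply: sub_generated.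
apply: (span_ordered_monomials (w := wA)) => //.
- have Tf r i j : (0 < r)%N -> fil x (@canonical_weight n) r.+1 (T r i j).
    case: r => // r _; rewrite mxE.
    by have := fil_gen x (@canonical_weight n) (i, j, r).
  have dM r s : (0 < r)%N -> (0 < s)%N -> (r.+1 + s.+1 - 1 <= (r + s).+1)%N by lia.
  have L i j r := gauss_leading (fun r => leqnn r.+1) dM T0 (yangian_gauss K nu) Tf i j (ltn0Sn r).
  have Xc q : fil x (@canonical_weight n) (wA q).+1 (XA q).
    case: q => [[q|q]|q] /=.
    + by rewrite familyDE; case: (L (posD q).1.1 (posD q).1.2 (posD q).2).
    + by rewrite familyEE; case: (L (posE q).1.1 (posE q).1.2 (posE q).2).
    + by rewrite familyFE; case: (L (posF q).1.1 (posF q).1.2 (posF q).2).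
  by move=> q q'; apply: fil_T_XA; apply: fil_comm => //; apply: yangianT_comm_can.
- by move=> q; apply: sub_generated.
- by move=> y _; have [e He] := yangian_words (@canonical_weight n) y; exists e; apply: fil_T_XA.
Qed.

End ParabolicPBW.

Theorem theoremB (R : realType) (m : nat) (nu : 'I_m -> nat)
    (n_ge1 : (1 <= \sum_a nu a)%N) (nu_gt0 : forall a : 'I_m, (0 < nu a)%N) :
  [/\ ordered_monomials_basis (@familyD R[i] m nu) (@subalgD R[i] m nu),
      ordered_monomials_basis (@familyE R[i] m nu) (@subalgE R[i] m nu),
      ordered_monomials_basis (@familyF R[i] m nu) (@subalgF R[i] m nu)
    & ordered_monomials_basis (@familyDEF R[i] m nu) [set: yangian R[i] (\sum_a nu a)]].
Proof.
split; [exact: D_basis|exact: E_basis|exact: F_basis|exact: DEF_basis].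
Qed.
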